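(* The following Banach spaces admit overcomplete sets (in ZFC): (1) every WLD Banach space of density $\omega_1$; in particular: (a) $\ell_p(\omega_1)$ and $L_p(\{0,1\}^{\omega_1})$ for $p\in(1,\infty)$; (b) $L_1(\{0,1\}^{\omega_1})$; (c) $c_0(\omega_1)$; (d) the spaces $C(K)$ of density $\omega_1$ for $K$ a Corson compact space on which all Radon measures have separable supports; (2) $C([0,\omega_1])$, where $[0,\omega_1]$ carries the order topology; (3) $C(K)$, where $K$ is the (Hausdorff) one-point compactification of a locally compact refinement of the order topology on $[0,\omega_1)$ obtained by isolating all points of some subset of $[0,\omega_1)$.
   Context: All Banach spaces are infinite dimensional and over the reals; all topological spaces are Hausdorff. $dens(X)$ is the minimal cardinality of a norm dense subset of $X$. A subset $Y$ of a Banach space $X$ is called overcomplete (in $X$) if $|Y|=dens(X)$ and every $Z\subseteq Y$ with $|Z|=|Y|$ is linearly dense in $X$ (its linear span is norm dense in $X$). $X$ admits an overcomplete set if such a $Y$ exists. A Banach space $X$ is WLD (weakly Lindelöf determined) if it admits a linearly dense set $D\subseteq X$ such that $\{d\in D: x^*(d)\neq 0\}$ is countable for each $x^*\in X^*$. $C(K)$ is the space of real-valued continuous functions on the compact Hausdorff space $K$ with the supremum norm. $L_p(\{0,1\}^{\kappa})$ means $L_p(\mu)$ for $\mu$ the homogeneous probability product measure on $\{0,1\}^\kappa$. A compact space is Corson if it is homeomorphic to a subspace of some $\{x\in\mathbb{R}^\Gamma: \{\gamma: x(\gamma)\ne0\}\text{ is countable}\}$ with the product topology. Isolating all points of a set $S\subseteq[0,\omega_1)$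 means taking the topology generated by the order topology together with all singletons $\{\alpha\}$, $\alpha\in S$. *)

(* Defs.v *)
From HB Require Import structures.
From mathcomp Require Import all_boot all_order all_algebra finmap.
From mathcomp Require Import generic_quotient ring_quotient.
From mathcomp Require Import all_classical all_reals all_analysis.
From mathcomp Require Import measurable_realfun interval_inference.
From mathcomp Require Import ring lra.
From mathcomp Require wochoice.

Set Implicit Arguments.
Unset Strict Implicit.
Unset Printing Implicit Defensive.

Import Order.TTheory GRing.Theory Num.Theory numFieldNormedType.Exports.

Local Open Scope classical_set_scope.
Local Open Scope ring_scope.

Section Overcomplete.
Variables (R : realType) (X : normedModType R).

Definition lspan (Z : set X) : set X :=
  [set x | exists n (c : 'I_n -> R) (z : 'I_n -> X),
     (forall i, Z (z i)) /\ x = \sum_i c i *: z i].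

Definition linearly_dense (Z : set X) : Prop := dense (lspan Z).

(* dens(X) = |A| *)
Definition has_dens (T : Type) (A : set T) : Prop :=
  (exists2 D : set X, dense D & (D #= A)%card) /\
  (forall D : set X, dense D -> (A #<= D)%card).

Definition overcomplete (Y : set X) : Prop :=
  has_dens Y /\
  (forall Z : set X, Z `<=` Y -> (Z #= Y)%card -> linearly_dense Z).

Definition admits_overcomplete : Prop := exists Y : set X, overcomplete Y.

Definition WLD : Prop :=
  exists2 D : set X, linearly_dense D &
    forall f : {linear X -> R^o}, continuous f ->
      countable [set d | D d /\ f d != 0].

End Overcomplete.

(* A well-ordering of the continuum: omega1 is its initial segment made of the
   points with countably many predecessors. *)
Definition binary_le : rel (nat -> bool) :=
  sval (wochoice.well_ordering_principle (nat -> bool)).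

Lemma binary_le_wo : wochoice.well_order binary_le.
Proof. exact: svalP (wochoice.well_ordering_principle (nat -> bool)). Qed.

Lemma binary_le_min (A : set (nat -> bool)) : A !=set0 ->
  exists2 m, A m & forall x, A x -> binary_le m x.
Proof.
move=> [x Ax]; have [|m [[+ mA] _]] := binary_le_wo (A := mem A).
  by exists x; exact/mem_set.
by move=> /set_mem Am; exists m => // y Ay; apply: mA; exact/mem_set.
Qed.

Lemma binary_le_total : total binary_le.
Proof.
move=> x y; have [|m [] /= -> h] := @binary_le_min [set x; y].
- by exists x; left.
- by apply/orP; left; apply: h; right.
- by apply/orP; right; apply: h; left.
Qed.

Lemma binary_le_refl : reflexive binary_le.
Proof. by move=> x; have := binary_le_total x x; rewrite orbb. Qed.

Lemma binary_le_anti : antisymmetric binary_le.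
Proof.
move=> x y /andP[xy yx].
have [|z [_ uz]] := binary_le_wo (A := mem [set x; y]).
  by exists x; apply/mem_set; left.
rewrite -(uz x) ?(uz y) //; split.
- by apply/mem_set; right.
- by move=> t /set_mem[] -> //; exact: binary_le_refl.
- by apply/mem_set; left.
- by move=> t /set_mem[] -> //; exact: binary_le_refl.
Qed.

Lemma binary_le_trans : transitive binary_le.
Proof.
move=> y x z xy yz; have [|m + h] := @binary_le_min [set x; y; z].
  by exists x; left; left.
have [mx my mz] : [/\ binary_le m x, binary_le m y & binary_le m z].
  by split; apply: h; [left; left|left; right|right].
case=> [[]|] /= e; first by rewrite -e.
  by have -> : x = y by apply: binary_le_anti; rewrite xy -e mx.
by have <- : y = z by apply: binary_le_anti; rewrite yz -e my.
Qed.

Definition countable_below (x : nat -> bool) : bool :=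
  `[< countable [set y | binary_le y x] >].

Definition omega1 : Type := {x : nat -> bool | countable_below x}.
HB.instance Definition _ := Choice.on omega1.

Definition omega1_le : rel omega1 := fun x y => binary_le (val x) (val y).

Fact omega1_display : Order.disp_t. Proof. exact: Order.Disp tt tt. Qed.

Lemma omega1_le_refl : reflexive omega1_le.
Proof. by move=> x; exact: binary_le_refl. Qed.

Lemma omega1_le_anti : antisymmetric omega1_le.
Proof. by move=> x y xy; apply: val_inj; exact: binary_le_anti. Qed.

Lemma omega1_le_trans : transitive omega1_le.
Proof. by move=> y x z; exact: binary_le_trans. Qed.

Lemma omega1_le_total : total omega1_le.
Proof. by move=> x y; exact: binary_le_total. Qed.

HB.instance Definition _ := Order.Le_isPOrder.Build omega1_display omega1
  omega1_le_refl omega1_le_anti omega1_le_trans.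
HB.instance Definition _ :=
  Order.POrder_isTotal.Build omega1_display omega1 omega1_le_total.

(* omega1_min, omega1_countable_below and omega1_uncountable characterize the
   order type omega1. *)
Lemma omega1_min (A : set omega1) : A !=set0 ->
  exists2 m, A m & forall x, A x -> (m <= x)%O.
Proof.
move=> [x Ax]; have [|_ [m Am <-] h] := @binary_le_min (val @` A).
  by exists (val x); exists x.
by exists m => // y Ay; apply: h; exists y.
Qed.

Lemma omega1_countable_below (x : omega1) :
  countable [set y : omega1 | (y <= x)%O].
Proof.
have /asboolP/countable_injP[f finj] := valP x.
apply/countable_injP; exists (f \o val) => y z /set_mem yx /set_mem zx /=.
by move/finj => /(_ _ _)/val_inj; apply; exact/mem_set.
Qed.

Lemma omega1_uncountable : ~ countable [set: omega1].
Proof.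
have binary_unc : ~ countable [set: nat -> bool].
  move=> /countable_injP[f finj].
  pose d n := ~~ `[< exists2 b : nat -> bool, f b = n & b n >].
  have : d (f d) = ~~ d (f d).
    rewrite {1}/d; congr (~~ _); apply/asboolP/idP => [[b fb]|dd].
      by have <- : b = d by apply: finj => //; exact/mem_set.
    by exists d.
  by case: (d _).
move=> unc.
have unc' : countable [set x | countable_below x].
  have /countable_injP[f finj] := unc.
  pose g (x : nat -> bool) := if insub x is Some u then f (u : omega1) else 0.
  apply/countable_injP; exists g => x y /set_mem /= xb /set_mem /= yb.
  rewrite /g !insubT => /finj E.
  by have [] : Sub x xb = Sub y yb :> omega1 by apply: E; exact/mem_set.
have [all|] := pselect (forall x, countable_below x).
  by apply: binary_unc; apply: sub_countable unc'; apply: subset_card_le => x _; exact: all.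
move=> /existsNP[x0 nx0].
have [|m /= nm h] := @binary_le_min [set x | ~ countable_below x]; first by exists x0.
apply: nm; apply/asboolP.
have : countable (\bigcup_(b in [set: bool])
    if b then [set x | countable_below x] else [set m]).
  by apply: bigcup_countable => // -[] _ //; exact: countable1.
apply: sub_countable; apply: subset_card_le => y /= ym.
have [yb|nyb] := pselect (countable_below y); [by exists true|exists false => //].
by apply: binary_le_anti; rewrite ym h.
Qed.

(* omega1 + 1, i.e. the interval [0, omega1]: None is the added top element.
   The topological space [0, omega1] is order_topology omega1_succ. *)
Definition omega1_succ : Type := option omega1.
HB.instance Definition _ := Choice.on omega1_succ.

Definition omega1_succ_le : rel omega1_succ := fun x y =>
  match x, y with
  | _, None => true
  | None, Some _ => false
  | Some a, Some b => (a <= b)%O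
  end.

Lemma omega1_succ_le_refl : reflexive omega1_succ_le.
Proof. by case=> //= a. Qed.

Lemma omega1_succ_le_anti : antisymmetric omega1_succ_le.
Proof. by move=> [a|] [b|] //= /le_anti ->. Qed.

Lemma omega1_succ_le_trans : transitive omega1_succ_le.
Proof. by move=> [b|] [a|] [c|] //=; exact: le_trans. Qed.

Lemma omega1_succ_le_total : total omega1_succ_le.
Proof. by move=> [a|] [b|] //=; exact: le_total. Qed.

HB.instance Definition _ := Order.Le_isPOrder.Build omega1_display omega1_succ
  omega1_succ_le_refl omega1_succ_le_anti omega1_succ_le_trans.
HB.instance Definition _ :=
  Order.POrder_isTotal.Build omega1_display omega1_succ omega1_succ_le_total.

Lemma omega1_succ_min (A : set omega1_succ) : A !=set0 ->
  exists2 m, A m & forall x, A x -> (m <= x)%O.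
Proof.
move=> [x Ax]; have [nA|] := pselect (exists a, A (Some a)).
  have [|m Am h] := @omega1_min [set a | A (Some a)]; first exact: nA.
  by exists (Some m) => // -[a Aa|//]; exact: h.
by case: x Ax => [a Aa []|AN nA]; [exists a|exists None => // -[a Aa|//]; case: nA; exists a].
Qed.

Lemma omega1_succ_compact : compact [set: order_topology omega1_succ].
Proof.
apply/compact_near_coveringP => I F P FF cov.
pose good x := F [set i | forall y : order_topology omega1_succ,
  (y <= x)%O -> P i y].
suff : good None by apply: filterS => i h y _; apply: h; case: y.
apply: contrapT => bad.
have [|m /= badm h] := @omega1_succ_min [set x | ~ good x]; first by exists None.
apply: badm; have [[U V] /= [+ FV] UVP] := cov m Logic.I.
rewrite itv_nbhsE => -[[l r] [oi mi] sub].
have near_ok i y : V i -> (y <= m)%O -> (l <= BLeft y)%O -> P i y.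
  move=> Vi ym ly; apply: (UVP (y, i)); split => //=; apply: sub.
  move: mi; rewrite /= !itv_boundlr ly /= => /andP[_].
  by apply: le_trans; rewrite bnd_simp.
case: l mi oi sub near_ok => [[] a|[]] mi oi sub near_ok.
- by move: oi; case: r {mi sub} => [[]|[]].
- have am : (a < m)%O by move: mi; rewrite itv_boundlr bnd_simp => /andP[].
  have : good a by apply: contrapT => /h; rewrite leNgt am.
  move=> ga; apply: filterS2 FV ga => i Vi ga y ym.
  have [/ga//|ay] := leP y a.
  by apply: near_ok => //; rewrite bnd_simp.
- by apply: filterS FV => i Vi y ym; exact: near_ok.
- by move: mi; rewrite itv_boundlr.
Qed.

(* [0, omega1) with the topology generated by the order topology and the
   singletons of S *)
Definition omega1_isolating (S : set omega1) : Type := omega1.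

Section Isolated.
Variable S : set omega1.
HB.instance Definition _ := Choice.on (omega1_isolating S).
HB.instance Definition _ := @isSubBaseTopological.Build (omega1_isolating S)
  (set omega1)
  (@open (order_topology omega1) `|` [set [set a] | a in S])
  id.
End Isolated.

Section SupNorm.
Variables (R : realType) (T : Type).
Implicit Types f g : T -> R.

(* sup set0 = 0, so that this is the zero norm when T is empty *)
Definition supnorm f : R := sup [set `|f t| | t in [set: T]].

Definition norm_bounded f : Prop := has_ubound [set `|f t| | t in [set: T]].

Lemma le_supnorm f t : norm_bounded f -> `|f t| <= supnorm f.
Proof. by move=> bf; apply: ub_le_sup => //; exists t. Qed.

Lemma supnorm_ge0 f : norm_bounded f -> 0 <= supnorm f.
Proof.
move=> bf; have [[t _]|nT] := pselect ([set: T] !=set0).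
  exact: le_trans (le_supnorm t bf).
rewrite /supnorm (_ : [set _ | _ in _] = set0) ?sup0//.
by apply/seteqP; split => // r [t _ _]; case: nT; exists t.
Qed.

Lemma supnorm_le f M : 0 <= M -> (forall t, `|f t| <= M) -> supnorm f <= M.
Proof.
move=> M0 fM; have [[t _]|nT] := pselect ([set: T] !=set0).
  by apply: ge_sup => [|_ [u _ <-]]; [exists `|f t|; exists t|].
rewrite /supnorm (_ : [set _ | _ in _] = set0) ?sup0//.
by apply/seteqP; split => // r [t _ _]; case: nT; exists t.
Qed.

Lemma supnormD f g : norm_bounded f -> norm_bounded g ->
  supnorm (f \+ g) <= supnorm f + supnorm g.
Proof.
move=> bf bg; apply: supnorm_le => [|t]; first by rewrite addr_ge0 ?supnorm_ge0.
by rewrite (le_trans (ler_normD _ _))// lerD// le_supnorm.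
Qed.

Lemma supnormZ (a : R) f : norm_bounded f ->
  supnorm (fun t => a * f t) = `|a| * supnorm f.
Proof.
move=> bf.
have le_ b g : norm_bounded g -> supnorm (fun t => b * g t) <= `|b| * supnorm g.
  move=> bg; apply: supnorm_le => [|t]; first by rewrite mulr_ge0 ?supnorm_ge0.
  by rewrite normrM ler_wpM2l// le_supnorm.
have baf : norm_bounded (fun t => a * f t).
  exists (`|a| * supnorm f) => _ [t _ <-].
  by rewrite normrM ler_wpM2l// le_supnorm.
apply/eqP; rewrite eq_le le_//=; have [->|a0] := eqVneq a 0.
  by rewrite normr0 mul0r supnorm_ge0 //; exists 0 => _ [t _ <-]; rewrite mul0r normr0.
rewrite -ler_pdivlMl ?normr_gt0//.
rewrite -normfV (le_trans _ (le_ _ _ baf))//.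
by under [X in _ <= supnorm X]eq_fun do rewrite mulKf//.
Qed.

Lemma supnorm_eq0 f : norm_bounded f -> supnorm f = 0 -> f = (fun=> 0).
Proof.
move=> bf f0; apply/funext => t; apply/normr0_eq0/eqP.
by rewrite eq_le normr_ge0 -f0 le_supnorm.
Qed.

End SupNorm.

Section C0.
Variables (T : choiceType) (R : realType).

Definition c0_pred : {pred T -> R} := mem [set x : T -> R |
  forall e : R, 0 < e -> finite_set [set t | e <= `|x t|]].

Record c0_space := MkC0_space { c0_fun :> T -> R ; c0_funP : c0_fun \in c0_pred }.

HB.instance Definition _ := [isSub for c0_fun].
HB.instance Definition _ := [Choice of c0_space by <:].

Lemma c0_submod_closed : submod_closed c0_pred.
Proof.
split=> [|a x y]; rewrite !inE /=.
  move=> e e0; rewrite (_ : [set _ | _] = set0)//; apply/seteqP; split => // t /=.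
  by rewrite normr0 leNgt e0.
move=> x0 y0 e e0; have d0 : 0 < e / 2 / (`|a| + 1).
  by rewrite !divr_gt0// ltr_wpDl.
apply: (@sub_finite_set _ _ ([set t | e / 2 / (`|a| + 1) <= `|x t|] `|`
                             [set t | e / 2 <= `|y t|])).
  move=> t /= et; have [yt|yt] := leP (e / 2) `|y t|; [by right|left].
  rewrite ler_pdivrMr ?ltr_wpDl//.
  have := ler_normD (a * x t) (y t); rewrite normrM.
  have := normr_ge0 (x t); move: et yt; rewrite /= /GRing.scale /=.
  nra.
by rewrite finite_setU; split; [exact: x0|exact/y0/divr_gt0].
Qed.
HB.instance Definition _ := GRing.isSubmodClosed.Build R (T -> R) c0_pred
  c0_submod_closed.
HB.instance Definition _ := [SubChoice_isSubLmodule of c0_space by <:].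

Lemma c0_bounded (x : c0_space) : norm_bounded x.
Proof.
have /set_mem /(_ 1 ltr01) fin1 := c0_funP x.
exists (1 + \sum_(t <- fset_set [set t | 1 <= `|x t|]) `|x t|) => _ [t _ <-].
have [t1|t1] := leP 1 `|x t|; last first.
  by rewrite (le_trans (ltW t1))// lerDl sumr_ge0.
rewrite (big_fsetD1 t)/=; last by rewrite in_fset_set// inE.
by rewrite addrCA lerDl addr_ge0// sumr_ge0.
Qed.

Lemma c0_norm_eq0 (x : c0_space) : supnorm x = 0 -> x = 0.
Proof. by move=> x0; apply: val_inj; exact: supnorm_eq0 (c0_bounded x) x0. Qed.

HB.instance Definition _ := @Lmodule_isNormed.Build R c0_space
  (fun x => supnorm x)
  (fun x y => supnormD (c0_bounded x) (c0_bounded y))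
  (fun a x => supnormZ a (c0_bounded x))
  c0_norm_eq0.

End C0.

Section ContinuousFunctions.
Variables (R : realType) (K : topologicalType) (cK : compact [set: K]).

(* The compactness proof is a parameter because the sup norm is a norm on the
   continuous functions only when K is compact. *)
Definition continuous_pred (_ : compact [set: K]) : {pred K -> R} :=
  mem [set f : K -> R | continuous f].

Record C_space := MkC_space {
  C_fun :> K -> R ;
  C_funP : C_fun \in continuous_pred cK }.

HB.instance Definition _ := [isSub for C_fun].
HB.instance Definition _ := [Choice of C_space by <:].

Lemma continuous_submod_closed : submod_closed (continuous_pred cK).
Proof.
split=> [|a f g]; rewrite !inE /=; first by move=> x; exact: cvg_cst.
by move=> cf cg x; apply: cvgD; [apply: cvgMr; exact: cf|exact: cg].
Qed.
HB.instance Definition _ := GRing.isSubmodClosed.Build R (K -> R) (continuous_pred cK)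
  continuous_submod_closed.
HB.instance Definition _ := [SubChoice_isSubLmodule of C_space by <:].

Lemma C_bounded (f : C_space) : norm_bounded f.
Proof.
have /set_mem cf := C_funP f.
have /compact_bounded[M [_ hM]] : compact (f @` [set: K]).
  by apply: continuous_compact => //; exact: continuous_subspaceT.
exists (M + 1) => _ [t _ <-]; apply: (hM (M + 1)); first by rewrite ltrDl.
by exists t.
Qed.

Lemma C_norm_eq0 (x : C_space) : supnorm x = 0 -> x = 0.
Proof. by move=> x0; apply: val_inj; exact: supnorm_eq0 (C_bounded x) x0. Qed.

HB.instance Definition _ := @Lmodule_isNormed.Build R C_space
  (fun x => supnorm x)
  (fun x y => supnormD (C_bounded x) (C_bounded y))
  (fun a x => supnormZ a (C_bounded x))
  C_norm_eq0.
End ContinuousFunctions.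

Section PowerSum.
Variables (T : choiceType) (R : realType) (p : R) (p1 : 1 <= p).
Implicit Types x y : T -> R.

Definition psum x : \bar R := (\esum_(t in [set: T]) (`|x t| `^ p)%:E)%E.

Definition ellp_norm x : R := fine (psum x) `^ p^-1.

Let p0 : 0 < p. Proof. exact: lt_le_trans p1. Qed.

Lemma psum_ge0 x : (0 <= psum x)%E.
Proof. by apply: esum_ge0 => t _; rewrite lee_fin powR_ge0. Qed.

Lemma psum_fin x : (psum x < +oo)%E -> psum x = ((ellp_norm x) `^ p)%:E.
Proof.
move=> fx; rewrite /ellp_norm -powRrM mulVf ?gt_eqF// powRr1 ?fine_ge0 ?psum_ge0//.
by rewrite fineK// ge0_fin_numE ?psum_ge0.
Qed.

Lemma ellp_norm_ge0 x : 0 <= ellp_norm x. Proof. exact: powR_ge0. Qed.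

Lemma ellp_norm_le x a : 0 <= a -> (psum x <= (a `^ p)%:E)%E -> ellp_norm x <= a.
Proof.
move=> a0 xa; have -> : a = (a `^ p) `^ p^-1.
  by rewrite -powRrM mulfV ?gt_eqF// powRr1.
rewrite ge0_ler_powR ?invr_ge0 ?nnegrE ?powR_ge0 ?fine_ge0 ?psum_ge0//.
  exact: ltW.
by rewrite -lee_fin fineK// ge0_fin_numE ?psum_ge0// (le_lt_trans xa) ?ltry.
Qed.

Let esumZ_le (c : R) (u : T -> R) : 0 <= c -> (forall t, 0 <= u t) ->
  (\esum_(t in [set: T]) (c * u t)%:E <= c%:E * \esum_(t in [set: T]) (u t)%:E)%E.
Proof.
move=> c0 u0; apply: ge_ereal_sup => _ /= [A Afin <-].
under eq_fsbigr do rewrite EFinM.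
rewrite -ge0_mule_fsumr; last by move=> t; rewrite lee_fin.
by rewrite lee_wpmul2l ?lee_fin//; apply: esum_ge; exists A.
Qed.

Let psumD_le x y a b : 0 < a -> 0 < b ->
  (psum x <= (a `^ p)%:E)%E -> (psum y <= (b `^ p)%:E)%E ->
  (psum (fun t => x t + y t)%R <= ((a + b) `^ p)%:E)%E.
Proof.
move=> a0 b0 xa yb; have ab0 : 0 < a + b by exact: addr_gt0.
pose w := a / (a + b); have w0 : 0 <= w by rewrite divr_ge0// ltW.
have w1 : w <= 1 by rewrite ler_pdivrMr// mul1r lerDl ltW.
have wE : 1 - w = b / (a + b) by rewrite /w; field; rewrite gt_eqF.
pose c := (a + b) `^ p * w / a `^ p; pose d := (a + b) `^ p * (1 - w) / b `^ p.
have ap0 : 0 < a `^ p by exact: powR_gt0.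
have bp0 : 0 < b `^ p by exact: powR_gt0.
have c0 : 0 <= c by apply: divr_ge0 (ltW ap0); exact: mulr_ge0 (powR_ge0 _ _) w0.
have d0 : 0 <= d.
  by apply: divr_ge0 (ltW bp0); apply: mulr_ge0 (powR_ge0 _ _) _; rewrite subr_ge0.
apply: (@le_trans _ _ (c%:E * psum x + d%:E * psum y)%E); last first.
  apply: (@le_trans _ _ (c%:E * (a `^ p)%:E + d%:E * (b `^ p)%:E)%E).
    by apply: leeD; rewrite lee_wpmul2l ?lee_fin.
  rewrite -!EFinM -EFinD lee_fin /c /d !mulfVK ?gt_eqF//.
  by rewrite -mulrDr addrCA subrr addr0 mulr1.
apply: (@le_trans _ _ (\esum_(t in [set: T]) ((c * `|x t| `^ p)%:E + (d * `|y t| `^ p)%:E))%E); last first.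
  rewrite esumD; [|by move=> t _; rewrite lee_fin mulr_ge0 ?powR_ge0..].
  by apply: leeD; apply: esumZ_le => // t; exact: powR_ge0.
apply: le_esum => t _; rewrite -EFinD lee_fin.
have xa0 : 0 <= `|x t| / a by rewrite divr_ge0// ltW.
have yb0 : 0 <= `|y t| / b by rewrite divr_ge0// ltW.
have conv := @convex_powR R p p1 (Itv01 w0 w1) (`|x t| / a) (`|y t| / b).
have {conv} : (w * (`|x t| / a) + (1 - w) * (`|y t| / b)) `^ p <=
    w * (`|x t| / a) `^ p + (1 - w) * (`|y t| / b) `^ p.
  by apply: conv; rewrite inE /= in_itv /= andbT.
have -> : w * (`|x t| / a) + (1 - w) * (`|y t| / b) = (`|x t| + `|y t|) / (a + b).
  by rewrite wE /w; field; rewrite !gt_eqF.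
have aV0 : 0 <= a^-1 by rewrite invr_ge0 ltW.
have bV0 : 0 <= b^-1 by rewrite invr_ge0 ltW.
have abV0 : 0 <= (a + b)^-1 by rewrite invr_ge0 ltW.
have powRV (u : R) : 0 <= u -> u^-1 `^ p = (u `^ p)^-1.
  by move=> u0; rewrite -powR_inv1// -powRrM mulN1r powRN.
rewrite !powRM ?addr_ge0// (powRV _ (ltW a0)) (powRV _ (ltW b0)) (powRV _ (ltW ab0)) => conv.
apply: (@le_trans _ _ ((`|x t| + `|y t|) `^ p)).
  by rewrite ge0_ler_powR ?nnegrE ?addr_ge0 ?ler_normD// ltW.
have abp0 : 0 < (a + b) `^ p by exact: powR_gt0.
move: conv; rewrite ler_pdivrMr// => /le_trans; apply.
by rewrite le_eqVlt; apply/orP; left; apply/eqP; rewrite /c /d; field; rewrite !gt_eqF.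
Qed.

Definition ellp_pred (_ : 1 <= p) : {pred T -> R} :=
  mem [set x : T -> R | (psum x < +oo)%E].

Let psum_fin_le x e : 0 < e -> (psum x < +oo)%E ->
  (psum x <= ((ellp_norm x + e) `^ p)%:E)%E.
Proof.
move=> e0 fx; rewrite psum_fin// lee_fin.
by rewrite ge0_ler_powR ?nnegrE ?addr_ge0 ?ellp_norm_ge0 ?lerDl// ltW.
Qed.

Lemma ellp_normD x y : (psum x < +oo)%E -> (psum y < +oo)%E ->
  ellp_norm (x \+ y) <= ellp_norm x + ellp_norm y.
Proof.
move=> fx fy; apply/ler_addgt0Pr => e e0; have e2 : 0 < e / 2 by rewrite divr_gt0.
have -> : ellp_norm x + ellp_norm y + e = (ellp_norm x + e / 2) + (ellp_norm y + e / 2).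
  by rewrite addrACA -splitr.
apply: ellp_norm_le; first by rewrite !addr_ge0 ?ellp_norm_ge0 ?ltW.
by apply: psumD_le; rewrite ?ltr_wpDl ?ellp_norm_ge0 ?psum_fin_le.
Qed.

Let psumD_fin x y : (psum x < +oo)%E -> (psum y < +oo)%E ->
  (psum (x \+ y)%R < +oo)%E.
Proof.
move=> fx fy; apply: (@le_lt_trans _ _ (((ellp_norm x + 1) + (ellp_norm y + 1)) `^ p)%:E).
  by apply: psumD_le; rewrite ?ltr_wpDl ?ellp_norm_ge0 ?psum_fin_le.
exact: ltry.
Qed.

Let psumZ_le (c : R) x : (psum (fun t => c * x t)%R <= (`|c| `^ p)%:E * psum x)%E.
Proof.
rewrite /psum; under eq_esum do rewrite normrM powRM//.
by apply: esumZ_le => *; exact: powR_ge0.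
Qed.

Let psumZ_fin (c : R) x : (psum x < +oo)%E -> (psum (fun t => c * x t)%R < +oo)%E.
Proof.
move=> fx; apply: le_lt_trans (psumZ_le _ _) _.
by rewrite psum_fin// -EFinM ltry.
Qed.

Lemma ellp_normZ (c : R) x : (psum x < +oo)%E ->
  ellp_norm (fun t => c * x t) = `|c| * ellp_norm x.
Proof.
have le_ b z : (psum z < +oo)%E -> ellp_norm (fun t => b * z t) <= `|b| * ellp_norm z.
  move=> fz; apply: ellp_norm_le; first by rewrite mulr_ge0 ?ellp_norm_ge0.
  by rewrite (le_trans (psumZ_le _ _))// psum_fin// powRM ?ellp_norm_ge0.
move=> fx; apply/eqP; rewrite eq_le le_//=; have [->|c0] := eqVneq c 0.
  by rewrite normr0 mul0r ellp_norm_ge0.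
rewrite -ler_pdivlMl ?normr_gt0// -normfV.
have cK : (fun t => c^-1 * (c * x t)) = x by apply/funext => t; rewrite mulKf.
by have := le_ c^-1 _ (psumZ_fin c fx); rewrite cK.
Qed.

Lemma ellp_norm_eq0 x : (psum x < +oo)%E -> ellp_norm x = 0 -> x = (fun=> 0).
Proof.
move=> fx x0; apply/funext => t; apply/normr0_eq0/eqP.
have : ((`|x t| `^ p)%:E <= psum x)%E.
  apply: esum_ge; exists [set t]; first by split.
  by rewrite fsbig_set1.
rewrite (psum_fin fx) x0 (powR0 (lt0r_neq0 p0)) lee_fin => le0.
have : `|x t| `^ p == 0 by rewrite eq_le le0 powR_ge0.
by rewrite powR_eq0 => /andP[].
Qed.

Lemma ellp_submod_closed : submod_closed (ellp_pred p1).
Proof.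
split=> [|a x y]; rewrite !inE /=.
  rewrite /psum esum1 ?ltry// => t _.
  by rewrite normr0 powR0 ?gt_eqF.
by move=> fx fy; apply: psumD_fin => //; exact: psumZ_fin.
Qed.

End PowerSum.

Section EllpSpace.
Variables (T : choiceType) (R : realType) (p : R) (p1 : 1 <= p).

Record ellp_space := MkEllp {
  ellp_fun :> T -> R ;
  ellp_funP : ellp_fun \in @ellp_pred T R p p1 }.

HB.instance Definition _ := [isSub for ellp_fun].
HB.instance Definition _ := [Choice of ellp_space by <:].
HB.instance Definition _ := GRing.isSubmodClosed.Build R (T -> R) (@ellp_pred T R p p1)
  (@ellp_submod_closed T R p p1).
HB.instance Definition _ := [SubChoice_isSubLmodule of ellp_space by <:].

Lemma ellp_fin (x : ellp_space) : (psum p x < +oo)%E.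
Proof. exact: set_mem (ellp_funP x). Qed.

Lemma ellp_space_norm_eq0 (x : ellp_space) : ellp_norm p x = 0 -> x = 0.
Proof. by move=> x0; apply: val_inj; exact: ellp_norm_eq0 p1 _ (ellp_fin x) x0. Qed.

HB.instance Definition _ := @Lmodule_isNormed.Build R ellp_space
  (fun x => ellp_norm p x)
  (fun x y => ellp_normD p1 (ellp_fin x) (ellp_fin y))
  (fun a x => ellp_normZ p1 a (ellp_fin x))
  ellp_space_norm_eq0.
End EllpSpace.

Local Open Scope quotient_scope.

Section LpMeasure.
Context d (T : measurableType d) (R : realType).
Variables (mu : {measure set T -> \bar R}) (p : R) (p1 : 1 <= p).

Let p1e : (1 <= p%:E)%E. Proof. by rewrite lee_fin. Qed.
Local Notation Lf := (LfunType mu p1e).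
Let nm (f : Lf) : R := fine ('N[mu]_p%:E[EFin \o f])%E.

(* The library's LfunType is the space of p-integrable functions, on which the
   L_p norm is only a seminorm, and its LspaceType carries no vector space
   structure: L_p(mu) is built here as the quotient of LfunType by the functions
   that vanish almost everywhere. *)
Definition Lnull : {pred Lf} :=
  mem [set f : Lf | (f : T -> R) = (fun=> 0) %[ae mu]].

Lemma Lnull_zmod_closed : zmod_closed Lnull.
Proof.
split=> [|f g]; rewrite !inE /=; first exact: ae_eq_refl.
move=> f0 g0; apply: filterS2 f0 g0 => t /= f0 g0 tT.
by transitivity (f t - g t) => //; rewrite f0// g0// subr0.
Qed.
HB.instance Definition _ := GRing.isZmodClosed.Build Lf Lnull Lnull_zmod_closed.

Definition Lp_space : Type := Quotient.quot Lnull.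
HB.instance Definition _ := GRing.Zmodule.on Lp_space.
HB.instance Definition _ : EqQuotient Lf (Quotient.equiv Lnull) Lp_space :=
  EqQuotient.on Lp_space.

Let nm_null f : f \in Lnull -> nm f = 0.
Proof.
rewrite inE /= => f0; rewrite /nm unlock (ae_eq_integral (cst 0%E))//=.
- by rewrite integral0 poweR0r// invr_neq0// gt_eqF// (lt_le_trans ltr01).
- apply/measurable_EFinP; apply: (@measurableT_comp _ _ _ _ _ _ (@powR R ^~ p)) => //.
  exact: measurableT_comp.
- case: f0 => A [mA A0 sA]; exists A; split => // t /= nt; apply: sA => /= h.
  apply: nt => _; rewrite h// normr0 powR0// gt_eqF//.
  exact: lt_le_trans p1.
Qed.

Let nm_le (f g : Lf) : f = g %[mod Lp_space] -> nm f <= nm g.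
Proof.
move=> /eqP; rewrite -Quotient.idealrBE => /nm_null fg0.
by rewrite -[f](subrK g) (le_trans (ler_LnormD _ _))// -/(nm _) fg0 add0r.
Qed.

Let nm_eq (f g : Lf) : f = g %[mod Lp_space] -> nm f = nm g.
Proof. by move=> fg; apply/eqP; rewrite eq_le !nm_le. Qed.

Definition Lp_space_scale (a : R) := lift_op1 Lp_space (fun f : Lf => a *: f).

Lemma pi_scale a (f : Lf) : Lp_space_scale a (\pi_Lp_space f) = \pi_Lp_space (a *: f).
Proof.
unlock Lp_space_scale; apply/eqP; rewrite -Quotient.idealrBE -scalerBr.
have : repr (\pi_Lp_space f) - f \in Lnull.
  by rewrite Quotient.idealrBE reprK.
rewrite !inE /= => f0; apply: filterS f0 => t + tT => /(_ tT) h.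
exact: etrans (congr1 ( *%R a) h) (mulr0 a).
Qed.

Fact Lp_space_scaleA a b x : Lp_space_scale a (Lp_space_scale b x) = Lp_space_scale (a * b) x.
Proof. by rewrite -[x]reprK !pi_scale scalerA. Qed.

Fact Lp_space_scale1 : left_id 1 Lp_space_scale.
Proof. by move=> x; rewrite -[x]reprK pi_scale scale1r. Qed.

Fact Lp_space_scaleDr : right_distributive Lp_space_scale +%R.
Proof.
move=> a x y; rewrite -[x]reprK -[y]reprK.
by rewrite -!raddfD /= !pi_scale scalerDr raddfD.
Qed.

Fact Lp_space_scaleDl x : {morph Lp_space_scale^~ x : a b / a + b}.
Proof. by move=> a b; rewrite -[x]reprK !pi_scale scalerDl raddfD. Qed.

HB.instance Definition _ := GRing.Zmodule_isLmodule.Build R Lp_space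
  Lp_space_scaleA Lp_space_scale1 Lp_space_scaleDr Lp_space_scaleDl.

Definition Lp_space_norm (x : Lp_space) : R := nm (repr x).

Lemma pi_norm f : Lp_space_norm (\pi_Lp_space f) = nm f.
Proof. by apply: nm_eq; rewrite reprK. Qed.

Lemma Lp_space_normD x y : Lp_space_norm (x + y) <= Lp_space_norm x + Lp_space_norm y.
Proof. by rewrite -[x]reprK -[y]reprK -raddfD !pi_norm ler_LnormD. Qed.

Lemma Lp_space_normZ a x : Lp_space_norm (a *: x) = `|a| * Lp_space_norm x.
Proof.
rewrite -[x]reprK -[_ *: _]/(Lp_space_scale _ _) pi_scale !pi_norm.
by apply: EFin_inj; rewrite EFinM !finite_norm_fine LnormZ.
Qed.

Lemma Lp_space_norm_eq0 x : Lp_space_norm x = 0 -> x = 0.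
Proof.
rewrite -[x]reprK pi_norm => /fine_Lnormr_eq0 x0.
rewrite -[RHS](raddf0 (\pi_Lp_space)); apply/eqP.
by rewrite -Quotient.idealrBE subr0 inE.
Qed.

HB.instance Definition _ := @Lmodule_isNormed.Build R Lp_space
  Lp_space_norm Lp_space_normD Lp_space_normZ Lp_space_norm_eq0.
End LpMeasure.

Local Close Scope quotient_scope.

Definition coordinate_sets (I : Type) : set (set (I -> bool)) :=
  [set [set x : I -> bool | x i] | i in [set: I]].

(* {0,1}^I with the product sigma-algebra *)
Definition cube (I : Type) : Type := g_sigma_algebraType (@coordinate_sets I).
HB.instance Definition _ (I : Type) := Measurable.on (cube I).

(* The product of the fair coin measures: these values on the finite cylinders
   determine mu on the product sigma-algebra. *)
Definition homogeneous_measure (I : choiceType) (R : realType)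
    (mu : probability (cube I) R) : Prop :=
  forall (F : {fset I}) (b : I -> bool),
    mu [set x | forall i, i \in F -> x i = b i] = ((2^-1) ^+ #|` F|)%:E.

(* Homeomorphism of K with a subspace of a Sigma-product: h is injective and K
   carries the topology induced by h. *)
Definition corson (R : realType) (K : topologicalType) : Prop :=
  exists (G : Type) (h : K -> {ptws G -> R}),
    [/\ forall x, countable [set g | h x g != 0],
        injective h &
        forall U : set K, open U <->
          exists2 V : set {ptws G -> R}, open V & U = h @^-1` V].

Section RadonMeasures.
(* The distinguished point of K plays no role: the library requires one of every
   measurable type. *)
Variables (R : realType) (K : ptopologicalType).

Definition borel : Type := g_sigma_algebraType (@open K).
HB.instance Definition _ := Measurable.on borel.

(* Inner regularity with respect to compact sets; finiteness is part of the type
   of mu. *)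
Definition radon (mu : {finite_measure set borel -> \bar R}) : Prop :=
  forall A : set borel, measurable A ->
    mu A = ereal_sup [set mu C | C in [set C : set K | compact C /\ C `<=` A]].

Definition measure_support (mu : {finite_measure set borel -> \bar R}) : set K :=
  [set x | forall U : set K, open U -> U x -> (0 < mu U)%E].

Definition separable_set (A : set K) : Prop :=
  exists2 D : set K, countable D & D `<=` A /\ A `<=` closure D.

Definition radon_separable_supports : Prop :=
  forall mu : {finite_measure set borel -> \bar R},
    radon mu -> separable_set (measure_support mu).

End RadonMeasures.

(* Main.v *)
(* Fix an Aronszajn tree of injections e_a : [0, a] -> nat, any two of which
   differ at finitely many points, and distinct reals l_a in [0, 1/4]. For a
   bounded family (d_a) which together with a vector u is linearly dense, put
   y_a = sum_n l_a^n x_{a,n}, where x_{a,0} = d_a, x_{a,1} = u and then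
   x_{a,n} runs over the differences d_b - d_a (b < a) at the place given by
   e_a(b). If a functional f is eventually constant on (d_a), then the
   coefficient sequences (f x_{a,n})_n take only countably many values for
   large a, so if f vanishes on uncountably many y_a, then one nonzero power
   series vanishes at uncountably many l_a, which is absurd. By Hahn-Banach
   every uncountable subset of the y_a is linearly dense.

   A WLD space of density omega1 has such a family, with all functionals
   eventually null. The spaces c_0, l_p and L_p of the cube are treated
   through vectors with small sums (in the cube, Walsh products), on which
   each functional is countably supported. For Corson K, a functional on C(K)
   is carried by the support of a Radon measure, which by separability sees
   only countably many coordinates; products of ramps of the coordinates are
   linearly dense. On [0, omega1] the family consists of suitable indicators
   of clopen sets, and any functional on it is eventually constant because
   arbitrarily long sums of disjointly supported differences stay bounded. *)
Require Import Defs.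
From HB Require Import structures.
From mathcomp Require Import all_boot all_order all_algebra finmap generic_quotient.
From mathcomp Require Import all_classical all_reals all_analysis.
From mathcomp Require Import measurable_realfun interval_inference.
From mathcomp Require Import ring lra zify.

Set Implicit Arguments.
Unset Strict Implicit.
Unset Printing Implicit Defensive.

Import Order.TTheory GRing.Theory Num.Theory numFieldNormedType.Exports.

Local Open Scope classical_set_scope.
Local Open Scope ring_scope.

(** * Combinatorics of omega1 *)

(** The obstacle is that each y_a has its own coefficient sequence under a functional f, whereas
    zeros can be counted only for one fixed power series. Differences d_b - d_a are used because f
    kills them once both indices lie beyond the point g from which f is constant on (d_a), whatever
    the constant is. Only the places e_a(b) with b <= g survive, carrying a value that does not
    depend on a, so the sequence depends on the restriction of e_a to [0, g] alone. Arbitrary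
    injections could have uncountably many such restrictions; those of an Aronszajn tree have
    countably many, and an uncountable set of indices then contains uncountably many with the same
    series. Linear density is what makes that series nonzero. The bound 1/4 on the l_a makes the
    count of zeros quantitative, by dividing real series and without analytic functions. Convergence
    of the defining series is demanded only for vectors of a set B, so that the argument also covers
    spaces in which the sum has to be formed pointwise. *)

Lemma card_le_inj {T U : Type} (A : set T) (B : set U) (f : T -> U) :
  (forall x, A x -> B (f x)) ->
  (forall x y, A x -> A y -> f x = f y -> x = y) -> (A #<= B)%card.
Proof.
move=> fAB finj; apply: (@card_le_trans _ _ _ (f @` A)).
  have /card_eqPle[] // : (A #= f @` A)%card.
  by apply/card_esym/inj_card_eq => x y /set_mem Ax /set_mem Ay; exact: finj.
by apply: subset_card_le => _ [x Ax <-]; exact: fAB.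
Qed.

Lemma card_le_exists_inj {T U : Type} (u0 : U) (A : set T) (B : set U) :
  (A #<= B)%card -> exists f : T -> U,
    (forall x, A x -> B (f x)) /\
    (forall x y, A x -> A y -> f x = f y -> x = y).
Proof.
move=> /card_leP[f].
pose F (x : T) : U := if pselect (A x) is left Ax
  then val (f (SigSub (mem_set Ax))) else u0.
exists F; split => [x Ax|x y Ax Ay]; rewrite /F.
  by case: pselect => // ?; apply: set_mem; exact: valP.
case: pselect => // a; case: pselect => // b /val_inj.
by move/(@inj _ _ _ f); rewrite !in_setT => /(_ isT isT) [].
Qed.

(** Transfinite recursion with choice: [spec t g v] may consult [g] only below [t], which is what
    the second hypothesis expresses. The conclusion is conditional because [v0] is taken where no
    value fits; that a value fits can then be proved by induction along [r]. *)
Lemma wf_choice (T : Type) (r : T -> T -> Prop) (V : Type) (v0 : V)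
    (spec : T -> (T -> V) -> V -> Prop) :
  well_founded r ->
  (forall t g h v, (forall s, r s t -> g s = h s) -> spec t g v -> spec t h v) ->
  exists f : T -> V, forall t, (exists v, spec t f v) -> spec t f (f t).
Proof.
move=> wfr ext.
pose ext_rec t (rec : forall s, r s t -> V) s :=
  if pselect (r s t) is left h then rec s h else v0.
pose step t rec := if pselect (exists v, spec t (ext_rec t rec) v) is left h
  then sval (cid h) else v0.
pose f := Fix wfr (fun _ => V) step.
have fE t : f t = step t (fun s _ => f s).
  rewrite /f Fix_eq// => x g h gh.
  by rewrite (_ : g = h)//; apply: functional_extensionality_dep => y; apply/funext => p.
have ext_recE t s : r s t -> ext_rec t (fun s _ => f s) s = f s.
  by rewrite /ext_rec; case: pselect.
exists f => t [v tv]; rewrite fE /step; case: pselect => [h|[]].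
  by case: cid => w /= ; apply: ext => s; exact: ext_recE.
by exists v; apply: ext tv => s /ext_recE.
Qed.

(* The image of the predecessors of [t] is countable, so it misses a point of
   [U], which can be taken as the value at [t]. *)
Lemma inj_into_uncountable (T V : Type) (r : T -> T -> Prop) (U : set V) :
  well_founded r -> (forall s t, s <> t -> r s t \/ r t s) ->
  (forall t, countable [set s | r s t]) -> ~ countable U ->
  ([set: T] #<= U)%card.
Proof.
move=> wfr tot cnt uncU.
have [v0 _] : U !=set0.
  by apply/set0P/eqP => U0; apply: uncU; rewrite U0; exact: countable0.
pose spec t (g : T -> V) v := U v /\ forall s, r s t -> g s <> v.
have [|f fP] := wf_choice v0 (spec := spec) wfr.
  by move=> t g h v gh [Uv gv]; split=> // s st; rewrite -gh//; exact: gv.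
have {}fP t : spec t f (f t).
  apply: fP; apply: contrapT => /forallNP no.
  apply: uncU; apply: sub_countable (_ : countable (f @` [set s | r s t])).
    apply: subset_card_le => v Uv; have /not_andP[//|/existsNP[s /not_implyP[st /contrapT fs]]] := no v.
    by exists s.
  exact: sub_countable (card_image_le _ _) (cnt t).
apply: (card_le_inj (f := f)) => [t _|s t _ _ fst]; first exact: (fP t).1.
apply: contrapT => /tot[] rst.
- exact: (fP t).2 rst fst.
- exact: (fP s).2 rst (esym fst).
Qed.

Lemma omega1_wf : well_founded (fun x y : omega1 => (x < y)%O).
Proof.
move=> x; apply: contrapT => nx.
have [m nm h] := @omega1_min [set x | ~ Acc (fun x y : omega1 => (x < y)%O) x] (ex_intro _ x nx).
apply: nm; constructor => y ym; apply: contrapT => ny.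
by have := h y ny; rewrite leNgt ym.
Qed.

Lemma omega1_countable_lt (x : omega1) : countable [set y : omega1 | (y < x)%O].
Proof.
apply: sub_countable (omega1_countable_below x).
by apply: subset_card_le => y /ltW.
Qed.

(** Besides the lower bound on densities, this is the source of the distinct reals attached to the
    points of omega1. *)
Lemma omega1_card_le (V : Type) (U : set V) :
  ~ countable U -> ([set: omega1] #<= U)%card.
Proof.
apply: inj_into_uncountable omega1_wf _ omega1_countable_lt => s t /eqP.
by rewrite neq_lt => /orP.
Qed.

(** Ordered lexicographically, the product still has countable initial segments, so the greedy
    embedding into an uncountable set applies to it. *)
Lemma card_omega1_nat : ([set: omega1 * nat] #<= [set: omega1])%card.
Proof.
pose r (s t : omega1 * nat) := (s.1 < t.1)%O \/ s.1 = t.1 /\ (s.2 < t.2)%N.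
apply: (inj_into_uncountable (r := r)); last exact: omega1_uncountable.
- move=> [x n]; elim/(well_founded_ind omega1_wf): x n => x IHx n.
  elim/ltn_ind: n => n IHn; constructor => -[y m] [/= yx|[/= -> mn]].
    exact: IHx.
  exact: IHn.
- move=> [x n] [y m] xy; rewrite /r /=.
  have [lt|lt|e] := ltgtP x y; [by left; left|by right; left|subst].
  have [lt|lt|e] := ltngtP n m; [by left; right|by right; right|subst].
  by [].
- move=> [x n]; have := countableX (omega1_countable_below x) (@countableP nat setT).
  apply: sub_countable; apply: subset_card_le => -[y m] [/= /ltW yx|[/= -> _]] //.
Qed.

Lemma card_bigcup_omega1 (T : Type) (A : omega1 -> set T) :
  (forall a, countable (A a)) -> (\bigcup_a A a #<= [set: omega1])%card.
Proof.
move=> cA; apply: card_le_trans card_omega1_nat.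
have cA' a : exists f : T -> nat, {in A a &, injective f}.
  exact/countable_injP/cA.
have [f finj] := choice cA'.
have [a0 _] : [set: omega1] !=set0.
  by apply/set0P/eqP => e; apply: omega1_uncountable; rewrite e.
have idx t : exists a, (exists b, A b t) -> A a t.
  by have [[a At]|nA] := pselect (exists b, A b t); [exists a|exists a0 => /nA].
have [i iP] := choice idx.
apply: (card_le_inj (f := fun t => (i t, f (i t) t))) => // s t [a _ As] [b _ Bt] [ist fst].
have Ais : A (i s) s by apply: iP; exists a.
have Ait : A (i s) t by rewrite ist; apply: iP; exists b.
by apply: (finj (i s)); rewrite ?inE// fst ist.
Qed.

Lemma omega1_inhabited : inhabited omega1.
Proof.
have [a _] : [set: omega1] !=set0.
  by apply/set0P/eqP => e; apply: omega1_uncountable; rewrite e.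
by constructor.
Qed.

Lemma countable_omega1_bounded (A : set omega1) : countable A ->
  exists g, forall a, A a -> (a <= g)%O.
Proof.
move=> cA; apply: contrapT => /forallNP unb; apply: omega1_uncountable.
have : countable (\bigcup_(a in A) [set y : omega1 | (y <= a)%O]).
  by apply: bigcup_countable => // a _; exact: omega1_countable_below.
apply: sub_countable; apply: subset_card_le => g _.
have /existsNP[a /not_implyP[Aa /negP]] := unb g.
by rewrite -ltNge => /ltW ga; exists a.
Qed.

Lemma uncountable_omega1_unbounded (A : set omega1) (g : omega1) :
  ~ countable A -> exists2 a, A a & (g < a)%O.
Proof.
move=> nA; apply: contrapT => h; apply: nA.
apply: sub_countable (omega1_countable_below g); apply: subset_card_le => a Aa.
by rewrite /= leNgt; apply/negP => ga; apply: h; exists a.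
Qed.

Lemma omega1_succ_exists (a : omega1) :
  exists2 b, (a < b)%O & forall c, (a < c)%O -> (b <= c)%O.
Proof.
have [|b] := @omega1_min [set b | (a < b)%O]; last by exists b.
have [b] := uncountable_omega1_unbounded a omega1_uncountable.
by move=> _ ?; exists b.
Qed.

(** With rho(x, g) the least n such that x is in [P g n], the last clause says, for x <= b <= g,
    that rho(x, g) <= max(rho(x, b), rho(b, g)) and rho(x, b) <= max(rho(x, g), rho(b, g)). This is
    Todorcevic's rho function, presented by its finite sublevel sets. *)
Definition coherent_at (P : omega1 -> nat -> seq omega1) (g : omega1) : Prop :=
  [/\ forall n, uniq (P g n) /\ g \in P g n,
      forall n x, x \in P g n -> (x <= g)%O,
      forall m n, (m <= n)%N -> {subset P g m <= P g n},
      forall x, (x <= g)%O -> exists n, x \in P g n &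
      forall n b x, b \in P g n -> (x <= b)%O -> (x \in P b n) = (x \in P g n)].

Definition update (T : Type) (V : Type) (f : T -> V) (t : T) (v : V) : T -> V :=
  fun s => if pselect (s = t) then v else f s.

Lemma updateE T V (f : T -> V) t v : update f t v t = v.
Proof. by rewrite /update; case: pselect. Qed.

Lemma updateN T V (f : T -> V) t v s : s <> t -> update f t v s = f s.
Proof. by rewrite /update; case: pselect. Qed.

Lemma coherent_ext P Q g : (forall x, (x <= g)%O -> P x = Q x) ->
  coherent_at P g -> coherent_at Q g.
Proof.
move=> PQ [P0 P1 P2 P3 P4]; rewrite /coherent_at -(PQ g)//; split => // n b x bn xb.
by rewrite -(PQ b) ?(P1 n)//; exact: P4.
Qed.

(** Monotonicity is not strict, which lets successors and limits share one construction: below a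
    successor the sequence is eventually equal to the predecessor. *)
Lemma cofinal_sequence (g : omega1) : (exists a, (a < g)%O) ->
  exists d : nat -> omega1, [/\ forall n, (d n < g)%O,
    forall n, (d n <= d n.+1)%O & forall x, (x < g)%O -> exists n, (x <= d n)%O].
Proof.
move=> [a ag].
have /countable_injP[f finj] := omega1_countable_lt g.
have /choice[e eP] : forall n, exists y,
    (y < g)%O /\ forall x, (x < g)%O -> f x = n -> y = x.
  move=> n; have [[x [xg fx]]|nx] := pselect (exists x, (x < g)%O /\ f x = n).
    exists x; split=> // y yg fy; apply: finj; rewrite ?inE//.
    by rewrite fx fy.
  by exists a; split=> // x xg fx; case: nx; exists x.
pose d := fix d n := if n is m.+1 then Order.max (d m) (e m) else a.
exists d; split.
- by elim=> //= n IHn; rewrite gt_max IHn; have [] := eP n.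
- by move=> n /=; rewrite le_max lexx.
- move=> x xg; exists (f x).+1 => /=.
  by have [_ /(_ x xg erefl) ->] := eP (f x); rewrite le_max lexx orbT.
Qed.

Section Slow.
Variables (P : omega1 -> nat -> seq omega1) (g : omega1) (d : nat -> omega1).
Hypothesis cohP : forall b, (b < g)%O -> coherent_at P b.
Hypothesis dg : forall n, (d n < g)%O.
Hypothesis d_nd : forall n, (d n <= d n.+1)%O.
Hypothesis d_cof : forall x, (x < g)%O -> exists n, (x <= d n)%O.

(** The index moves from k to k+1 at level n+1 only if [d k] already belongs to the level n+1 set of
    [d k.+1]. This delay makes the sets [P (d (slow n)) n] increase with n, which the bare
    [P (d n) n] need not do. *)
Fixpoint slow n : nat := if n is m.+1 then
  (if d (slow m) \in P (d (slow m).+1) m.+1 then (slow m).+1 else slow m) else 0%N.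

Lemma slow_nd m n : (m <= n)%N -> (slow m <= slow n)%N.
Proof.
elim: n => [|n IHn]; first by rewrite leqn0 => /eqP ->.
rewrite leq_eqVlt => /orP[/eqP -> //|/IHn mn]; apply: leq_trans mn _ => /=.
by case: ifP.
Qed.

(** The index cannot stall at k: [d k] enters some level of [d k.+1], and from that level on the
    index is free to move. *)
Lemma slow_unbounded k : exists n, (k <= slow n)%N.
Proof.
elim: k => [|k [n kn]]; first by exists 0%N.
apply: contrapT => /forallNP no.
have [_ _ _ /(_ _ (d_nd k))[m dm] _] := cohP (dg k.+1).
have sE n' : (n <= n')%N -> slow n' = k.
  move=> nn'; apply/eqP; rewrite eqn_leq (leq_trans kn (slow_nd nn')) andbT.
  by rewrite leqNgt; apply/negP/no.
apply: (no (maxn n m).+1) => /=; rewrite sE ?leq_maxl//.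
have [_ _ mono _ _] := cohP (dg k.+1).
by rewrite (mono m _ _ _ dm)// (leq_trans (leq_maxr n m)).
Qed.

Lemma slow_step n : d (slow n) \in P (d (slow n.+1)) n.+1.
Proof.
rewrite /=; case: ifP => // _.
by have [/(_ n.+1)[]] := cohP (dg (slow n)).
Qed.

Lemma slow_subset m n : (m <= n)%N ->
  {subset P (d (slow m)) m <= P (d (slow n)) n}.
Proof.
elim: n => [|n IHn]; first by rewrite leqn0 => /eqP ->.
rewrite leq_eqVlt => /orP[/eqP -> //|/IHn mn] x /mn xn.
have [_ le_n mono _ _] := cohP (dg (slow n)).
have [_ _ _ _ coh] := cohP (dg (slow n.+1)).
by rewrite -(coh _ _ _ (slow_step n)) ?(le_n n)// (mono n).
Qed.

Lemma slow_cofinal x : (x < g)%O -> exists n, x \in P (d (slow n)) n.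
Proof.
move=> /d_cof[k xk]; have [n kn] := slow_unbounded k.
have xd : (x <= d (slow n))%O.
  apply: le_trans xk _; move: kn; elim: (slow n) => [|j IHj]; first by rewrite leqn0 => /eqP ->.
  by rewrite leq_eqVlt => /orP[/eqP -> //|/IHj /le_trans]; apply.
have [P0 _ _ /(_ x xd)[m xm] _] := cohP (dg (slow n)).
exists (maxn n m).
have dn : d (slow n) \in P (d (slow (maxn n m))) (maxn n m).
  by apply: (slow_subset (leq_maxl n m)); have [] := P0 n.
have [_ _ _ _ coh] := cohP (dg (slow (maxn n m))).
rewrite -(coh _ _ _ dn)//.
by have [_ _ mono _ _] := cohP (dg (slow n)); apply: mono xm; exact: leq_maxr.
Qed.

(** Level n of g is that of [d (slow n)] with g added, so coherence between g and a smaller b is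
    inherited from coherence between [d (slow n)] and b. *)
Lemma coherent_extend_limit :
  coherent_at (update P g (fun n => g :: P (d (slow n)) n)) g.
Proof.
have ltE b : (b < g)%O -> update P g (fun n => g :: P (d (slow n)) n) b = P b.
  by move=> bg; rewrite updateN// => e; rewrite e ltxx in bg.
have Pg n b : b \in P (d (slow n)) n -> (b < g)%O.
  by have [_ le_n _ _ _] := cohP (dg (slow n)); move=> /le_n/le_lt_trans; apply.
rewrite /coherent_at updateE; split.
- move=> n; rewrite inE eqxx; split=> //=.
  have [/(_ n)[-> _] _ _ _ _] := cohP (dg (slow n)); rewrite andbT.
  by apply/negP => /Pg; rewrite ltxx.
- by move=> n x; rewrite inE => /orP[/eqP ->|/Pg/ltW].
- move=> m n mn x; rewrite !inE => /orP[->//|/(slow_subset mn) ->].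
  by rewrite orbT.
- move=> x; rewrite le_eqVlt => /orP[/eqP ->|/slow_cofinal[n xn]].
    by exists 0%N; rewrite inE eqxx.
  by exists n; rewrite inE xn orbT.
- move=> n b x; rewrite inE => /orP[/eqP ->|bn xb]; first by rewrite updateE.
  have xg := le_lt_trans xb (Pg _ _ bn).
  rewrite ltE ?(Pg n)// inE (lt_eqF xg)/=.
  by have [_ _ _ _ coh] := cohP (dg (slow n)); exact: coh.
Qed.
End Slow.

Lemma coherent_exists : exists P, forall g, coherent_at P g.
Proof.
pose spec g P v := (forall b, (b < g)%O -> coherent_at P b) -> coherent_at (update P g v) g.
have ext g P Q v : (forall b, (b < g)%O -> P b = Q b) -> spec g P v -> spec g Q v.
  move=> PQ sP cQ.
  have : coherent_at (update P g v) g.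
    apply: sP => b bg; apply: coherent_ext (cQ b bg) => x xb.
    by rewrite PQ// (le_lt_trans xb).
  apply: coherent_ext => x; rewrite le_eqVlt => /orP[/eqP ->|xg].
    by rewrite !updateE.
  by rewrite !updateN ?PQ// => e; rewrite e ltxx in xg.
have [P PP] := wf_choice (fun=> [::]) omega1_wf ext.
exists P; elim/(well_founded_ind omega1_wf) => g IHg.
suff : coherent_at (update P g (P g)) g.
  apply: coherent_ext => x _.
  by have [->|xg] := pselect (x = g); rewrite ?updateE ?updateN.
apply: PP => //.
have [[a ag]|no] := pselect (exists a, (a < g)%O).
  have [d [d1 d2 d3]] := cofinal_sequence (ex_intro _ a ag).
  by exists (fun n => g :: P (d (slow P d n)) n) => c; exact: coherent_extend_limit.
exists (fun=> [:: g]) => _; rewrite /coherent_at updateE; split => //.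
- by move=> n; rewrite inE.
- by move=> n x; rewrite inE => /eqP ->.
- by move=> m n _ x.
- move=> x; rewrite le_eqVlt => /orP[/eqP ->|xg]; first by exists 0%N; rewrite inE.
  by case: no; exists x.
- by move=> n b x; rewrite inE => /eqP -> _; rewrite updateE.
Qed.

(* An Aronszajn tree of injections into the natural numbers: [k g a] takes
   countably many values when [a] varies, and determines the restriction of
   [e a] to the predecessors of [g]. *)
Lemma coherent_injections : exists (e : omega1 -> omega1 -> nat)
    (k : omega1 -> omega1 -> nat * seq nat),
  (forall a b c, (b <= a)%O -> (c <= a)%O -> e a b = e a c -> b = c) /\
  (forall g a a' b, (g <= a)%O -> (g <= a')%O -> k g a = k g a' ->
    (b <= g)%O -> e a b = e a' b).
Proof.
have [P cohP] := coherent_exists.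
have lvl a b : exists n, (b <= a)%O ->
    b \in P a n /\ forall m, (b \in P a m) = (n <= m)%N.
  have [ba|nba] := pselect (b <= a)%O; last by exists 0%N.
  have [_ _ mono /(_ b ba) ex _] := cohP a; exists (ex_minn ex) => _.
  case: ex_minnP => n bn nmin; split=> // m; apply/idP/idP; first exact: nmin.
  by move=> /mono; apply.
have [l0 l0P] := choice (fun ab : omega1 * omega1 => lvl ab.1 ab.2).
pose l a b := l0 (a, b).
have lP a b : (b <= a)%O -> b \in P a (l a b) /\ forall m, (b \in P a m) = (l a b <= m)%N.
  exact: (l0P (a, b)).
(* The level alone is not injective. When b has level n in a, [P b n] is the part of [P a n] up to
   b, so its size is the rank of b among the points of level at most n. *)
pose e a b := choice.pickle (l a b, size (P b (l a b))).
(* It is enough to remember the level of g in a and the levels of the finitely many points of its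
   level set. Every other b <= g enters later than g, and from there on [P a] and [P g] agree on the
   points up to g. *)
pose k g a := (l a g, [seq l a b | b <- P g (l a g)]).
exists e, k; split.
- move=> a; suff lt_e b c : (b < c)%O -> (c <= a)%O -> e a b <> e a c.
    move=> b c ba ca bc; have [/lt_e h|/lt_e h|//] := ltgtP b c.
      by case: (h ca).
    by case: (h ba).
  move=> bc ca /(pcan_inj choice.pickleK)[lbc].
  have ba := le_trans (ltW bc) ca.
  rewrite lbc; apply/eqP; rewrite neq_ltn; apply/orP; left.
  set n := l a c.
  have [[bn _] [cn _]] := (lP a b ba, lP a c ca); rewrite lbc -/n in bn cn.
  have [_ _ _ _ coh] := cohP a.
  have [P0 leP _ _ _] := cohP b; have [Pc _ _ _ _] := cohP c.
  suff : (size (c :: P b n) <= size (P c n))%N by [].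
  apply: uniq_leq_size => /= [|x].
    by rewrite (P0 n).1 andbT; apply/negP => /leP; rewrite leNgt bc.
  rewrite inE => /orP[/eqP ->|xb]; first by have [] := Pc n.
  have xb' := leP _ _ xb.
  by rewrite (coh n)// ?(le_trans xb' (ltW bc))// -(coh n b).
- move=> g a a' b ga ga' [lg ls] bg.
  suff lE : l a b = l a' b by rewrite /e lE.
  have [bm|bm] := boolP (b \in P g (l a g)).
    by move: ls; rewrite lg => /eq_in_map; apply; rewrite -lg.
  have ba := le_trans bg ga; have ba' := le_trans bg ga'.
  have key c : (g <= c)%O -> l c g = l a g -> forall n, (l c b <= n)%N = (b \in P g n).
    move=> gc lcg n; have bc := le_trans bg gc.
    have [_ _ mono _ _] := cohP c; have [_ _ monog _ _] := cohP g.
    have [_ <-] := lP c b bc; have [_ lcE] := lP c g gc.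
    have [_ _ _ _ coh] := cohP c.
    have [mn|nm] := leqP (l a g) n.
      by rewrite (coh n g b)// lcE lcg.
    transitivity false.
      apply/negbTE; apply: contra bm => bn; rewrite (coh _ g b) ?lcE ?lcg//.
      by apply: mono bn; exact: ltnW.
    by apply/esym/negbTE; apply: contra bm; apply: monog; exact: ltnW.
  apply/eqP; rewrite eqn_leq.
  rewrite (key a ga erefl) -(key a' ga' (esym lg)) leqnn /=.
  by rewrite (key a' ga' (esym lg)) -(key a ga erefl).
Qed.

(** * Zeros of bounded real power series *)

Section PowerSeriesZeros.
Variable R : realType.
Implicit Types (c : nat -> R) (x y M : R).

Definition power_sum c x : R := limn (series (fun k => c k * x ^+ k)).

Lemma geometric_quarter_le M x c : 0 <= x <= 4^-1 -> (forall n, `|c n| <= M) ->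
  forall n, `|c n * x ^+ n| <= geometric M 4^-1 n.
Proof.
move=> /andP[x0 x4] cM n; rewrite normrM normrX (ger0_norm x0) /=.
by rewrite ler_pM// ?exprn_ge0// lerXn2r ?nnegrE// invr_ge0.
Qed.

Lemma power_sum_cvg M x c : 0 <= x <= 4^-1 -> (forall n, `|c n| <= M) ->
  series (fun k => c k * x ^+ k) @ \oo --> power_sum c x.
Proof.
move=> x01 cM; apply: normed_cvg.
apply: (@series_le_cvg _ _ (geometric M 4^-1)) => [n|n||].
- exact: normr_ge0.
- by rewrite (le_trans _ (geometric_quarter_le x01 cM n)).
- by move=> n; exact: geometric_quarter_le.
- by apply: is_cvg_geometric_series; rewrite ger0_norm ?invr_ge0// invf_lt1// ltr1n.
Qed.

Lemma power_sum_recl M x c : 0 <= x <= 4^-1 -> (forall n, `|c n| <= M) ->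
  power_sum c x = c 0%N + x * power_sum (fun n => c n.+1) x.
Proof.
move=> x01 cM; apply: (@cvg_lim _ _ _ \oo) => //.
have cS n : `|c n.+1| <= M by [].
have lim1 : (fun n => c 0%N + x * series (fun k => c k.+1 * x ^+ k) n) @ \oo -->
    c 0%N + x * power_sum (fun n => c n.+1) x.
  by apply: cvgD; [exact: cvg_cst|apply: cvgMr; exact: power_sum_cvg cS].
rewrite -(cvg_shiftS (series _)) /=.
rewrite (_ : (fun n => _) = (fun n => c 0%N + x * series (fun k => c k.+1 * x ^+ k) n))//.
apply/funext => n; rewrite /series /= big_nat_recl//= expr0 mulr1 mulr_sumr.
by congr (_ + _); apply: eq_bigr => i _; rewrite exprS; ring.
Qed.

Lemma power_sum_le M x c : 0 <= x <= 4^-1 -> (forall n, `|c n| <= M) ->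
  `|power_sum c x| <= 4 / 3 * M.
Proof.
move=> x01 cM; have cv := @power_sum_cvg M x c x01 cM.
have M0 : 0 <= M := le_trans (normr_ge0 _) (cM 0%N).
have partial n : `|series (fun k => c k * x ^+ k) n| <= 4 / 3 * M.
  rewrite /series /= (le_trans (ler_norm_sum _ _ _))//.
  apply: (@le_trans _ _ (series (geometric M 4^-1) n)).
    by apply: ler_sum => i _; exact: geometric_quarter_le.
  rewrite geometric_seriesE ?lt_eqF ?invf_lt1 ?ltr1n//=.
  have : 0 <= (4^-1 : R) ^+ n by rewrite exprn_ge0// invr_ge0.
  have -> : (1 - 4^-1 : R) = 3 / 4 by field.
  have -> : M * (1 - 4^-1 ^+ n) / (3 / 4) = 4 / 3 * (M - M * 4^-1 ^+ n) by field.
  move=> q0; rewrite ler_wpM2l// ?divr_ge0// lerBlDr lerDl.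
  exact: mulr_ge0.
rewrite -(cvg_lim (@norm_hausdorff _ _) (cvg_norm cv)).
apply: limr_le; first by apply/cvg_ex; eexists; exact: cvg_norm cv.
exact: nearW.
Qed.

(* Division of the power series by [y - x]: the coefficients of the quotient are
   the values at [x] of the tails of [c]. *)
Lemma power_sum_sub M x y c : 0 <= x <= 4^-1 -> 0 <= y <= 4^-1 ->
  (forall n, `|c n| <= M) ->
  power_sum c y - power_sum c x =
  (y - x) * power_sum (fun n => power_sum (fun k => c (n.+1 + k)%N) x) y.
Proof.
move=> x01 y01 cM; pose G n := power_sum (fun k => c (n + k)%N) x.
have GM n : `|G n| <= 4 / 3 * M by apply: power_sum_le => // k.
have GE n : G n = c n + x * G n.+1.
  rewrite /G (@power_sum_recl M)// addn0.
  by congr (_ + x * power_sum _ _); apply/funext => k; rewrite addnS.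
pose S n := series (fun n => G n.+1 * y ^+ n) n.
have SE n : (y - x) * S n = G n * y ^+ n + series (fun k => c k * y ^+ k) n - G 0%N.
  elim: n => [|n IHn]; first by rewrite /S /series /= !big_geq// mulr0 expr0 mulr1 addr0 subrr.
  rewrite /S /series /= !big_nat_recr//= mulrDr -/(series _ n) -/(S n) IHn (GE n) exprS.
  by rewrite /series /=; ring.
have cvG : G n * y ^+ n @[n --> \oo] --> (0 : R).
  have := @power_sum_cvg _ y G y01 GM.
  by move=> /cvgP/cvg_series_cvg_0.
have cv1 : (y - x) * S n @[n --> \oo] --> (y - x) * power_sum (fun n => G n.+1) y.
  by apply: cvgMr; apply: power_sum_cvg => // n; exact: GM.
have cv2 : (y - x) * S n @[n --> \oo] --> 0 + power_sum c y - G 0%N.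
  under eq_fun do rewrite SE; apply: cvgB; last exact: cvg_cst.
  by apply: cvgD => //; exact: power_sum_cvg cM.
rewrite -[LHS]/(_ - G 0%N) -[LHS]add0r addrA.
exact: cvg_unique cv2 cv1.
Qed.

(** Each zero divided off turns the coefficient bound M into 4/3 M and contributes a factor y - x of
    absolute value at most 1/4: a net factor 1/3. The constant 2 covers the 4/3 of the case without
    zeros. *)
Lemma power_sum_zeros_le M c (s : seq R) y :
  (forall n, `|c n| <= M) -> uniq s ->
  (forall x, x \in s -> 0 <= x <= 4^-1 /\ power_sum c x = 0) ->
  0 <= y <= 4^-1 -> `|power_sum c y| <= 2 * M * 3^-1 ^+ size s.
Proof.
elim: s M c y => [|x s IHs] M c y cM; have M0 : 0 <= M := le_trans (normr_ge0 _) (cM 0%N).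
  move=> _ _ y01; rewrite expr0 mulr1 (le_trans (power_sum_le y01 cM))//.
  by rewrite ler_wpM2r//; lra.
move=> /= /andP[xs us] sP y01.
have [x01 x0] := sP _ (mem_head x s).
rewrite -[power_sum c y]subr0 -x0 (power_sum_sub x01 y01 cM) normrM.
set c' := fun n => power_sum _ x.
have c'M n : `|c' n| <= 4 / 3 * M by apply: power_sum_le => // k.
have /(_ _ _ _ c'M us) := IHs; move=> /(_ y) IH.
apply: (@le_trans _ _ (4^-1 * (2 * (4 / 3 * M) * 3^-1 ^+ size s))).
  apply: ler_pM => //; last first.
    apply: IH => // z zs; have [z01 z0] := sP z (mem_behead (s := x :: s) zs).
    split=> //; have := power_sum_sub x01 z01 cM; rewrite z0 x0 subrr => /esym/eqP.
    rewrite mulf_eq0 subr_eq0 => /orP[/eqP zx|/eqP//].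
    by rewrite zx in zs; rewrite zs in xs.
  move: x01 y01 => /andP[? ?] /andP[? ?]; rewrite ler_norml; apply/andP; split; lra.
by rewrite exprS le_eqVlt; apply/orP; left; apply/eqP; field.
Qed.

Lemma power_sum_eq0 M c : (forall n, `|c n| <= M) ->
  (forall n, exists s, [/\ uniq s, size s = n &
     forall x, x \in s -> 0 <= x <= 4^-1 /\ power_sum c x = 0]) ->
  forall y, 0 <= y <= 4^-1 -> power_sum c y = 0.
Proof.
move=> cM inf y y01; apply/normr0_eq0/eqP; rewrite eq_le normr_ge0 andbT.
have cv0 : geometric (2 * M) 3^-1 n @[n --> \oo] --> (0 : R).
  by apply: cvg_geometric; rewrite ger0_norm ?invr_ge0// invf_lt1// ltr1n.
rewrite -(cvg_lim (@norm_hausdorff _ _) cv0).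
apply: limr_ge; first exact: cvgP cv0.
apply: nearW => n; have [s [us <- sP]] := inf n.
exact: power_sum_zeros_le cM us sP y01.
Qed.

(** A series vanishing on the whole interval has constant term 0, and away from 0 a factor x can be
    cancelled, so the shifted series again has infinitely many zeros. *)
Lemma power_sum_infinite_zeros M c : (forall n, `|c n| <= M) ->
  (forall n, exists s, [/\ uniq s, size s = n &
     forall x, x \in s -> 0 <= x <= 4^-1 /\ power_sum c x = 0]) ->
  forall n, c n = 0.
Proof.
move=> cM inf n; elim: n c cM inf => [|n IHn] c cM inf.
  have q0 : 0 <= (0 : R) <= 4^-1 by rewrite lexx invr_ge0 ler0n.
  have := power_sum_eq0 cM inf q0; rewrite (@power_sum_recl M)//.
  by rewrite mul0r addr0.
have zero := power_sum_eq0 cM inf.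
apply: (IHn (fun k => c k.+1)) => // N.
exists [seq (4 + k%:R)^-1 | k <- iota 0 N]; rewrite size_map size_iota; split=> //.
  rewrite map_inj_uniq ?iota_uniq// => i j /invr_inj /addrI/eqP.
  by rewrite eqr_nat => /eqP.
move=> x /mapP[k _ ->{x}]; set x := _^-1.
have x0 : 0 < x by rewrite invr_gt0 ltr_wpDr.
have x01 : 0 <= x <= 4^-1.
  by rewrite ltW//= lef_pV2 ?posrE ?ltr_wpDr ?lerDl.
split=> //; have := zero x x01; rewrite (@power_sum_recl M)//.
have -> : c 0%N = 0.
  have := zero 0; rewrite lexx invr_ge0 ler0n (@power_sum_recl M)//; first by rewrite mul0r addr0; exact.
  by rewrite lexx invr_ge0 ler0n.
by rewrite add0r => /eqP; rewrite mulf_eq0 gt_eqF//= => /eqP.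
Qed.

Lemma power_sum_zeros_countable M c (T : Type) (A : set T) (l : T -> R) :
  (forall n, `|c n| <= M) -> (exists n, c n != 0) ->
  (forall s t, A s -> A t -> l s = l t -> s = t) ->
  (forall t, A t -> 0 <= l t <= 4^-1 /\ power_sum c (l t) = 0) ->
  countable A.
Proof.
move=> cM [n cn0] linj lA; apply: finite_set_countable.
apply: contrapT => infA.
have lA_A : (l @` A #= A)%card.
  by apply: inj_card_eq => x y /set_mem Ax /set_mem Ay; exact: linj.
have infl : infinite_set (l @` A) by rewrite (eq_finite_set lA_A).
move/eqP: cn0; apply; apply: (power_sum_infinite_zeros cM) => N.
have [B BA NB] := infinite_set_fset N infl.
exists (take N (enum_fset B)); split.
- by rewrite take_uniq// fset_uniq.
- by rewrite size_takel.
- by move=> x /mem_take xB; have [t At <-] := BA x xB; exact: lA.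
Qed.
End PowerSeriesZeros.

(** * Hahn-Banach *)

Section HahnBanach.
Variables (R : realType) (X : normedModType R).
Implicit Types (q : X -> R) (x y : X) (t : R).

Definition sublinear q : Prop :=
  (forall x y, q (x + y) <= q x + q y) /\ (forall t x, 0 <= t -> q (t *: x) <= t * q x).

Lemma sublinear0 q : sublinear q -> q 0 = 0.
Proof.
move=> [qD qZ]; apply/eqP; rewrite eq_le; apply/andP; split.
  by have := qZ 0 0 (lexx _); rewrite scale0r mul0r.
by have := qD 0 0; rewrite addr0 lerDl.
Qed.

Lemma sublinearZ q t x : sublinear q -> 0 <= t -> q (t *: x) = t * q x.
Proof.
move=> sq; have [qD qZ] := sq; rewrite le_eqVlt => /orP[/eqP <-|t0].
  by rewrite scale0r mul0r sublinear0.
apply/eqP; rewrite eq_le; apply/andP; split; first exact/qZ/ltW.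
rewrite -ler_pdivlMl//.
have := qZ t^-1 (t *: x); rewrite scalerA mulVf ?gt_eqF// scale1r; apply.
by rewrite invr_ge0 ltW.
Qed.

Lemma sublinear_ge q x : sublinear q -> - q (- x) <= q x.
Proof.
move=> sq; have := sq.1 x (- x); rewrite subrr sublinear0// => h; lra.
Qed.

(* The largest sublinear functional below [q] that is linear in the direction
   of [y]. *)
Definition slope q y x : R := inf [set q (x + t *: y) - t * q y | t in [set t | 0 <= t]].

Lemma slope_has_inf q y x : sublinear q ->
  has_inf [set q (x + t *: y) - t * q y | t in [set t | 0 <= t]].
Proof.
move=> sq; split; first by exists (q (x + 0 *: y) - 0 * q y), 0 => //=.
exists (- q (- x)) => _ [t /= t0 <-]; rewrite -(sublinearZ _ sq t0).
have := sq.1 (x + t *: y) (- x); rewrite addrAC subrr add0r => h; lra.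
Qed.

Lemma slope_le q y x t : sublinear q -> 0 <= t -> slope q y x <= q (x + t *: y) - t * q y.
Proof.
move=> sq t0; apply: ge_inf; last by exists t.
by have [] := slope_has_inf y x sq.
Qed.

Lemma le_slope q y x a : (forall t, 0 <= t -> a <= q (x + t *: y) - t * q y) -> a <= slope q y x.
Proof.
move=> h; apply: lb_le_inf; first by exists (q (x + 0 *: y) - 0 * q y), 0 => //=.
by move=> _ [t /= t0 <-]; exact: h.
Qed.

Lemma slope_sublinear q y : sublinear q -> sublinear (slope q y).
Proof.
move=> sq; split=> [x x'|s x s0].
  rewrite -lerBlDr; apply: le_slope => t t0; rewrite lerBlDr -lerBlDl.
  apply: le_slope => t' t'0; rewrite lerBlDl.
  apply: le_trans (slope_le y (x + x') sq (addr_ge0 t0 t'0)) _.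
  have := sq.1 (x + t *: y) (x' + t' *: y); rewrite addrACA -scalerDl => h; lra.
move: s0; rewrite le_eqVlt => /orP[/eqP <-|s0].
  rewrite scale0r mul0r (le_trans (slope_le y 0 sq (lexx 0)))//.
  by rewrite scale0r addr0 mul0r subr0 sublinear0.
rewrite -ler_pdivrMl//; apply: le_slope => t t0.
rewrite ler_pdivrMl//; apply: le_trans (slope_le y _ sq (mulr_ge0 (ltW s0) t0)) _.
by rewrite -scalerA -scalerDr (sublinearZ _ sq (ltW s0)) mulrBr mulrA.
Qed.

(** Zorn's lemma is applied to the reversed order. The pointwise infimum bounds a chain:
    [- q0 (- x)] keeps it finite, and of any two members of the chain the smaller one serves for
    both arguments in subadditivity. *)
Lemma minimal_sublinear q0 : sublinear q0 -> exists q, [/\ sublinear q,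
  forall x, q x <= q0 x &
  forall q', sublinear q' -> (forall x, q' x <= q x) -> q' = q].
Proof.
move=> sq0; pose T := {q | sublinear q /\ forall x, q x <= q0 x}.
pose r (q q' : T) := `[< forall x, sval q' x <= sval q x >].
have [||||q qmin] := @Zorn T r.
- by move=> q; apply/asboolP => x; exact: lexx.
- by move=> q q' q'' /asboolP h1 /asboolP h2; apply/asboolP => x; exact: le_trans (h2 x) (h1 x).
- move=> [q hq] [q' hq'] /asboolP /= h1 /asboolP /= h2; apply: eq_exist; apply/funext => x.
  by apply/eqP; rewrite eq_le h1 h2.
- move=> A totA; have [[s0 As0]|nA] := pselect (A !=set0); last first.
    exists (exist _ q0 (conj sq0 (fun x => lexx _))) => s As.
    by case: nA; exists s.
  pose V x := [set sval s x | s in A].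
  have infV x : has_inf (V x).
    split; first by exists (sval s0 x), s0.
    exists (- q0 (- x)) => _ [s _ <-]; have [ss sle] := svalP s.
    by rewrite (le_trans _ (sublinear_ge x ss))// lerN2.
  have leV x s : A s -> inf (V x) <= sval s x.
    by move=> As; apply: ge_inf; [exact: (infV x).2|exists s].
  have geV x a : (forall s, A s -> a <= sval s x) -> a <= inf (V x).
    by move=> h; apply: lb_le_inf; [exact: (infV x).1|move=> _ [s As <-]; exact: h].
  have sV : sublinear (fun x => inf (V x)).
    split=> [x y|t x].
      rewrite -lerBlDr; apply: (geV) => s As; rewrite lerBlDr -lerBlDl.
      apply: (geV) => s' As'; rewrite lerBlDl.
      have [/asboolP ss'|/asboolP s's] := totA _ _ As As'.
        rewrite (le_trans (leV _ _ As'))// (le_trans ((svalP s').1.1 x y))//.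
        by rewrite lerD2r.
      rewrite (le_trans (leV _ _ As))// (le_trans ((svalP s).1.1 x y))//.
      by rewrite lerD2l.
    rewrite le_eqVlt => /orP[/eqP <-|t0].
      rewrite mul0r (le_trans (leV _ _ As0))// scale0r.
      by rewrite sublinear0//; exact: (svalP s0).1.
    rewrite -ler_pdivrMl//; apply: (geV) => s As; rewrite ler_pdivrMl//.
    by rewrite (le_trans (leV _ _ As))//; apply: (svalP s).1.2; exact: ltW.
  have V0 x : inf (V x) <= q0 x.
    by rewrite (le_trans (leV x _ As0))//; exact: (svalP s0).2.
  by exists (exist _ (fun x => inf (V x)) (conj sV V0)) => s As; apply/asboolP => x; exact: leV.
exists (sval q); split=> [||q' sq' q'q].
- exact: (svalP q).1.
- exact: (svalP q).2.
have q'0 x : q' x <= q0 x := le_trans (q'q x) ((svalP q).2 x).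
by have /(congr1 sval) := qmin (exist _ q' (conj sq' q'0)) (asboolT q'q).
Qed.

(** Minimality makes [q] equal to [slope q y] for every y, and the term t = 1 of that infimum gives
    q x + q y <= q (x + y). *)
Lemma linear_below_sublinear q0 : sublinear q0 -> exists2 f : {linear X -> R^o},
  (forall x, f x <= q0 x) & True.
Proof.
move=> /minimal_sublinear[q [sq qq0 qmin]].
have sup_add x y : q x + q y <= q (x + y).
  have -> : q x = slope q y x.
    rewrite (qmin _ (slope_sublinear y sq))// => z.
    by rewrite (le_trans (slope_le y z sq (lexx 0)))// scale0r addr0 mul0r subr0.
  have := slope_le y x sq ler01; rewrite scale1r mul1r => h; lra.
have qD x y : q (x + y) = q x + q y by apply/eqP; rewrite eq_le sup_add sq.1.
have qN x : q (- x) = - q x.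
  by apply/eqP; rewrite -addr_eq0 addrC -qD subrr sublinear0.
have lin : linear (q : X -> R^o).
  move=> a x y; rewrite qD; congr (_ + _).
  have [a0|a0] := leP 0 a; first exact: sublinearZ.
  by rewrite -[a]opprK scaleNr qN sublinearZ ?oppr_ge0 1?ltW// scaleNr.
pose f : {linear X -> R^o} := HB.pack (q : X -> R^o) (GRing.isLinear.Build R X R^o *:%R q lin).
by exists f.
Qed.

Lemma linear_le_norm_continuous (f : {linear X -> R^o}) :
  (forall x, f x <= `|x|) -> continuous f.
Proof.
move=> fM; apply/bounded_linear_continuous/linear_boundedP.
near=> r => x; apply: (@le_trans _ _ `|x|).
  rewrite ler_norml fM andbT lerNl -(linearN f).
  by rewrite (le_trans (fM _))// normrN.
by rewrite ler_peMl//; near: r; exact: nbhs_pinfty_ge.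
Unshelve. all: by end_near. Qed.

Lemma linear_continuous_bound (f : {linear X -> R^o}) : continuous f ->
  exists2 M, 0 < M & forall x, `|f x| <= M * `|x|.
Proof.
move=> /linear_bounded_continuous/linear_boundedP h.
have [M M0 fM] := pinfty_ex_gt0 h.
by exists M.
Qed.

Lemma lspan_addZ (Z : set X) a x y : lspan Z x -> lspan Z y -> lspan Z (a *: x + y).
Proof.
move=> [m [c [z [Zz ->]]]] [n [c' [z' [Zz' ->]]]].
exists (m + n)%N, (fun i => match fintype.split i with inl j => a * c j | inr j => c' j end),
  (fun i => match fintype.split i with inl j => z j | inr j => z' j end); split.
  by move=> i; case: (fintype.split i).
rewrite big_split_ord /= scaler_sumr; congr (_ + _); apply: eq_bigr => i _.
  by rewrite (unsplitK (inl i)) scalerA.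
by rewrite (unsplitK (inr i)).
Qed.

Lemma lspan_sub (Z : set X) : Z `<=` lspan Z.
Proof.
move=> z Zz; exists 1%N, (fun=> 1), (fun=> z); split=> //.
by rewrite big_ord1 scale1r.
Qed.

Lemma lspan0 (Z : set X) : lspan Z 0.
Proof.
by exists 0%N, (fun=> 0), (fun=> 0); split; [case|rewrite big_ord0].
Qed.

Lemma lspan_sum (Z : set X) (I : Type) (s : seq I) (c : I -> R) (z : I -> X) :
  (forall i, lspan Z (z i)) -> lspan Z (\sum_(i <- s) c i *: z i).
Proof.
move=> Zz; elim/big_rec: _ => [|i x _ Zx]; first exact: lspan0.
exact: lspan_addZ.
Qed.

Lemma hahn_banach_dense (Z : set X) :
  (forall f : {linear X -> R^o}, continuous f -> (forall z, Z z -> f z = 0) ->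
    forall x, f x = 0) -> linearly_dense Z.
Proof.
move=> hf O [x0 Ox0] oO; apply: contrapT => nO.
have /nbhs_normP[r /= r0 rO] : nbhs x0 O by exact: open_nbhs_nbhs.
pose V x := [set `|x - l| | l in lspan Z].
pose d x := inf (V x).
have d_le x l : lspan Z l -> d x <= `|x - l|.
  by move=> Zl; apply: ge_inf; [exists 0 => _ [? _ <-]|exists l].
have le_d x a : (forall l, lspan Z l -> a <= `|x - l|) -> a <= d x.
  move=> h; apply: lb_le_inf; last by move=> _ [l Zl <-]; exact: h.
  by exists `|x - 0|, 0 => //; exact: lspan0.
have dx0 : r <= d x0.
  apply: (le_d) => l Zl; rewrite leNgt; apply/negP => lr; apply: nO.
  by exists l; split=> //; exact: rO.
have sd : sublinear d.
  split=> [x y|t x].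
    rewrite -lerBlDr; apply: (le_d) => l Zl; rewrite lerBlDr -lerBlDl.
    apply: (le_d) => l' Zl'; rewrite lerBlDl.
    have Zll' : lspan Z (l + l') by rewrite -[l]scale1r; exact: lspan_addZ.
    by rewrite (le_trans (d_le _ _ Zll'))// opprD addrACA (le_trans (ler_normD _ _)).
  rewrite le_eqVlt => /orP[/eqP <-|t0].
    by rewrite mul0r scale0r (le_trans (d_le _ _ (lspan0 Z)))// subr0 normr0.
  rewrite -ler_pdivrMl//; apply: (le_d) => l Zl; rewrite ler_pdivrMl//.
  have Ztl : lspan Z (t *: l) by rewrite -[_ *: _]addr0; apply: lspan_addZ => //; exact: lspan0.
  by rewrite (le_trans (d_le _ _ Ztl))// -scalerBr normrZ gtr0_norm.
(* A functional below the distance [d] to the span vanishes on Z, but it could vanish everywhere.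
   Staying below the slope in the direction x0 forces f (- x0) <= d 0 - d x0 < 0. *)
have [f fle _] := linear_below_sublinear (slope_sublinear x0 sd).
have fd x : f x <= d x.
  by rewrite (le_trans (fle x))// (le_trans (slope_le x0 x sd (lexx 0)))// scale0r addr0 mul0r subr0.
have fx0 : f (- x0) <= - d x0.
  rewrite (le_trans (fle _))// (le_trans (slope_le x0 _ sd ler01))//.
  by rewrite scale1r addNr (sublinear0 sd) mul1r sub0r.
have fn x : f x <= `|x|.
  by rewrite (le_trans (fd x))// (le_trans (d_le _ _ (lspan0 Z)))// subr0.
have fZ z : Z z -> f z <= 0.
  move=> Zz; rewrite (le_trans (fd z))// (le_trans (d_le z z _))// ?subrr ?normr0//.
  exact: lspan_sub.
have fmZ z : Z z -> f (- z) <= 0.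
  move=> Zz; rewrite (le_trans (fd _))// (le_trans (d_le _ (- z) _))// ?subrr ?normr0//.
  by rewrite -scaleN1r -[_ *: _]addr0; apply: lspan_addZ; [exact: lspan_sub|exact: lspan0].
have := hf f (linear_le_norm_continuous fn) _ (- x0).
move=> h; move: fx0; rewrite h ?oppr_ge0.
  by move=> /(le_trans dx0); rewrite leNgt r0.
move=> z Zz; apply/eqP; rewrite eq_le fZ//=.
by have := fmZ z Zz; rewrite linearN oppr_le0.
Qed.
End HahnBanach.

(** * A criterion for overcompleteness *)

Section Density.
Variables (R : realType) (X : normedModType R).
Implicit Types (Z D : set X).

Lemma denseP D : dense D <-> forall x e, 0 < e -> exists2 y, D y & `|x - y| < e.
Proof.
split=> [dD x e e0|h O [x Ox] oO].
  have [|y [xy Dy]] := dD (ball x e) (ex_intro _ x (ballxx x e0)).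
    exact: ball_open.
  by exists y => //; move: xy; rewrite -ball_normE.
have /nbhs_ballP[e /= e0 eO] : nbhs x O by exact: open_nbhs_nbhs.
have [y Dy xy] := h x e e0.
by exists y; split=> //; apply: eO; rewrite -ball_normE.
Qed.

Lemma linear_eq0_dense Z (f : {linear X -> R^o}) : linearly_dense Z ->
  continuous f -> (forall z, Z z -> f z = 0) -> forall x, f x = 0.
Proof.
move=> Zd cf fZ x; apply: contrapT => fx0.
have oO : open (f @^-1` [set r : R^o | r != 0]).
  move/continuousP : cf; apply; rewrite (_ : [set r | _] = ~` [set 0]).
    exact/closed_openC/accessible_closed_set1/hausdorff_accessible/Rhausdorff.
  by apply/seteqP; split => r /=; [move=> /eqP|move=> /eqP].
have [|y [/= /eqP fy [n [c [z [Zz yE]]]]]] := Zd _ _ oO.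
  by exists x; apply/eqP.
apply: fy; rewrite yE linear_sum big1// => i _.
by rewrite linearZ /= fZ// scaler0.
Qed.

Definition ratspan Z : set X := [set x | exists s : seq (rat * X),
  (forall p, p \in s -> Z p.2) /\ x = \sum_(p <- s) ratr p.1 *: p.2].

Lemma ratspan_dense Z : linearly_dense Z -> dense (ratspan Z).
Proof.
move=> /denseP Zd; apply/denseP => x e e0.
have [_ [n [c [z [Zz ->]]]] xy] := Zd x (e / 2) (divr_gt0 e0 (ltr0n _ 2)).
set y := \sum_i _ in xy.
have ex_q i : exists q : rat, `|c i - ratr q| * `|z i| <= e / 2 / n.+1%:R.
  have d0 : 0 < e / 2 / n.+1%:R / (`|z i| + 1).
    by rewrite !divr_gt0// ?ltr_wpDl.
  have [q] := rat_in_itvoo (ltr_pwDr d0 (lexx (c i))).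
  rewrite in_itv /= => /andP[cq qc]; exists q.
  have : `|c i - ratr q| <= e / 2 / n.+1%:R / (`|z i| + 1).
    by rewrite distrC ger0_norm ?subr_ge0 ?ltW// ltrBlDl.
  rewrite ler_pdivlMr ?ltr_wpDl//; apply: le_trans.
  by rewrite ler_wpM2l// lerDl.
have [q qP] := choice ex_q.
exists (\sum_(p <- [seq (q i, z i) | i <- enum 'I_n]) ratr p.1 *: p.2).
  exists [seq (q i, z i) | i <- enum 'I_n]; split=> //.
  by move=> p /mapP[i _ ->]; exact: Zz.
rewrite big_map big_enum /=.
rewrite (_ : x - _ = (x - y) + (y - \sum_i ratr (q i) *: z i)); last by rewrite addrA subrK.
rewrite (le_lt_trans (ler_normD _ _))// [e in ltRHS]splitr ltr_leD//.
rewrite /y -sumrB (le_trans (ler_norm_sum _ _ _))//.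
apply: (@le_trans _ _ (\sum_(i < n) e / 2 / n.+1%:R)).
  by apply: ler_sum => i _; rewrite -scalerBl normrZ; exact: qP.
rewrite sumr_const card_ord -[leLHS]mulr_natr mulrAC ler_pdivrMr//.
by rewrite ler_pM2l ?divr_gt0// ler_nat.
Qed.

Lemma countable_range_or_empty (T : Type) (A : set T) :
  countable A -> A = set0 \/ exists f : nat -> T, A = range f.
Proof.
move=> cA; have [->|/set0P[a Aa]] := eqVneq A set0; [by left|right].
have /countable_injP[g ginj] := cA.
have ex n : exists t, A t /\ forall u, A u -> g u = n -> t = u.
  have [[u [Au gu]]|no] := pselect (exists u, A u /\ g u = n).
    by exists u; split=> // v Av gv; apply: ginj; rewrite ?inE// gu gv.
  by exists a; split=> // u Au gu; case: no; exists u.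
have [f fP] := choice ex; exists f; apply/seteqP; split=> [t At|_ [n _ <-]].
  by exists (g t) => //; have [_] := fP (g t); exact.
by have [] := fP n.
Qed.

Lemma ratspan_countable Z : countable Z -> countable (ratspan Z).
Proof.
move=> /countable_range_or_empty[->|[f ->]].
  apply: sub_countable (countable1 (0 : X)); apply: subset_card_le => x [s [sP ->]].
  rewrite /= big_seq big1// => p /sP //.
pose g (s : seq (rat * nat)) : X := \sum_(p <- s) ratr p.1 *: f p.2.
apply: sub_countable (sub_countable (card_image_le g setT) (countableP _)).
apply: subset_card_le => x [s [sP ->]].
have ex p : exists n, p \in s -> f n = p.2.
  have [ps|nps] := boolP (p \in s); last by exists 0%N.
  by have [n _ fn] := sP p ps; exists n.
have [i iP] := choice ex.
exists [seq (p.1, i p) | p <- s] => //; rewrite /g big_map.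
by rewrite !big_seq; apply: eq_bigr => p /iP /= ->.
Qed.

Definition nonseparable : Prop := forall D, dense D -> ~ countable D.

Lemma separated_nonseparable (d : omega1 -> X) (e : R) : 0 < e ->
  (forall a b, a != b -> e <= `|d a - d b|) -> nonseparable.
Proof.
move=> e0 sep D /denseP dD cD; apply: omega1_uncountable.
have ex a : exists y, D y /\ `|d a - y| < e / 2.
  by have [y Dy ay] := dD (d a) (e / 2) (divr_gt0 e0 (ltr0n _ 2)); exists y.
have [y yP] := choice ex.
apply: sub_countable cD; apply: (card_le_inj (f := y)) => [a _|a b _ _ yab].
  by have [] := yP a.
apply/eqP; apply: contraT => /sep; rewrite leNgt => /negP[].
have [_ ay] := yP a; have [_ by_] := yP b; rewrite -yab in by_.
rewrite (_ : d a - d b = (d a - y a) - (d b - y a)); last by rewrite opprB addrA subrK.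
by rewrite (le_lt_trans (ler_normB _ _))// [e]splitr ltrD.
Qed.

(** Finitely many indices are bounded in omega1 and the family increases, so each finite combination
    lives in a single [L a]. The countable rational spans of the [L a] therefore have a dense union,
    of size at most omega1. *)
Lemma has_dens_omega1 (L : omega1 -> set X) :
  (forall a, countable (L a)) -> (forall a b, (a <= b)%O -> L a `<=` L b) ->
  linearly_dense (\bigcup_a L a) -> nonseparable -> has_dens X [set: omega1].
Proof.
move=> cL Lmono Ld nsep; split; last by move=> D /nsep; exact: omega1_card_le.
have dL : dense (\bigcup_a ratspan (L a)).
  apply/denseP => x e e0; have /denseP/(_ x e e0)[y [s [sL ->]] xy] := ratspan_dense Ld.
  exists (\sum_(p <- s) ratr p.1 *: p.2) => //.
  have ex p : exists a, p \in s -> L a p.2.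
    have [ps|nps] := boolP (p \in s).
      by have [a _ La] := sL p ps; exists a.
    by have [a] := omega1_inhabited; exists a.
  have [i iP] := choice ex.
  have cA : countable [set i p | p in [set` s]].
    apply: finite_set_countable; apply: finite_image.
    exact: finite_seq.
  have [g gP] := countable_omega1_bounded cA.
  exists g => //; exists s; split=> // p ps.
  by apply: (Lmono (i p)); [apply: gP; exists p|exact: iP].
exists (\bigcup_a ratspan (L a)) => //.
apply/card_eqPle; split.
  by apply: card_bigcup_omega1 => a; exact: ratspan_countable.
exact/omega1_card_le/nsep.
Qed.

Lemma has_dens_card_eq (T U : Type) (A : set T) (B : set U) :
  (A #= B)%card -> has_dens X A -> has_dens X B.
Proof.
move=> AB [[D dD DA] le_D]; split; first by exists D => //; exact: card_eq_trans DA AB.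
by move=> E dE; rewrite -(card_le_eql AB); exact: le_D.
Qed.

Lemma has_dens_nonseparable : has_dens X [set: omega1] -> nonseparable.
Proof.
move=> [_ le_D] D /le_D wD cD; apply: omega1_uncountable.
exact: sub_countable wD cD.
Qed.

(** [y] may repeat values, yet its range is uncountable: the rational span of a countable range
    would be a countable dense set. *)
Lemma admits_overcomplete_family (y : omega1 -> X) : has_dens X [set: omega1] ->
  (forall A : set omega1, ~ countable A -> linearly_dense (y @` A)) ->
  admits_overcomplete X.
Proof.
move=> dX yP.
have unc : ~ countable (range y).
  move=> /ratspan_countable; apply: has_dens_nonseparable => //.
  exact/ratspan_dense/yP/omega1_uncountable.
have eqY : ([set: omega1] #= range y)%card.
  apply/card_eqPle; split; [exact: omega1_card_le|exact: card_image_le].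
exists (range y); split; first exact: has_dens_card_eq dX.
move=> Z Zy ZY; rewrite (_ : Z = y @` (y @^-1` Z)).
  apply: yP => cZ; apply: unc; move: ZY => /card_eqPle[_ YZ].
  apply: sub_countable YZ _; apply: sub_countable cZ.
  apply: card_le_trans (card_image_le y _); apply: subset_card_le => z Zz.
  by have [a _ az] := Zy z Zz; exists a => //; rewrite /preimage /= az.
apply/seteqP; split=> [z Zz|_ [a Za <-]//].
by have [a _ az] := Zy z Zz; exists a => //; rewrite /preimage /= az.
Qed.
End Density.

Lemma uncountable_quarter_itv (R : realType) :
  ~ countable [set x : R | 0 <= x <= 4^-1].
Proof.
move=> /countable_lebesgue_measure0; rewrite (_ : [set x | _] = `[0, 4^-1]%classic).
  rewrite lebesgue_measure_itv /= lte_fin invr_gt0 ltr0n oppr0 adde0 => -[] /eqP.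
  by rewrite invr_eq0 pnatr_eq0.
by apply/seteqP; split => x /=; rewrite in_itv.
Qed.

(** * Linear density of uncountable sets of geometric sums *)

Section KeyLemma.
Variables (R : realType) (X : normedModType R).
Variables (B : set X) (M : R) (d : omega1 -> X) (u : X).
Hypothesis B_bound : forall x, B x -> `|x| <= M.
Hypothesis B_cvg : forall v : nat -> X, (forall n, B (v n)) ->
  forall l : R, 0 <= l <= 4^-1 -> cvgn (series (fun n => l ^+ n *: v n)).
Hypothesis B0 : B 0.
Hypothesis Bu : B u.
Hypothesis Bd : forall a, B (d a).
Hypothesis Bdd : forall a b, B (d a - d b).
Hypothesis d_dense : linearly_dense (u |` range d).
Hypothesis d_eventually_cst : forall f : {linear X -> R^o}, continuous f ->
  exists v g, forall a, (g <= a)%O -> f (d a) = v.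

Section Terms.
Variable e : omega1 -> omega1 -> nat.
Hypothesis e_inj : forall a b c, (b <= a)%O -> (c <= a)%O -> e a b = e a c -> b = c.

Definition terms (a : omega1) (n : nat) : X :=
  match n with
  | 0 => d a
  | 1 => u
  | k.+2 => if pselect (exists b, (b < a)%O /\ e a b = k) is left h
            then d (sval (cid h)) - d a else 0
  end.

Lemma B_terms a n : B (terms a n).
Proof. by case: n => [|[|n]] //=; case: pselect. Qed.

Lemma terms_lt a b : (b < a)%O -> terms a (e a b).+2 = d b - d a.
Proof.
move=> ba /=; case: pselect => [h|[]]; last by exists b.
case: cid => c [/= ca eac]; congr (d _ - _).
by apply: e_inj eac; exact: ltW.
Qed.

Lemma terms_eq0 a k : (forall b, (b < a)%O -> e a b <> k) -> terms a k.+2 = 0.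
Proof. by move=> no /=; case: pselect => // -[b [ba eab]]; case: (no b ba). Qed.

(** Beyond g the functional no longer separates [d b] from [d a], so the places of the b > g, like
    the empty ones, have coefficient 0. A place taken by some b <= g has coefficient f (d b) - v, in
    which a does not occur. *)
Lemma terms_coef (f : {linear X -> R^o}) v g a a' :
  (forall a, (g <= a)%O -> f (d a) = v) -> (g < a)%O -> (g < a')%O ->
  (forall b, (b <= g)%O -> e a b = e a' b) ->
  forall n, f (terms a n) = f (terms a' n).
Proof.
move=> fv.
have small b c k : (g < c)%O -> (b <= g)%O -> e c b = k -> f (terms c k.+2) = f (d b) - v.
  by move=> gc bg <-; rewrite terms_lt ?linearB ?(fv c (ltW gc))// (le_lt_trans bg).
have large c k : (g < c)%O -> (forall b, (b <= g)%O -> e c b <> k) -> f (terms c k.+2) = 0.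
  move=> gc no.
  have [[b [bc ecb]]|no'] := pselect (exists b, (b < c)%O /\ e c b = k).
    have gb : (g < b)%O by rewrite ltNge; apply/negP => /no.
    by rewrite -ecb terms_lt// linearB /= !fv ?subrr// ltW.
  by rewrite terms_eq0 ?linear0// => b bc ecb; apply: no'; exists b.
move=> ga ga' ee [|[|k]]; [by rewrite /= !fv// ltW|by []|].
have [[b [bg eab]]|no] := pselect (exists b, (b <= g)%O /\ e a b = k).
  by rewrite (small b)// (small b)// -ee.
rewrite !large// => b bg eab; apply: no; exists b; split=> //.
by rewrite ee.
Qed.
End Terms.

Lemma overcomplete_family : exists y : omega1 -> X,
  forall A : set omega1, ~ countable A -> linearly_dense (y @` A).
Proof.
have [e [k [e_inj ek]]] := coherent_injections.
have [l [l01 l_inj]] := card_le_exists_inj (0 : R)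
  (omega1_card_le (@uncountable_quarter_itv R)).
pose y a := limn (series (fun n => l a ^+ n *: terms e a n)).
have yP a : series (fun n => l a ^+ n *: terms e a n) @ \oo --> y a.
  by apply: B_cvg; [exact: B_terms|exact: l01].
have fy (f : {linear X -> R^o}) a : continuous f ->
    f (y a) = power_sum (fun n => f (terms e a n)) (l a).
  move=> cf; have := cvg_comp _ _ (yP a) (cf (y a)).
  rewrite (_ : f \o _ = series (fun n => f (terms e a n) * l a ^+ n)); last first.
    apply/funext => n; rewrite /series /= linear_sum.
    by apply: eq_bigr => i _; rewrite linearZ /=; exact: mulrC.
  by move=> /cvg_lim => /(_ (@norm_hausdorff _ _)) <-.
exists y => A uncA; apply: hahn_banach_dense => f cf fA x; apply: contrapT => fx.
have [N N0 fN] := linear_continuous_bound cf.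
have [v [g gv]] := d_eventually_cst cf.
have fM a n : `|f (terms e a n)| <= N * M.
  by rewrite (le_trans (fN _))// ler_pM2l// B_bound//; exact: B_terms.
(* Some coefficient survives for large a: the limit v at place 0, or f u at place 1, or, when both
   are 0, the value f (d b) of one fixed b once a exceeds b. Otherwise f would vanish on a linearly
   dense set. *)
have [g' gg' nz] : exists2 g', (g <= g')%O &
    forall a, (g' < a)%O -> exists n, f (terms e a n) != 0.
  have [v0|v0] := eqVneq v 0; last first.
    by exists g => // a ga; exists 0%N; rewrite /= gv// ltW.
  have [fu|fu] := eqVneq (f u) 0; last by exists g => // a _; exists 1%N.
  have [b fb] : exists b, f (d b) != 0.
    apply: contrapT => /forallNP no; apply: fx.
    apply: (linear_eq0_dense d_dense cf) => z [->//|[b _ <-]].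
    by apply/eqP; apply: contraT => /no.
  exists (Order.max g b); first by rewrite le_max lexx.
  move=> a; rewrite gt_max => /andP[ga ba]; exists (e a b).+2.
  by rewrite terms_lt// linearB /= (gv a) ?ltW// v0 subr0.
have gv' a : (g' <= a)%O -> f (d a) = v by move=> /(le_trans gg'); exact: gv.
(* Within a class of equal [k g' a] the coefficients coincide, so the reals [l a] of the class are
   zeros of one nonzero power series. *)
pose A' i := [set a | [/\ A a, (g' < a)%O & k g' a = i]].
apply: uncA.
have : countable ([set a | (a <= g')%O] `|` \bigcup_i A' i).
  rewrite -bigcup2E; apply: bigcup_countable => // -[|[|i]] _ /=.
  - exact: omega1_countable_below.
  - apply: bigcup_countable => [|i _]; first exact: countableP.
    have [->|/set0P[a0 [Aa0 ga0 ka0]]] := eqVneq (A' i) set0; first exact: countable0.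
    apply: (@power_sum_zeros_countable _ (N * M) (fun n => f (terms e a0 n)) _ _ l).
    + by move=> n; exact: fM.
    + exact: nz.
    + by move=> s t _ _; exact: l_inj.
    + move=> a [Aa ga ka]; split; first exact: l01.
      have -> : (fun n => f (terms e a0 n)) = (fun n => f (terms e a n)).
        apply/funext; apply: (terms_coef e_inj gv') => // b bg.
        by apply: (ek g') => //; [exact: ltW|exact: ltW|rewrite ka0 ka].
      by rewrite -fy//; apply: fA; exists a.
  - exact: countable0.
apply: sub_countable; apply: subset_card_le => a Aa.
have [ag|ga] := leP a g'; [by left|right].
by exists (k g' a).
Qed.
End KeyLemma.

(** * Weakly Lindelöf determined spaces of density omega1 *)

Section WLD.
Variables (R : realType) (X : normedModType R).
Implicit Types (Z D : set X).

Lemma lspan_mono Z Z' : Z `<=` Z' -> lspan Z `<=` lspan Z'.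
Proof. by move=> ZZ' x [n [c [z [Zz ->]]]]; exists n, c, z; split=> // i; exact: ZZ'. Qed.

Lemma linearly_dense_mono Z Z' : Z `<=` Z' -> linearly_dense Z -> linearly_dense Z'.
Proof.
move=> ZZ' Zd O O0 oO; have [x [Ox Zx]] := Zd O O0 oO.
by exists x; split=> //; exact: lspan_mono Zx.
Qed.

Lemma linearly_dense_countable_sub D x : linearly_dense D ->
  exists C, [/\ countable C, C `<=` D &
    forall e : R, 0 < e -> exists2 y, lspan C y & `|x - y| < e].
Proof.
move=> /denseP Dd.
have ex n : exists C, [/\ countable C, C `<=` D &
    exists2 y, lspan C y & `|x - y| < n.+1%:R^-1].
  have [|y [k [c [z [Dz yE]]]] xy] := Dd x n.+1%:R^-1; first by rewrite invr_gt0.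
  exists (range z); split; first exact: sub_countable (card_image_le _ _) (countableP _).
    by move=> _ [i _ <-].
  by exists y => //; exists k, c, z; split=> // i; exists i.
have [C CP] := choice ex; exists (\bigcup_n C n); split.
- by apply: bigcup_countable => // n _; have [] := CP n.
- by move=> z [n _ Cz]; have [_ CD _] := CP n; exact: CD.
move=> e e0; have [n ne] : exists n, n.+1%:R^-1 < e.
  exists (Num.truncn e^-1); rewrite invf_plt ?posrE//.
  exact: truncnS_gt.
have [_ _ [y Cy xy]] := CP n; exists y; last exact: lt_trans xy ne.
by apply: lspan_mono Cy => z Cz; exists n.
Qed.

(** The enumeration inverts an injection and is padded by [t0], which is thus the only value it can
    repeat. Hence a set that avoids [t0] and meets [A] in a countable set has a countable
    preimage. *)
Lemma card_le_omega1_range (T : Type) (t0 : T) (A : set T) : (A #<= [set: omega1])%card ->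
  exists d : omega1 -> T, [/\ A `<=` range d, forall a, A (d a) \/ d a = t0 &
    forall S : set T, countable (S `&` A) -> ~ S t0 -> countable [set a | S (d a)]].
Proof.
have [a0] := omega1_inhabited; move=> /(card_le_exists_inj a0)[j [_ j_inj]].
have ex a : exists x, (A x /\ j x = a) \/ (x = t0 /\ forall y, A y -> j y <> a).
  have [[x [Ax jx]]|no] := pselect (exists x, A x /\ j x = a); first by exists x; left.
  by exists t0; right; split=> // y Ay jy; apply: no; exists y.
have [d dP] := choice ex; exists d; split.
- move=> x Ax; exists (j x) => //; have [[Ad jd]|[_ /(_ x Ax)]//] := dP (j x).
  exact: j_inj.
- by move=> a; have [[]|[]] := dP a; [left|right].
- move=> S cS nS; apply: sub_countable (sub_countable (card_image_le j _) cS).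
  apply: subset_card_le => a /= Sa; have [[Ad jd]|[dt _]] := dP a.
    by exists (d a).
  by rewrite dt in Sa.
Qed.

(** [D] may be larger than omega1. The points of a dense set of size omega1 are approximated from
    countable subsets of [D], whose union has size at most omega1 and is still linearly dense.
    Enumerated along omega1, it is eventually null under every functional, because countable sets of
    indices are bounded. *)
Lemma wld_overcomplete (B : set X) (M : R) (D : set X) :
  (forall x, B x -> `|x| <= M) ->
  (forall v : nat -> X, (forall n, B (v n)) ->
    forall l : R, 0 <= l <= 4^-1 -> cvgn (series (fun n => l ^+ n *: v n))) ->
  (forall x y, x = 0 \/ D x -> y = 0 \/ D y -> B (x - y)) ->
  linearly_dense D ->
  (forall f : {linear X -> R^o}, continuous f -> countable [set x | D x /\ f x != 0]) ->
  has_dens X [set: omega1] -> admits_overcomplete X.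
Proof.
move=> B_bound B_cvg BD Dd cD dX.
have [[E /denseP dE /card_eqPle[Ew _]] _] := dX.
have [e [eE _ _]] := card_le_omega1_range 0 Ew.
have [C CP] := choice (fun a => linearly_dense_countable_sub (e a) Dd).
have [|d [dC d0 d_cnt]] := @card_le_omega1_range _ 0 (\bigcup_a C a).
  by apply: card_bigcup_omega1 => a; have [] := CP a.
have d0D a : d a = 0 \/ D (d a).
  have [[b _ Cb]|->] := d0 a; [right|by left].
  by have [_ CD _] := CP b; exact: CD.
have [||||||y yP] := @overcomplete_family R X B M d 0 B_bound B_cvg.
- by rewrite -[0]subr0; apply: BD; left.
- by rewrite -[0]subr0; apply: BD; left.
- by move=> a; rewrite -[d a]subr0; apply: BD => //; left.
- by move=> a b; exact: BD.
- apply/denseP => x r r0.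
  have [z /eE[a _ <-] xz] := dE x (r / 2) (divr_gt0 r0 (ltr0n _ 2)).
  have [_ _ /(_ (r / 2) (divr_gt0 r0 (ltr0n _ 2)))[w Cw zw]] := CP a.
  exists w; first by apply: lspan_mono Cw => t Ct; right; apply: dC; exists a.
  rewrite (_ : x - w = (x - e a) + (e a - w)); last by rewrite addrA subrK.
  by rewrite (le_lt_trans (ler_normD _ _))// [r]splitr ltrD.
- move=> f cf; exists 0.
  have [|g gP] := @countable_omega1_bounded [set a | f (d a) != 0].
    apply: (d_cnt (fun x => f x != 0)); last by rewrite linear0 eqxx.
    apply: sub_countable (cD f cf); apply: subset_card_le => x [fx [b _ Cb]]; split=> //.
    by have [_ CD _] := CP b; exact: CD.
  have [h gh _] := omega1_succ_exists g; exists h => a ha.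
  apply/eqP; apply: contraT => /gP ag.
  by have := lt_le_trans gh (le_trans ha ag); rewrite ltxx.
- exact: admits_overcomplete_family yP.
Qed.
End WLD.

Lemma complete_geometric_cvg (R : realType) (X : completeNormedModType R) (M : R)
    (v : nat -> X) (l : R) : (forall n, `|v n| <= M) -> 0 <= l <= 4^-1 ->
  cvgn (series (fun n => l ^+ n *: v n)).
Proof.
move=> vM l01; apply: normed_cvg.
have vM' n : `| `|v n| | <= M by rewrite normr_id.
rewrite (_ : [normed series _] = series (fun n => `|v n| * l ^+ n)).
  exact: cvgP (power_sum_cvg l01 vM').
congr series; apply/funext => n /=; rewrite normrZ mulrC normrX.
by have /andP[l0 _] := l01; rewrite ger0_norm.
Qed.

Lemma linearly_dense_normalize (R : realType) (X : normedModType R) (D : set X)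
    (c : X -> R) : (forall x, c x != 0) ->
  linearly_dense D -> linearly_dense [set c x *: x | x in D].
Proof.
move=> c0; move=> Dd O O0 oO; have [x [Ox [n [b [z [Dz xE]]]]]] := Dd O O0 oO.
exists x; split=> //; exists n, (fun i => b i / c (z i)), (fun i => c (z i) *: z i); split.
  by move=> i; exists (z i).
by rewrite xE; apply: eq_bigr => i _; rewrite scalerA mulfVK.
Qed.

Lemma WLD_admits_overcomplete (R : realType) (X : normedModType R) :
  (forall (M : R) (v : nat -> X) (l : R), (forall n, `|v n| <= M) -> 0 <= l <= 4^-1 ->
    cvgn (series (fun n => l ^+ n *: v n))) ->
  WLD X -> has_dens X [set: omega1] -> admits_overcomplete X.
Proof.
move=> X_cvg [D Dd cD]; pose c (x : X) := (1 + `|x|)^-1.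
have c0 x : 0 < c x by rewrite invr_gt0 ltr_pwDl.
apply: (@wld_overcomplete _ _ [set x | `|x| <= 2] 2 [set c x *: x | x in D]) => //.
- by move=> v vB l l01; exact: (X_cvg 2).
- have n1 x : x = 0 \/ [set c x *: x | x in D] x -> `|x| <= 1.
    move=> [->|[y _ <-]]; first by rewrite normr0.
    rewrite normrZ gtr0_norm// /c mulrC ler_pdivrMr ?ltr_pwDl// mul1r lerDr//.
  move=> x y /n1 x1 /n1 y1 /=.
  by rewrite (le_trans (ler_normB _ _))// (_ : 2 = 1 + 1)// lerD.
- by apply: linearly_dense_normalize => // x; rewrite gt_eqF.
- move=> f /cD; apply: sub_countable.
  apply: card_le_trans (card_image_le (fun x => c x *: x) _).
  apply: subset_card_le => _ [[x Dx <-]]; rewrite linearZ /= => fx; exists x => //.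
  by split=> //; apply: contraNneq fx => ->; rewrite scaler0.
Qed.

(** The bound is the same for all coefficient sequences bounded by M, so sums formed at each point
    converge uniformly. Norm convergence in the function spaces below rests on this. *)
Lemma power_sum_tail (R : realType) (M l : R) (c : nat -> R) N :
  0 <= l <= 4^-1 -> (forall n, `|c n| <= M) ->
  `|power_sum c l - series (fun n => c n * l ^+ n) N| <= geometric (4 / 3 * M) 4^-1 N.
Proof.
move=> l01 cM.
have -> : power_sum c l - series (fun n => c n * l ^+ n) N =
    l ^+ N * power_sum (fun n => c (N + n)%N) l.
  elim: N => [|N IHN]; first by rewrite /series /= big_geq// subr0 expr0 mul1r.
  rewrite /series /= big_nat_recr//= opprD addrA -/(series _ N) IHN.
  rewrite (@power_sum_recl _ M)// addn0 mulrDr [c N * _]mulrC addrAC subrr add0r.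
  rewrite exprSr mulrA; congr (_ * power_sum _ _); apply/funext => n.
  by rewrite addnS.
have /andP[l0 l4] := l01.
rewrite normrM normrX (ger0_norm l0) /= [leRHS]mulrC ler_pM ?exprn_ge0//.
  by rewrite lerXn2r ?nnegrE// invr_ge0.
exact: power_sum_le.
Qed.

Lemma geometric_lt (R : realType) (a e : R) : 0 < e ->
  \forall n \near \oo, geometric a 4^-1 n < e.
Proof.
move=> e0; have : geometric a 4^-1 n @[n --> \oo] --> (0 : R).
  by apply: cvg_geometric; rewrite ger0_norm ?invr_ge0// invf_lt1// ltr1n.
by move=> /cvgr_lt; exact.
Qed.

(** Subtracting the truncation to [-e, e] moves a value by at most e and sends small values to 0.
    Applied to a continuous function, it gives a nearby one that vanishes off the closed set where
    the original has absolute value at least e. *)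
Definition soft_threshold (R : realType) (e r : R) : R := r - Num.max (- e) (Num.min e r).

Lemma soft_threshold_dist (R : realType) (e r : R) : 0 <= e -> `|r - soft_threshold e r| <= e.
Proof.
move=> e0; rewrite /soft_threshold opprB addrCA subrr addr0.
rewrite ler_norml le_max lexx /= ge_max ge_min lexx /= andbT.
by rewrite (le_trans _ e0)// oppr_le0.
Qed.

Lemma soft_threshold_eq0 (R : realType) (e r : R) : `|r| <= e -> soft_threshold e r = 0.
Proof.
rewrite ler_norml /soft_threshold => /andP[er re].
by rewrite (min_idPr re) (max_idPr er) subrr.
Qed.

Lemma soft_threshold_norm (R : realType) (e r : R) : 0 <= e ->
  `|soft_threshold e r| <= `|r|.
Proof.
move=> e0; rewrite /soft_threshold; have [r0|r0] := leP 0 r.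
  rewrite (max_idPr _); last by rewrite le_min (le_trans _ e0) ?oppr_le0//= (le_trans _ r0)// oppr_le0.
  rewrite ger0_norm ?subr_ge0 ?ge_min ?lexx ?orbT// ?(ger0_norm r0) lerBlDr lerDl.
  by rewrite le_min e0.
rewrite (min_idPr (le_trans (ltW r0) e0)) (ltr0_norm r0) ler0_norm.
  by rewrite opprB lerBlDr addrC addrN ge_max oppr_le0 e0 ltW.
by rewrite subr_le0 le_max lexx orbT.
Qed.

Lemma continuous_soft_threshold (R : realType) (T : topologicalType) (e : R) (f : T -> R) :
  continuous f -> continuous (fun t => soft_threshold e (f t)).
Proof.
move=> cf t; apply: cvgB; first exact: cf.
apply: (@continuous_max R T (cst (- e)) (fun t => Num.min e (f t))); first exact: cvg_cst.
by apply: (@continuous_min R T (cst e) f); [exact: cvg_cst|exact: cf].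
Qed.

(** * Continuous functions on a compact space *)

Section CSpace.
Variables (R : realType) (K : topologicalType) (cK : compact [set: K]).
Implicit Types f g : C_space R cK.

Definition mkC (f : K -> R) (cf : continuous f) : C_space R cK := MkC_space (mem_set cf).

Lemma mkCE (f : K -> R) (cf : continuous f) t : mkC cf t = f t.
Proof. by []. Qed.

Lemma C_continuous f : continuous f. Proof. exact: set_mem (C_funP f). Qed.

Lemma C_addE f g t : (f + g) t = f t + g t. Proof. by []. Qed.
Lemma C_subE f g t : (f - g) t = f t - g t. Proof. by []. Qed.
Lemma C_scaleE a f t : (a *: f) t = a * f t. Proof. by []. Qed.
Lemma C_zeroE t : (0 : C_space R cK) t = 0. Proof. by []. Qed.
Lemma C_sumE (I : Type) (r : seq I) (P : pred I) (F : I -> C_space R cK) t :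
  (\sum_(i <- r | P i) F i) t = \sum_(i <- r | P i) F i t.
Proof. by elim/big_rec2 : _ => [|i x y _ <-]. Qed.

Lemma C_norm_le f a : 0 <= a -> (forall t, `|f t| <= a) -> `|f| <= a.
Proof. exact: supnorm_le. Qed.

Lemma C_norm_ge f t : `|f t| <= `|f|.
Proof. exact: le_supnorm (C_bounded f). Qed.

Lemma C_geometric_cvg (M : R) (v : nat -> C_space R cK) (l : R) :
  (forall n, `|v n| <= M) -> 0 <= l <= 4^-1 -> cvgn (series (fun n => l ^+ n *: v n)).
Proof.
move=> vM l01; pose S := series (fun n => l ^+ n *: v n).
have vtM t n : `|v n t| <= M by exact: le_trans (C_norm_ge _ _) (vM n).
pose h t := power_sum (fun n => v n t) l.
have SE N t : S N t = series (fun n => v n t * l ^+ n) N.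
  by rewrite /S /series /= C_sumE; apply: eq_bigr => i _; rewrite C_scaleE mulrC.
have hS N t : `|h t - S N t| <= geometric (4 / 3 * M) 4^-1 N.
  by rewrite SE; exact: power_sum_tail.
have ch : continuous h.
  move=> t; apply/cvgrPdist_lt => e e0; have e3 : 0 < e / 3 by rewrite divr_gt0.
  have [N _ /(_ N (leqnn N)) Ne] := geometric_lt (4 / 3 * M) e3.
  have := @C_continuous (S N) t; move=> /cvgrPdist_lt/(_ _ e3); apply: filterS => t' tt'.
  rewrite (_ : h t - h t' = (h t - S N t) + (S N t - S N t') - (h t' - S N t')); last by ring.
  rewrite (le_lt_trans (ler_normB _ _))//.
  have h1 := le_lt_trans (hS N t) Ne; have h2 := le_lt_trans (hS N t') Ne.
  have h3 := ler_normD (h t - S N t) (S N t - S N t'); lra.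
apply/cvg_ex; exists (mkC ch); apply/cvgrPdist_lt => e e0.
near=> N; apply: (@le_lt_trans _ _ (geometric (4 / 3 * M) 4^-1 N)).
  apply: C_norm_le => [|t]; last exact: hS.
  rewrite /= mulr_ge0 ?exprn_ge0 ?invr_ge0// mulr_ge0 ?divr_ge0//.
  exact: le_trans (normr_ge0 _) (vM 0%N).
by near: N; exact: geometric_lt.
Unshelve. all: by end_near. Qed.

Definition indicator (A : set K) (t : K) : R := if pselect (A t) then 1 else 0.

Lemma indicatorT A t : A t -> indicator A t = 1.
Proof. by rewrite /indicator; case: pselect. Qed.

Lemma indicatorF A t : ~ A t -> indicator A t = 0.
Proof. by rewrite /indicator; case: pselect. Qed.

Lemma continuous_indicator (A : set K) : open A -> closed A -> continuous (indicator A).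
Proof.
move=> oA cA t; have [At|nAt] := pselect (A t).
  rewrite /continuous_at indicatorT//; apply: cvg_near_cst.
  have : nbhs t A by exact: open_nbhs_nbhs.
  by apply: filterS => u Au; rewrite /= indicatorT.
rewrite /continuous_at indicatorF//; apply: cvg_near_cst.
have : nbhs t (~` A) by apply: open_nbhs_nbhs; split=> //; exact: closed_openC.
by apply: filterS => u Au; rewrite /= indicatorF.
Qed.

Lemma continuous_cst_fun (a : R) : continuous (fun _ : K => a).
Proof. by move=> x; exact: cvg_cst. Qed.

Definition C_cst a : C_space R cK := mkC (@continuous_cst_fun a).

Lemma C_linearly_denseP (D : set (C_space R cK)) :
  (forall f e, 0 < e -> exists2 g, lspan D g & forall t, `|f t - g t| <= e) ->
  linearly_dense D.
Proof.
move=> h; apply/denseP => f e e0; have e2 : 0 < e / 2 by rewrite divr_gt0.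
have [g Dg fg] := h f _ e2; exists g => //.
apply: (@le_lt_trans _ _ (e / 2)); last by lra.
by apply: C_norm_le => //; exact: ltW.
Qed.
End CSpace.

(** * Continuous functions on [0, omega1] *)

(** Among finitely many members of an increasing family one contains all the others; the finite
    subcover is replaced by a filter of tails of the family. *)
Lemma compact_nested_cover (K : topologicalType) (C : set K) (J : set omega1)
    (U : omega1 -> set K) :
  compact C -> J !=set0 -> (forall b, J b -> open (U b)) ->
  (forall a b, (a <= b)%O -> U a `<=` U b) ->
  C `<=` \bigcup_(b in J) U b -> exists2 b, J b & C `<=` U b.
Proof.
move=> /compact_near_coveringP cC [b0 Jb0] oU Umono CU.
pose F := filter_from J (fun b => [set c | (b <= c)%O] : set omega1).
have FF : Filter F.
  apply: filter_from_filter; first by exists b0.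
  move=> a b Ja Jb; exists (Order.max a b); first by rewrite /Order.max; case: ifP.
  by move=> c /=; rewrite ge_max => /andP.
have [x Cx|b Jb h] := cC _ F (fun b x => U b x) FF.
  have [b Jb Ubx] := CU x Cx.
  exists (U b, [set c | (b <= c)%O]) => /=.
    by split; [apply: open_nbhs_nbhs; split=> //; exact: oU|exists b].
  by move=> [y c] [/= Uby bc]; exact: Umono Uby.
by exists b => //; apply: h; rewrite /= lexx.
Qed.

Section EventuallyConstant.
Variables (R : realType) (K : topologicalType) (cK : compact [set: K]).
Variables (s : omega1 -> K) (oo : K).
Hypothesis K_cases : forall x, x = oo \/ exists a, x = s a.
Variable d : omega1 -> C_space R cK.
Hypothesis d_le1 : forall b x, 0 <= d b x <= 1.
Hypothesis d_oo : forall b, d b oo = 0.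
Hypothesis d_supp : forall b a, (b < a)%O -> d b (s a) = 0.
Hypothesis d_stable : forall g, exists h, forall b c a,
  (h <= b)%O -> (h <= c)%O -> (a <= g)%O -> d b (s a) = d c (s a).

(* Otherwise there are arbitrarily many differences [d b - d c] with pairwise
   disjoint supports on which [f] is at least [e]: with suitable signs, their sum
   has norm at most one. *)
Lemma eventually_small_oscillation (f : {linear C_space R cK -> R^o}) (e : R) :
  continuous f -> 0 < e ->
  exists g, forall b c, (g <= b)%O -> (g <= c)%O -> `|f (d b - d c)| <= e.
Proof.
move=> cf e0; have [N N0 fN] := linear_continuous_bound cf.
apply: contrapT => /forallNP no.
have [h hP] := choice d_stable.
have ex g : exists bc : omega1 * omega1,
    [/\ (h g <= bc.1)%O, (h g <= bc.2)%O & e < `|f (d bc.1 - d bc.2)|].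
  have /existsNP[b /existsNP[c]] := no (h g).
  move=> /not_implyP[gb /not_implyP[gc /negP]]; rewrite -ltNge => ebc.
  by exists (b, c).
have [p pP] := choice ex.
have [g0] := omega1_inhabited.
(* The n-th difference lives on the points after [G n] and up to [G n.+1]: [d_stable] kills it up to
   [G n], and [d_supp] kills it beyond both of its indices. *)
pose next g := Order.max g (Order.max (p g).1 (p g).2).
pose G n := iter n next g0.
have GS n : G n.+1 = Order.max (G n) (Order.max (p (G n)).1 (p (G n)).2) by [].
pose D n := d (p (G n)).1 - d (p (G n)).2.
pose T n := \sum_(i < n) Num.sg (f (D i)) *: D i.
have D0 n a : (a <= G n)%O -> D n (s a) = 0.
  move=> aG; rewrite /D C_subE; have [b1 c1 _] := pP (G n).
  by rewrite (hP (G n) _ _ a b1 c1 aG) subrr.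
have Dsupp n a : (G n.+1 < a)%O -> D n (s a) = 0.
  rewrite GS !gt_max => /and3P[_ b1 c1].
  by rewrite /D C_subE !d_supp ?subrr.
have Doo n : D n oo = 0 by rewrite /D C_subE !d_oo subrr.
have Dle n x : `|D n x| <= 1.
  have /andP[? ?] := d_le1 (p (G n)).1 x; have /andP[? ?] := d_le1 (p (G n)).2 x.
  by rewrite /D C_subE ler_norml; apply/andP; split; lra.
have TS n x : T n.+1 x = T n x + Num.sg (f (D n)) * D n x.
  by rewrite /T big_ord_recr C_addE C_scaleE.
have Gmono n : (G n <= G n.+1)%O by rewrite GS le_max lexx.
have Tsupp n a : (G n < a)%O -> T n (s a) = 0.
  elim: n => [|n IHn] Ga; first by rewrite /T big_ord0.
  by rewrite TS IHn ?(le_lt_trans (Gmono n))// Dsupp// mulr0 addr0.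
have Tle n : `|T n| <= 1.
  apply: C_norm_le => // x; elim: n => [|n IHn].
    by rewrite /T big_ord0 C_zeroE normr0.
  rewrite TS; have [->|[a xa]] := K_cases x.
    rewrite Doo mulr0 addr0; elim: n {IHn} => [|n IHn]; first by rewrite /T big_ord0 C_zeroE normr0.
    by rewrite TS Doo mulr0 addr0.
  rewrite xa in IHn *; have [aG|Ga] := leP a (G n).
    by rewrite D0// mulr0 addr0.
  rewrite Tsupp// add0r normrM (le_trans _ (Dle n (s a)))// ler_piMl//.
  by rewrite normr_sg; case: (_ == _).
have fT n : n%:R * e <= f (T n).
  elim: n => [|n IHn]; first by rewrite /T big_ord0 linear0 mul0r.
  rewrite /T big_ord_recr /= -/(T n) linearD linearZ /= -natr1 mulrDl mul1r lerD//.
  have [_ _ /ltW ef] := pP (G n); apply: le_trans ef _.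
  by rewrite [leRHS](_ : _ = Num.sg (f (D n)) * f (D n))// -normrEsg.
have le_N n : n%:R * e <= N.
  rewrite (le_trans (fT n))// (le_trans (ler_norm _))// (le_trans (fN _))//.
  by rewrite ler_piMr// ltW.
have := le_N (Num.truncn (N / e)).+1.
by rewrite leNgt -ltr_pdivrMr// truncnS_gt.
Qed.

Lemma eventually_constant (f : {linear C_space R cK -> R^o}) :
  continuous f -> exists v g, forall a, (g <= a)%O -> f (d a) = v.
Proof.
move=> cf.
have [g gP] := choice (fun n => @eventually_small_oscillation f n.+1%:R^-1 cf (ltac:(by rewrite invr_gt0))).
have [h hP] : exists h, forall n, (g n <= h)%O.
  have [|h hP] := @countable_omega1_bounded (range g).
    exact: sub_countable (card_image_le _ _) (countableP _).
  by exists h => n; apply: hP; exists n.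
exists (f (d h)), h => a ha; apply/eqP; rewrite -subr_eq0 -linearB -normr_eq0.
apply: contraT; rewrite -normr_gt0 normr_id => n0.
pose n := Num.truncn `|f (d a - d h)|^-1.
have := gP n a h (le_trans (hP n) ha) (hP n).
by rewrite leNgt invf_plt ?posrE// truncnS_gt.
Qed.
End EventuallyConstant.

(** * Clopen segments of omega1 with one point at infinity *)

Section Omega1Space.
Variables (R : realType) (K : topologicalType) (cK : compact [set: K]).
Variables (s : omega1 -> K) (oo : K).
Hypothesis s_inj : injective s.
Hypothesis s_oo : forall a, s a <> oo.
Hypothesis K_cases : forall x, x = oo \/ exists a, x = s a.
Hypothesis open_below : forall b, open (s @` [set a | (a <= b)%O]).
Hypothesis open_above : forall b, open (s @` [set a | (b < a)%O]).
Hypothesis closed_point : forall a, closed [set s a].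
Hypothesis closed_left : forall a, open [set s a] \/
  exists2 x, (x < a)%O & closed (s @` [set y | (x <= y <= a)%O]).

Local Notation I x b := (s @` [set y | (x <= y <= b)%O]).

(** The initial segment up to b need not be closed in K: once a limit point below b is isolated, the
    points under it may accumulate at [oo]. The longest closed segment ending at b takes its place;
    the segment reduced to b shows that there is one. *)
Lemma segment_left_exists b : exists x, [/\ (x <= b)%O, closed (I x b) &
  forall y, (y <= b)%O -> closed (I y b) -> (x <= y)%O].
Proof.
have [|x [xb cx] xmin] := @omega1_min [set x | (x <= b)%O /\ closed (I x b)].
  exists b; split=> //=; rewrite (_ : I b b = [set s b])//.
  apply/seteqP; split=> [_ [y /= by_ <-]|_ ->]; last by exists b => //=; rewrite lexx.
  by rewrite (@le_anti _ _ y b) // andbC.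
by exists x; split=> // y yb cy; exact: xmin.
Qed.

Definition left b := sval (cid (segment_left_exists b)).

Lemma left_le b : (left b <= b)%O.
Proof. by rewrite /left; case: cid => x []. Qed.

Lemma closed_segment b : closed (I (left b) b).
Proof. by rewrite /left; case: cid => x []. Qed.

Lemma left_min b y : (y <= b)%O -> closed (I y b) -> (left b <= y)%O.
Proof. by rewrite /left; case: cid => x [] //= _ _; apply. Qed.

(** Were the left end not isolated, [closed_left] would supply a longer closed segment ending there,
    and gluing it on would contradict minimality. *)
Lemma open_segment b : open (I (left b) b).
Proof.
have oU x : open (s @` [set y | (x < y <= b)%O]).
  rewrite (_ : _ @` _ = (s @` [set a | (x < a)%O]) `&` (s @` [set a | (a <= b)%O])).
    by apply: openI.
  apply/seteqP; split=> [_ [y /= /andP[xy yb] <-]|_ [[y /= xy <-] [z /= zb /s_inj zy]]].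
    by split; exists y.
  by exists y => //=; rewrite xy -zy.
have [opn|[x xl cx]] := closed_left (left b).
  rewrite (_ : I _ _ = [set s (left b)] `|` (s @` [set y | (left b < y <= b)%O])).
    exact: openU.
  apply/seteqP; split=> [_ [y /= /andP[+ yb] <-]|_ [->|[y /= /andP[ly yb] <-]]].
  - by rewrite le_eqVlt => /orP[/eqP ->|ly]; [left|right; exists y => //=; rewrite ly].
  - by exists (left b) => //=; rewrite lexx left_le.
  - by exists y => //=; rewrite ltW.
have : (left b <= x)%O; last by rewrite leNgt xl.
apply: left_min; first exact: le_trans (ltW xl) (left_le b).
rewrite (_ : I x b = I x (left b) `|` I (left b) b).
  by apply: closedU => //; exact: closed_segment.
apply/seteqP; split=> [_ [y /= /andP[xy yb] <-]|_ [[y /= /andP[xy yl] <-]|[y /= /andP[ly yb] <-]]].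
- have [yl|ly] := leP y (left b); [left|right]; exists y => //=.
    by rewrite xy.
  by rewrite ltW.
- by exists y => //=; rewrite xy (le_trans yl (left_le b)).
- by exists y => //=; rewrite yb (le_trans (ltW xl) ly).
Qed.

(** Segments are nested or disjoint. If the segment of g started earlier, gluing would lengthen that
    of b; if it started later, the segment of b cut off at g would lengthen that of g. *)
Lemma left_eq g b : (g <= b)%O -> (left b <= g)%O -> left b = left g.
Proof.
move=> gb bg; apply: le_anti; apply/andP; split.
  have /orP[//|lg] := le_total (left b) (left g).
  apply: left_min; first exact: le_trans (left_le g) gb.
  rewrite (_ : I _ _ = I (left g) g `|` I (left b) b).
    by apply: closedU; exact: closed_segment.
  apply/seteqP; split=> [_ [y /= /andP[xy yb] <-]|_ [[y /= /andP[xy yl] <-]|[y /= /andP[ly yb] <-]]].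
  - have [yl|ly] := leP y g; [left|right]; exists y => //=.
      by rewrite xy.
    by rewrite yb (le_trans bg (ltW ly)).
  - by exists y => //=; rewrite xy (le_trans yl).
  - by exists y => //=; rewrite yb (le_trans lg).
apply: left_min => //; rewrite (_ : I _ _ = I (left b) b `&` ~` (s @` [set a | (g < a)%O])).
  by apply: closedI; [exact: closed_segment|exact: open_closedC].
apply/seteqP; split=> [_ [y /= /andP[ly yg] <-]|_ [[y /= /andP[ly yb] <-] ny]].
  split; first by exists y => //=; rewrite ly (le_trans yg).
  by move=> [z /= gz /s_inj zy]; move: gz; rewrite zy ltNge yg.
exists y => //=; rewrite ly leNgt; apply/negP => gy; apply: ny.
by exists y.
Qed.

Definition segment_fun b : C_space R cK :=
  mkC cK (continuous_indicator (R := R) (@open_segment b) (@closed_segment b)).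

Lemma segment_funE b a : segment_fun b (s a) = (left b <= a <= b)%O%:R.
Proof.
rewrite mkCE; case: (boolP (left b <= a <= b)%O) => h.
  by rewrite indicatorT//; exists a.
by rewrite indicatorF// => -[y /= yb /s_inj ya]; move/negP: h; rewrite -ya.
Qed.

Lemma segment_fun_oo b : segment_fun b oo = 0.
Proof. by rewrite mkCE indicatorF// => -[y _ /s_oo]. Qed.

(** Either the left ends stay below some g0, and then all late segments share one left end, or some
    segment starts after g. In the second case every later segment does so too, since otherwise it
    would contain [b0] and hence have the same left end as the segment of [b0]; the functions are
    then 0 up to g. *)
Lemma segment_fun_stable g : exists h, forall b c a,
  (h <= b)%O -> (h <= c)%O -> (a <= g)%O -> segment_fun b (s a) = segment_fun c (s a).
Proof.
have [[g0 tail]|notail] := pselect (exists g0, forall b, (g0 < b)%O -> (left b <= g0)%O).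
  pose g' := Order.max g g0; have [h gh _] := omega1_succ_exists g'.
  have gg' : (g <= g')%O by rewrite le_max lexx.
  have g0g' : (g0 <= g')%O by rewrite le_max lexx orbT.
  have val b a : (h <= b)%O -> (a <= g)%O -> segment_fun b (s a) = (left g' <= a)%O%:R.
    move=> hb ag; have gb := lt_le_trans gh hb.
    have lb := le_trans (tail b (le_lt_trans g0g' gb)) g0g'.
    rewrite segment_funE (left_eq (ltW gb) lb).
    by rewrite (le_trans ag (le_trans gg' (ltW gb))) andbT.
  by exists h => b c a hb hc ag; rewrite !val.
have [b0 gb0 lb0] : exists2 b, (g < b)%O & (g < left b)%O.
  apply: contrapT => no; apply: notail; exists g => b gb.
  by rewrite leNgt; apply/negP => gl; apply: no; exists b.
have zero b a : (b0 <= b)%O -> (a <= g)%O -> segment_fun b (s a) = 0.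
  move=> b0b ag; rewrite segment_funE (_ : (_ <= _)%O = false)//.
  apply/negbTE; rewrite -ltNge; apply: le_lt_trans ag _.
  rewrite ltNge; apply/negP => lg.
  have := left_eq b0b (le_trans lg (ltW gb0)) => e.
  by move: lg; rewrite e leNgt lb0.
by exists b0 => b c a b0b b0c ag; rewrite !zero.
Qed.

Let one : C_space R cK := C_cst cK 1.
Let D := one |` range segment_fun.

Lemma closed_bounded (C : set K) (J : set omega1) : closed C -> J !=set0 ->
  C `<=` \bigcup_(b in J) (s @` [set a | (a <= b)%O]) ->
  exists2 b, J b & C `<=` s @` [set a | (a <= b)%O].
Proof.
move=> clC J0; apply: compact_nested_cover => //.
- exact: subclosed_compact clC cK _.
- move=> a b ab _ [y /= ya <-]; exists y => //=; exact: le_trans ab.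
Qed.

Lemma closed_threshold (f : C_space R cK) e : closed [set x | e <= `|f x|].
Proof.
have cf : continuous (fun x => `|f x|) by move=> x; apply: cvg_norm; exact: C_continuous.
rewrite (_ : [set x | _] = (fun x => `|f x|) @^-1` [set r | e <= r])//.
by apply: closed_comp; [move=> x _; exact: cf|exact: closed_ge].
Qed.

Definition threshold e (f : C_space R cK) : C_space R cK :=
  mkC cK (continuous_soft_threshold (e := e) (@C_continuous _ _ _ f)).

(** Induction on the bound a of the support. Once the value at a has been removed by a multiple of
    [segment_fun a], the remainder is at least e / 2 only on a compact set strictly below a, hence
    up to some b < a. Thresholding confines it there, and half of the tolerance is left for the
    induction. *)
Lemma segment_fun_approx a (f : C_space R cK) (e : R) : 0 < e ->
  (forall x, ~ (s @` [set b | (b <= a)%O]) x -> f x = 0) ->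
  exists2 g, lspan D g & forall x, `|f x - g x| <= e.
Proof.
elim/(well_founded_ind omega1_wf): a f e => a IHa f e e0 fa.
have e2 : 0 < e / 2 by rewrite divr_gt0.
have Da : D (segment_fun a) by right; exists a.
pose f1 : C_space R cK := f - f (s a) *: segment_fun a.
have f1a : f1 (s a) = 0.
  by rewrite /f1 C_subE C_scaleE segment_funE left_le lexx mulr1 subrr.
have f1_supp x : ~ (s @` [set b | (b <= a)%O]) x -> f1 x = 0.
  move=> nx; rewrite /f1 C_subE C_scaleE fa// sub0r.
  have [->|[y xy]] := K_cases x; first by rewrite segment_fun_oo mulr0 oppr0.
  rewrite xy segment_funE (_ : (_ <= _)%O && _ = false) ?mulr0 ?oppr0//.
  by apply/negP => /andP[_ ya]; apply: nx; exists y.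
have lspan_a : lspan D (f (s a) *: segment_fun a).
  by rewrite -[_ *: _]addr0; apply: lspan_addZ; [exact: lspan_sub|exact: lspan0].
have [small|] := pselect (forall x, `|f1 x| < e / 2).
  exists (f (s a) *: segment_fun a) => // x.
  by rewrite -C_subE (le_trans (ltW (small x)))//; lra.
move=> /existsNP[x0 /negP]; rewrite -leNgt => fx0.
pose C := [set x | e / 2 <= `|f1 x|].
have Ca x : C x -> exists2 y, (y < a)%O & x = s y.
  move=> Cx0; have Cx : e / 2 <= `|f1 x| by exact: Cx0.
  have : (s @` [set b | (b <= a)%O]) x.
    by apply: contrapT => /f1_supp fx; move: Cx; rewrite fx normr0 leNgt e2.
  move=> [y /= ya xy]; exists y => //; rewrite lt_neqAle ya andbT; apply/eqP => yae.
  by move: Cx; rewrite -xy yae f1a normr0 leNgt e2.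
have [|x Cx|b ba Cb] := @closed_bounded C [set b | (b < a)%O] (@closed_threshold f1 (e / 2)).
- by have [y ya _] := Ca x0 fx0; exists y.
- by have [y ya ->] := Ca x Cx; exists y => //; exists y => //=.
have [|g Dg f2g] := IHa b ba (threshold (e / 2) f1) (e / 2) e2.
  move=> x nx; apply: soft_threshold_eq0; rewrite leNgt; apply/negP => /ltW/Cb.
  exact: nx.
exists (f (s a) *: segment_fun a + g).
  by rewrite -(scale1r (f (s a) *: _)); exact: lspan_addZ.
move=> x; have h1 := soft_threshold_dist (f1 x) (ltW e2); have h2 := f2g x.
have -> : f x - (f (s a) *: segment_fun a + g) x =
    (f1 x - threshold (e / 2) f1 x) + (threshold (e / 2) f1 x - g x).
  by rewrite /f1 C_subE C_addE; ring.
rewrite (le_trans (ler_normD _ _))//.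
by rewrite [leRHS]splitr lerD.
Qed.

(** After subtraction of its value at [oo], a function is large only on a compact part of omega1,
    and such a part is bounded. *)
Lemma segment_fun_linearly_dense : linearly_dense D.
Proof.
apply: C_linearly_denseP => f e e0; have e2 : 0 < e / 2 by rewrite divr_gt0.
pose f1 : C_space R cK := f - f oo *: one.
have f1oo : f1 oo = 0 by rewrite /f1 C_subE C_scaleE mkCE mulr1 subrr.
have [a0] := omega1_inhabited.
have [||b _ Cb] := @closed_bounded [set x | e / 2 <= `|f1 x|] setT (@closed_threshold f1 (e / 2)).
- by exists a0.
- move=> x Cx0; have Cx : e / 2 <= `|f1 x| by exact: Cx0.
  have [xoo|[y ->]] := K_cases x; last by exists y => //; exists y => /=.
  by move: Cx; rewrite xoo f1oo normr0 leNgt e2.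
have [|g Dg f2g] := @segment_fun_approx b (threshold (e / 2) f1) (e / 2) e2.
  move=> x nx; apply: soft_threshold_eq0; rewrite leNgt; apply/negP => /ltW/Cb.
  exact: nx.
exists (f oo *: one + g).
  by apply: lspan_addZ => //; apply: lspan_sub; left.
move=> x; have h1 := soft_threshold_dist (f1 x) (ltW e2); have h2 := f2g x.
have -> : f x - (f oo *: one + g) x =
    (f1 x - threshold (e / 2) f1 x) + (threshold (e / 2) f1 x - g x).
  by rewrite /f1 C_subE C_addE; ring.
rewrite (le_trans (ler_normD _ _))//.
by rewrite [leRHS]splitr lerD.
Qed.

Lemma segment_fun_norm b : `|segment_fun b| <= 1.
Proof.
apply: C_norm_le => // x; have [->|[a ->]] := K_cases x.
  by rewrite segment_fun_oo normr0.
by rewrite segment_funE; case: (_ && _); rewrite ?normr1 ?normr0.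
Qed.

Lemma omega1_space_has_dens : has_dens (C_space R cK) [set: omega1].
Proof.
apply: (@has_dens_omega1 _ _ (fun a => one |` segment_fun @` [set b | (b <= a)%O])).
- move=> a; rewrite -bigcup2E; apply: bigcup_countable => // -[|[|i]] _ /=.
  + exact: countable1.
  + exact: sub_countable (card_image_le _ _) (omega1_countable_below a).
  + exact: countable0.
- move=> a b ab f [->|[c /= ca <-]]; [by left|right].
  by exists c => //=; exact: le_trans ab.
- apply: linearly_dense_mono segment_fun_linearly_dense => f [->|[b _ <-]].
    by have [a0] := omega1_inhabited; exists a0 => //; left.
  by exists b => //; right; exists b => /=.
- apply: (@separated_nonseparable _ _ segment_fun 1) => //.
  suff sep a b : (a < b)%O -> 1 <= `|segment_fun a - segment_fun b|.
    move=> a b; rewrite neq_lt => /orP[/sep//|/sep].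
    by rewrite distrC.
  move=> ab; rewrite (le_trans _ (C_norm_ge _ (s b)))// C_subE !segment_funE.
  by rewrite (lt_geF ab) andbF left_le lexx sub0r normrN normr1.
Qed.

Lemma omega1_space_admits_overcomplete : admits_overcomplete (C_space R cK).
Proof.
have seg01 b x : 0 <= segment_fun b x <= 1.
  have [->|[a ->]] := K_cases x; first by rewrite segment_fun_oo lexx ler01.
  by rewrite segment_funE ler0n (@ler_nat R _ 1) leq_b1.
have one1 : `|one| <= 1 by apply: C_norm_le => // x; rewrite mkCE normr1.
have [|||||||y yP] := @overcomplete_family R (C_space R cK)
    [set f | `|f| <= 2] 2 segment_fun one (fun x h => h).
- by move=> v vB l l01; exact: (@C_geometric_cvg _ _ _ 2).
- by rewrite /= normr0.
- by rewrite /= (le_trans one1)// ler1n.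
- by move=> a; rewrite /= (le_trans (segment_fun_norm a))// ler1n.
- move=> a b; rewrite /= (le_trans (ler_normB _ _))// (_ : 2 = 1 + 1)// lerD//;
  exact: segment_fun_norm.
- exact: segment_fun_linearly_dense.
- move=> f cf; apply: (eventually_constant K_cases seg01 segment_fun_oo) => //.
  + move=> b a ba; rewrite segment_funE (lt_geF ba) andbF//.
  + exact: segment_fun_stable.
exact: admits_overcomplete_family omega1_space_has_dens yP.
Qed.
End Omega1Space.

Lemma order_below_open (b : omega1) :
  @open (order_topology omega1) [set a | (a <= b)%O].
Proof.
have [c bc cmin] := omega1_succ_exists b.
rewrite (_ : [set a | _] = `]-oo, (c : order_topology omega1)[%classic).
  exact: lray_open.
apply/seteqP; split=> a /=; rewrite in_itv /=; first by move=> /le_lt_trans; apply.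
by move=> ac; rewrite leNgt; apply/negP => /cmin; rewrite leNgt ac.
Qed.

Lemma omega1_succ_ltE (a b : omega1) : ((Some a : omega1_succ) < Some b)%O = (a < b)%O.
Proof. by rewrite !lt_neqAle. Qed.

(** * The order topology on [0, omega1] *)

Section Two.
Let K : topologicalType := order_topology omega1_succ.

Lemma omega1_succ_admits_overcomplete (R : realType) :
  admits_overcomplete (C_space R omega1_succ_compact).
Proof.
have below b : @open K (Some @` [set a : omega1 | (a <= b)%O]).
  have [c bc cmin] := omega1_succ_exists b.
  rewrite (_ : _ @` _ = `]-oo, (Some c : K)[%classic); first exact: lray_open.
  apply/seteqP; split=> [_ [a /= ab <-]|[a|]]; rewrite /= in_itv //=.
    by rewrite omega1_succ_ltE; exact: le_lt_trans bc.
  rewrite omega1_succ_ltE => ac; exists a => //=.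
  by rewrite leNgt; apply/negP => /cmin; rewrite leNgt ac.
apply: (@omega1_space_admits_overcomplete R K omega1_succ_compact Some None) => //.
- by move=> [a|]; [right; exists a|left].
- move=> b; rewrite (_ : _ @` _ = `](Some b : K), (None : K)[%classic); first exact: itv_open.
  by apply/seteqP; split=> [_ [a /= ab <-]|[a|]]; rewrite /= in_itv //= ?andbT// => ba; exists a; rewrite //= -[X in is_true X]andbT.
- move=> a; rewrite (_ : [set _] = `[(Some a : K), (Some a : K)]%classic); first exact: itv_closed.
  by apply/seteqP; split=> [x /= ->|x /=]; rewrite in_itv /= ?lexx// => ?; exact/esym/le_anti.
- move=> a; have [[x xa]|no] := pselect (exists x, (x < a)%O); [right; exists x => //|left].
    rewrite (_ : _ @` _ = `[(Some x : K), (Some a : K)]%classic); first exact: itv_closed.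
    apply/seteqP; split=> [_ [y /= ya <-]|[y|]]; rewrite /= in_itv //= => h.
    by exists y.
  rewrite (_ : [set Some a] = Some @` [set b : omega1 | (b <= a)%O])//.
  apply/seteqP; split=> [_ ->|_ [y /= ya <-]]; first by exists a => /=.
  congr Some; apply/eqP; rewrite eq_le ya leNgt; apply/negP => ay; apply: no.
  by exists y.
Qed.
End Two.

(** * One-point compactifications after isolating points *)

Section Three.
Variable S : set omega1.
Local Notation T := (omega1_isolating S).

Lemma isolating_open_sub (U : set omega1) :
  (@open (order_topology omega1) `|` [set [set a] | a in S]) U -> @open T U.
Proof.
move=> DU; exists [set U]; last by rewrite bigcup_set1.
move=> _ ->; exists (fset1 (U : set T)); last by rewrite set_fset1 bigcap_set1.
by move=> V; rewrite in_fset1 => /eqP ->; exact/mem_set.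
Qed.

Lemma isolating_open (U : set omega1) : @open (order_topology omega1) U -> @open T U.
Proof. by move=> oU; apply: isolating_open_sub; left. Qed.

Lemma isolating_open1 a : S a -> @open T [set a].
Proof. by move=> Sa; apply: isolating_open_sub; right; exists a. Qed.

(** A subbasic singleton containing [a] would force [S a], so only order-open sets occur in the
    finite intersections around [a]. *)
Lemma isolating_nbhs (a : omega1) (U : set omega1) : ~ S a -> @nbhs _ T a U ->
  @nbhs _ (order_topology omega1) a U.
Proof.
move=> nSa; rewrite nbhsE => -[V [[D' D'D VE] Va] VU].
move: Va; rewrite -VE => -[A D'A Aa].
have [F FD AE] := D'D A D'A.
have AU : A `<=` U by move=> x Ax; apply: VU; rewrite -VE; exists A.
apply: filterS AU _; rewrite -AE.
apply: (@filter_bigI _ _ F id (@nbhs _ (order_topology omega1) a)) => W WF.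
have Wa : W a by move: Aa; rewrite -AE; apply.
have /set_mem [oW|[b Sb bW]] := FD W WF; first exact: open_nbhs_nbhs.
by move: Wa; rewrite -bW /= => ab; rewrite ab in nSa.
Qed.

Lemma isolating_closed (U : set omega1) : @closed (order_topology omega1) U -> @closed T U.
Proof. by move=> /closed_openC/isolating_open/open_closedC; rewrite setCK. Qed.

Lemma one_point_closed (U : set T) : compact U -> closed U ->
  @closed (one_point_compactification T) (Some @` U).
Proof.
move=> cU clU; rewrite -[_ @` _]setCK; apply: open_closedC.
rewrite openE => -[x nx|_]; last first.
  by exists U => // _ [[z nUz <-]|->] [w Uw] // [wz]; apply: nUz; rewrite -wz.
rewrite /interior; change (nbhs x (Some @^-1` ~` (Some @` U))).
apply: (@filterS _ _ _ (~` U)); first by move=> y nUy [z Uz [zy]]; apply: nUy; rewrite -zy.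
apply: open_nbhs_nbhs; split; first exact: closed_openC.
by move=> Ux; apply: nx; exists x.
Qed.

Lemma isolating_admits_overcomplete (R : realType) : locally_compact [set: T] ->
  admits_overcomplete (C_space R (@one_point_compactification_compact T)).
Proof.
move=> lcT.
have closed_itv x y : @closed T [set z | (x <= z <= y)%O].
  apply: isolating_closed.
  rewrite (_ : [set z | _] = `[(x : order_topology omega1), y]%classic).
    exact: itv_closed.
  by apply/seteqP; split=> z /=; rewrite in_itv.
apply: (@omega1_space_admits_overcomplete R (one_point_compactification T) _ Some None) => //.
- by move=> [a|]; [right; exists a|left].
- move=> b; apply: one_point_compactification_open_some.
  exact/isolating_open/order_below_open.
- move=> b; apply: one_point_compactification_open_some; apply: isolating_open.
  rewrite (_ : [set a | _] = `](b : order_topology omega1), +oo[%classic).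
    exact: rray_open.
  by apply/seteqP; split=> z /=; rewrite in_itv /= andbT.
- move=> a; rewrite (_ : [set Some a] = Some @` [set a]); last by rewrite image_set1.
  apply: one_point_closed; first exact: compact_set1.
  rewrite (_ : [set a] = [set z | (a <= z <= a)%O])//.
  by apply/seteqP; split=> [z /= ->|z /= ?]; [rewrite lexx|exact/esym/le_anti].
- move=> a.
  have isolated : @open T [set a] -> @open (one_point_compactification T) [set Some a].
    by move=> oa; rewrite -image_set1; exact: one_point_compactification_open_some.
  have [/isolating_open1/isolated|nSa] := pselect (S a); first by left.
  (* Local compactness gives an order interval around a inside a compact closed set. If it contains
     some x < a, the segment from x to a is compact; if not, cutting it at a shows that a is
     isolated. *)
  have [C] := lcT a Logic.I; rewrite withinET => /(isolating_nbhs nSa).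
  rewrite itv_nbhsE => -[i [oi ai] iC] [cC clC].
  have [[x [xa xi]]|no] := pselect (exists x, (x < a)%O /\ x \in i).
    right; exists x => //; apply: one_point_closed => //.
    apply: subclosed_compact cC _ => // y /= /andP[xy ya]; apply: iC => /=.
    move: xi ai; case: (i) => l r; rewrite !itv_boundlr => /andP[lx _] /andP[_ ar].
    by rewrite (le_trans lx) ?(le_trans _ ar) ?bnd_simp.
  left; apply: isolated.
  rewrite (_ : [set a] = [set` i] `&` [set z | (z <= a)%O]).
    apply: openI; apply: isolating_open; last exact: order_below_open.
    exact: itv_open_ends_open.
  apply/seteqP; split=> [z /= ->|z /= [zi za]]; first by rewrite lexx.
  apply/eqP; rewrite eq_le za leNgt; apply/negP => az; apply: no.
  by exists z.
Qed.
End Three.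

(** * c_0 *)

Section SmallSums.
Variables (R : realType) (X : normedModType R) (I : choiceType) (d : I -> X).

Hypothesis small_sums : forall e : R, 0 < e -> exists2 m, (0 < m)%N &
  forall (s : seq I) (c : I -> R), uniq s -> size s = m -> (forall i, `|c i| <= 1) ->
    `|\sum_(i <- s) c i *: d i| <= e * m%:R.

(** The hypothesis makes sums of m vectors of norm o(m), the opposite of the behaviour of an l_1
    basis. If |f (d i)| >= 1/(n+1) for infinitely many i, then m of them, taken with the right
    signs, have a sum on which f is at least m/(n+1), too much for a norm of at most m/(2 N
    (n+1)). *)
Lemma small_sums_countable (f : {linear X -> R^o}) : continuous f ->
  countable [set i | f (d i) != 0].
Proof.
move=> cf; have [N N0 fN] := linear_continuous_bound cf.
have fin n : finite_set [set i | n.+1%:R^-1 <= `|f (d i)|].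
  apply: contrapT => inf.
  have e0 : 0 < n.+1%:R^-1 / (2 * N) :> R by rewrite divr_gt0 ?invr_gt0 ?mulr_gt0.
  have [m m0 small] := small_sums e0.
  have [B BA mB] := infinite_set_fset m inf.
  pose s := take m (enum_fset B).
  have sB i : i \in s -> n.+1%:R^-1 <= `|f (d i)| by move=> /mem_take /BA.
  have szs : size s = m by rewrite size_takel.
  have us : uniq s by rewrite take_uniq// fset_uniq.
  have sg1 i : `|Num.sg (f (d i)) : R| <= 1 by rewrite normr_sg; case: (_ == _).
  have := fN (\sum_(i <- s) Num.sg (f (d i)) *: d i).
  rewrite linear_sum /= (eq_bigr (fun i => `|f (d i)|)); last first.
    by move=> i _; rewrite linearZ [RHS]normrEsg.
  rewrite ger0_norm; last by apply: sumr_ge0.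
  apply/negP; rewrite -ltNge.
  apply: (@le_lt_trans _ _ (N * (n.+1%:R^-1 / (2 * N) * m%:R))).
    by rewrite ler_pM2l// small.
  apply: (@lt_le_trans _ _ (n.+1%:R^-1 *+ size s)); last first.
    rewrite -(addr0 (_ *+ _)) -iter_addr -[size s]count_predT -big_const_seq.
    by rewrite big_seq [leRHS]big_seq; apply: ler_sum => i /sB.
  rewrite szs -[ltRHS]mulr_natr mulrA ltr_pM2r ?ltr0n//.
  rewrite (_ : N * _ = n.+1%:R^-1 / 2); last by field; rewrite ?gt_eqF.
  by rewrite ltr_pdivrMr// ltr_pMr ?invr_gt0// ltr1n.
have : countable (\bigcup_n [set i | n.+1%:R^-1 <= `|f (d i)|]).
  by apply: bigcup_countable => // n _; exact: finite_set_countable.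
apply: sub_countable; apply: subset_card_le => i /= fi.
have fi0 : 0 < `|f (d i)| by rewrite normr_gt0.
exists (Num.truncn `|f (d i)|^-1) => //=.
by rewrite ltW// invf_plt ?posrE// truncnS_gt.
Qed.

Variables (A : omega1 -> set I) (B : set X) (M : R).
Hypothesis A_countable : forall a, countable (A a).
Hypothesis A_mono : forall a b, (a <= b)%O -> A a `<=` A b.
Hypothesis A_cover : forall i, exists a, A a i.
Hypothesis B_bound : forall x, B x -> `|x| <= M.
Hypothesis B_cvg : forall v : nat -> X, (forall n, B (v n)) ->
  forall l : R, 0 <= l <= 4^-1 -> cvgn (series (fun n => l ^+ n *: v n)).
Hypothesis B_sub : forall x y, x = 0 \/ range d x -> y = 0 \/ range d y -> B (x - y).
Hypothesis d_dense : linearly_dense (range d).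
Hypothesis X_nonseparable : nonseparable X.

Lemma small_sums_overcomplete : admits_overcomplete X.
Proof.
apply: (wld_overcomplete B_bound B_cvg B_sub d_dense).
  move=> f cf; apply: sub_countable (small_sums_countable cf).
  apply: card_le_trans (card_image_le d _); apply: subset_card_le => _ [[i _ <-] fi].
  by exists i.
apply: (@has_dens_omega1 _ _ (fun a => d @` A a)) => //.
- by move=> a; apply: sub_countable (card_image_le _ _) (A_countable a).
- by move=> a b ab _ [i Ai <-]; exists i => //; exact: A_mono Ai.
- apply: linearly_dense_mono d_dense => _ [i _ <-].
  by have [a Aa] := A_cover i; exists a => //; exists i.
Qed.
End SmallSums.

(** * The space c_0 of omega1 *)

Section C0.
Variable R : realType.
Local Notation T := omega1.
Local Notation X := (c0_space T R).

Lemma c0_norm_le (x : X) a : 0 <= a -> (forall t, `|x t| <= a) -> `|x| <= a.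
Proof. exact: supnorm_le. Qed.

Lemma c0_norm_ge (x : X) t : `|x t| <= `|x|.
Proof. exact: le_supnorm (c0_bounded x). Qed.

Lemma c0_subE (x y : X) t : (x - y) t = x t - y t. Proof. by []. Qed.
Lemma c0_scaleE a (x : X) t : (a *: x) t = a * x t. Proof. by []. Qed.
Lemma c0_sumE (I : Type) (r : seq I) (P : pred I) (F : I -> X) t :
  (\sum_(i <- r | P i) F i) t = \sum_(i <- r | P i) F i t.
Proof. by elim/big_rec2 : _ => [|i x y _ <-]. Qed.

Lemma c0_delta_pred (t : T) : (fun u => (u == t)%:R : R) \in @c0_pred T R.
Proof.
apply/mem_set => e e0; apply: sub_finite_set (finite_set1 t) => u /=.
by case: eqP => [-> //|_]; rewrite normr0 leNgt e0.
Qed.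

Definition c0_delta t : X := MkC0_space (c0_delta_pred t).

Lemma c0_deltaE t u : c0_delta t u = (u == t)%:R. Proof. by []. Qed.

Lemma sum_delta (I : eqType) (s : seq I) (c : I -> R) u : uniq s ->
  \sum_(t <- s) c t * (u == t)%:R = if u \in s then c u else 0.
Proof.
move=> us; case: ifP => [us'|/negbT nus].
  rewrite (bigD1_seq u)//= eqxx mulr1 big1 ?addr0// => t tu.
  by rewrite eq_sym (negbTE tu) mulr0.
by rewrite big_seq big1// => t ts; case: eqP => [ut|_]; [rewrite ut ts in nus|rewrite mulr0].
Qed.

Lemma c0_geometric_cvg (M : R) (v : nat -> X) (l : R) :
  (forall n, `|v n| <= M) -> 0 <= l <= 4^-1 -> cvgn (series (fun n => l ^+ n *: v n)).
Proof.
move=> vM l01; pose S := series (fun n => l ^+ n *: v n).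
have vtM t n : `|v n t| <= M by exact: le_trans (c0_norm_ge _ _) (vM n).
pose h t := power_sum (fun n => v n t) l.
have SE N t : S N t = series (fun n => v n t * l ^+ n) N.
  by rewrite /S /series /= c0_sumE; apply: eq_bigr => i _; rewrite c0_scaleE mulrC.
have hS N t : `|h t - S N t| <= geometric (4 / 3 * M) 4^-1 N.
  by rewrite SE; exact: power_sum_tail.
have ch : h \in @c0_pred T R.
  apply/mem_set => e e0; have e2 : 0 < e / 2 by rewrite divr_gt0.
  have [N _ /(_ N (leqnn N)) Ne] := geometric_lt (4 / 3 * M) e2.
  have /set_mem/(_ _ e2) := c0_funP (S N); apply: sub_finite_set => t /= eh.
  have h1 := le_lt_trans (hS N t) Ne.
  have h2 := ler_normD (h t - S N t) (S N t); rewrite subrK in h2.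
  have h3 : 2 * (e / 2) = e by field.
  lra.
apply/cvg_ex; exists (MkC0_space ch : X); apply/cvgrPdist_lt => e e0.
near=> N; apply: (@le_lt_trans _ _ (geometric (4 / 3 * M) 4^-1 N)).
  apply: c0_norm_le => [|t]; last exact: hS.
  rewrite /= mulr_ge0 ?exprn_ge0 ?invr_ge0// mulr_ge0 ?divr_ge0//.
  exact: le_trans (normr_ge0 _) (vM 0%N).
by near: N; exact: geometric_lt.
Unshelve. all: by end_near. Qed.

Lemma c0_delta_norm t : `|c0_delta t| <= 1.
Proof.
by apply: c0_norm_le => // u; rewrite c0_deltaE; case: (_ == _); rewrite ?normr1 ?normr0.
Qed.

Lemma c0_admits_overcomplete : admits_overcomplete X.
Proof.
have B1 (x : X) : x = 0 \/ range c0_delta x -> `|x| <= 1.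
  by move=> [->|[t _ <-]]; rewrite ?normr0// c0_delta_norm.
apply: (@small_sums_overcomplete _ _ _ c0_delta _ (fun a => [set b | (b <= a)%O])
  [set x | `|x| <= 2] 2) => //.
- move=> e e0; exists (Num.truncn e^-1).+1 => // s c us ss c1.
  apply: (@le_trans _ _ 1); last first.
    by rewrite mulrC -ler_pdivrMr// mul1r ltW// truncnS_gt.
  apply: c0_norm_le => // u; rewrite c0_sumE.
  under eq_bigr do rewrite c0_scaleE c0_deltaE.
  by rewrite sum_delta//; case: ifP => _; rewrite ?normr0.
- exact: omega1_countable_below.
- by move=> a b ab c /= ca; exact: le_trans ab.
- by move=> a; exists a => /=.
- by move=> v vB l l01; exact: (@c0_geometric_cvg 2).
- move=> x y /B1 x1 /B1 y1 /=.
  by rewrite (le_trans (ler_normB _ _))// (_ : 2 = 1 + 1)// lerD.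
- apply/denseP => x e e0; have e2 : 0 < e / 2 by rewrite divr_gt0.
  have /set_mem/(_ _ e2) fin := c0_funP x.
  pose s := enum_fset (fset_set [set t | e / 2 <= `|x t|]).
  have sP t : (t \in s) = (e / 2 <= `|x t|).
    by rewrite /s in_fset_set//; apply/idP/idP => [/set_mem|/mem_set].
  exists (\sum_(t <- s) x t *: c0_delta t).
    by apply: lspan_sum => t; apply: lspan_sub; exists t.
  apply: (@le_lt_trans _ _ (e / 2)); last by lra.
  apply: c0_norm_le => [|u]; first exact: ltW.
  rewrite c0_subE c0_sumE.
  under eq_bigr do rewrite c0_scaleE c0_deltaE.
  rewrite sum_delta ?fset_uniq// sP; case: (leP (e / 2) `|x u|) => h; first by rewrite subrr normr0 ltW.
  by rewrite subr0 ltW.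
- apply: (@separated_nonseparable _ _ c0_delta 1) => // a b ab.
  rewrite (le_trans _ (c0_norm_ge _ a))// c0_subE !c0_deltaE eqxx (negbTE ab).
  by rewrite subr0 normr1.
Qed.
End C0.

(** * l_p *)

Section Ellp.
Variables (R : realType) (p : R) (p1 : 1 <= p).
Local Notation T := omega1.
Local Notation X := (@ellp_space T R p p1).
Let p0 : 0 < p. Proof. exact: lt_le_trans p1. Qed.

Lemma ellp_addE (x y : X) t : (x + y) t = x t + y t. Proof. by []. Qed.
Lemma ellp_subE (x y : X) t : (x - y) t = x t - y t. Proof. by []. Qed.
Lemma ellp_scaleE a (x : X) t : (a *: x) t = a * x t. Proof. by []. Qed.
Lemma ellp_sumE (I : Type) (r : seq I) (P : pred I) (F : I -> X) t :
  (\sum_(i <- r | P i) F i) t = \sum_(i <- r | P i) F i t.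
Proof. by elim/big_rec2 : _ => [|i x y _ <-]. Qed.

Lemma psum_fsupp (s : seq T) (x : T -> R) : uniq s ->
  psum p (fun t => if t \in s then x t else 0) = (\sum_(t <- s) `|x t| `^ p)%:E.
Proof.
move=> us; rewrite /psum -sumEFin (fsbig_seq _ _ us) -esum_fset; last first.
- by move=> t _; rewrite lee_fin powR_ge0.
- exact: finite_seq.
rewrite [RHS]esum_mkcond; apply: eq_esum => t _.
rewrite mem_setE; case: ifP => //.
by rewrite normr0 powR0// gt_eqF.
Qed.

Lemma le_psum (x : T -> R) (s : seq T) : uniq s ->
  ((\sum_(t <- s) `|x t| `^ p)%:E <= psum p x)%E.
Proof.
move=> us; rewrite -psum_fsupp//; apply: le_esum => t _.
by case: ifP => // _; rewrite normr0 powR0 ?gt_eqF// lee_fin powR_ge0.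
Qed.

Lemma psum_le (x : T -> R) (a : R) :
  (forall s, uniq s -> \sum_(t <- s) `|x t| `^ p <= a) -> (psum p x <= a%:E)%E.
Proof.
move=> h; apply: ge_ereal_sup => _ [A [finA _] <-].
rewrite fsbig_finite//= sumEFin lee_fin; apply: h; exact: fset_uniq.
Qed.

Lemma ellp_fsupp_pred (s : seq T) (x : T -> R) :
  (fun t => if t \in s then x t else 0) \in @ellp_pred T R p p1.
Proof.
apply/mem_set => /=; rewrite (_ : (fun t => _) = fun t => if t \in undup s then x t else 0).
  by rewrite psum_fsupp ?undup_uniq// ltry.
by apply/funext => t; rewrite mem_undup.
Qed.

Definition ellp_fsupp (s : seq T) (x : T -> R) : X := MkEllp (ellp_fsupp_pred s x).

Lemma ellp_fsuppE s x t : ellp_fsupp s x t = if t \in s then x t else 0.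
Proof. by []. Qed.

Lemma ellp_norm_leP (x : X) a : 0 <= a ->
  (forall s, uniq s -> \sum_(t <- s) `|x t| `^ p <= a `^ p) -> `|x| <= a.
Proof. by move=> a0 h; apply: (ellp_norm_le p1 a0); exact: psum_le. Qed.

Lemma sum_le_ellp_norm (x : X) s : uniq s -> \sum_(t <- s) `|x t| `^ p <= `|x| `^ p.
Proof. by move=> us; rewrite -lee_fin -(psum_fin p1 (ellp_fin x)) le_psum. Qed.

Lemma ellp_norm_ge (x : X) t : `|x t| <= `|x|.
Proof.
have := @sum_le_ellp_norm x [:: t] isT; rewrite big_seq1 => le_p.
rewrite leNgt; apply/negP => lt; move: le_p; rewrite leNgt => /negP; apply.
by apply: gt0_ltr_powR => //; rewrite nnegrE.
Qed.

Lemma ellp_fsupp_norm_le s x a : 0 <= a -> uniq s ->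
  \sum_(t <- s) `|x t| `^ p <= a `^ p -> `|ellp_fsupp s x| <= a.
Proof.
by move=> a0 us h; apply: (ellp_norm_le p1 a0); rewrite psum_fsupp// lee_fin.
Qed.

Lemma ellp_fsupp_norm s (x : X) : uniq s -> `|ellp_fsupp s x| <= `|x|.
Proof. by move=> us; apply: ellp_fsupp_norm_le => //; exact: sum_le_ellp_norm. Qed.

Definition ellp_delta t : X := ellp_fsupp [:: t] (fun=> 1).

Lemma ellp_deltaE t u : ellp_delta t u = (u == t)%:R.
Proof. by rewrite ellp_fsuppE inE; case: eqP. Qed.

Lemma ellp_delta_norm t : `|ellp_delta t| <= 1.
Proof. by apply: ellp_fsupp_norm_le => //; rewrite big_seq1 normr1. Qed.

Lemma ellp_extensional (x y : X) : (forall t, x t = y t) -> x = y.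
Proof. by move=> xy; apply: val_inj; apply/funext. Qed.

Lemma ellp_fsupp_sum s x : uniq s -> ellp_fsupp s x = \sum_(t <- s) x t *: ellp_delta t.
Proof.
move=> us; apply: ellp_extensional => u; rewrite ellp_sumE.
under eq_bigr do rewrite ellp_scaleE ellp_deltaE.
by rewrite sum_delta.
Qed.

(** Uniform closeness of the pointwise limit h to the partial sums does not control the p-norm. On a
    finite set s, the difference h - S N is therefore split at a later partial sum: S m - S N has
    norm at most q N, while h - S m contributes at most [size s] times q m on s, which is negligible
    for large m. A bound valid on all finite sets then yields both membership and convergence. *)
Lemma ellp_geometric_cvg (M : R) (v : nat -> X) (l : R) :
  (forall n, `|v n| <= M) -> 0 <= l <= 4^-1 -> cvgn (series (fun n => l ^+ n *: v n)).
Proof.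
move=> vM l01; pose S := series (fun n => l ^+ n *: v n).
have M0 : 0 <= M := le_trans (normr_ge0 _) (vM 0%N).
have vtM t n : `|v n t| <= M by exact: le_trans (ellp_norm_ge _ _) (vM n).
pose h t := power_sum (fun n => v n t) l.
pose q N : R := geometric (4 / 3 * M) 4^-1 N.
have q0 N : 0 <= q N.
  by rewrite /q /= mulr_ge0 ?exprn_ge0 ?invr_ge0// mulr_ge0 ?divr_ge0.
have SE N t : S N t = series (fun n => v n t * l ^+ n) N.
  by rewrite /S /series /= ellp_sumE; apply: eq_bigr => i _; rewrite ellp_scaleE mulrC.
have hS N t : `|h t - S N t| <= q N by rewrite SE; exact: power_sum_tail.
(* The increments telescope: q N - q N.+1 is exactly M / 4^N. *)
have SS N m : `|S (N + m)%N - S N| <= q N - q (N + m)%N.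
  elim: m => [|m IHm]; first by rewrite addn0 !subrr normr0.
  rewrite addnS {1}/S /series /= big_nat_recr//= -/(series _ _) -/(S _) addrAC.
  rewrite (le_trans (ler_normD _ _))//.
  apply: (@le_trans _ _ (q N - q (N + m)%N + 4^-1 ^+ (N + m) * M)).
    rewrite lerD// normrZ ler_pM// normrX.
    have /andP[l0 l4] := l01.
    by rewrite (ger0_norm l0) lerXn2r ?nnegrE// invr_ge0.
  by rewrite /q /= exprS le_eqVlt; apply/orP; left; apply/eqP; field.
have hSle N s : uniq s -> `|ellp_fsupp s (fun t => h t - S N t)| <= q N.
  move=> us; apply/ler_addgt0Pr => e e0.
  have [m0 _ /(_ _ (leq_addl N m0)) qe] := geometric_lt ((size s)%:R * (4 / 3 * M)) e0.
  set m := (N + m0)%N in qe.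
  have -> : ellp_fsupp s (fun t => h t - S N t) =
      ellp_fsupp s (fun t => h t - S m t) + ellp_fsupp s (S m - S N).
    apply: ellp_extensional => t; rewrite ellp_addE !ellp_fsuppE ellp_subE.
    by case: ifP => _; [rewrite addrA subrK|rewrite addr0].
  rewrite (le_trans (ler_normD _ _))// addrC lerD//.
    apply: le_trans (ellp_fsupp_norm _ us) _; apply: le_trans (SS _ _) _.
    by rewrite lerBlDr lerDl.
  rewrite ellp_fsupp_sum// (le_trans (ler_norm_sum _ _ _))//.
  have qE : geometric ((size s)%:R * (4 / 3 * M)) 4^-1 m = q m *+ size s.
    by rewrite /q /= -[RHS]mulr_natl [RHS]mulrA.
  apply: le_trans _ (ltW qe); rewrite qE.
  rewrite -[leRHS](addr0 (_ *+ _)) -iter_addr -[size s]count_predT -big_const_seq.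
  apply: ler_sum => t _; rewrite normrZ.
  by rewrite (le_trans _ (hS m t))// ler_piMr// ellp_delta_norm.
have hSsum N s : uniq s -> \sum_(t <- s) `|h t - S N t| `^ p <= q N `^ p.
  move=> us; have := sum_le_ellp_norm (ellp_fsupp s (fun t => h t - S N t)) us.
  rewrite big_seq (eq_bigr (fun t => `|h t - S N t| `^ p)) => [|t ts].
    rewrite -big_seq => /le_trans; apply.
    by rewrite ge0_ler_powR ?nnegrE ?hSle// ltW.
  by rewrite ellp_fsuppE ts.
have ch : h \in @ellp_pred T R p p1.
  apply/mem_set => /=; apply: (@le_lt_trans _ _ (q 0%N `^ p)%:E); last exact: ltry.
  apply: psum_le => s us; have := hSsum 0%N s us.
  by under eq_bigr do rewrite SE /series /= big_geq// subr0.
apply/cvg_ex; exists (MkEllp ch : X); apply/cvgrPdist_lt => e e0.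
near=> N; apply: (@le_lt_trans _ _ (q N)).
  by apply: ellp_norm_leP => // s us; exact: hSsum.
by near: N; exact: geometric_lt.
Unshelve. all: by end_near. Qed.

Lemma ellp_delta_dense : linearly_dense (range ellp_delta).
Proof.
apply/denseP => x e e0; have e2 : 0 < e / 2 by rewrite divr_gt0.
have ep : 0 < (e / 2) `^ p by rewrite powR_gt0.
have fin : psum p x \is a fin_num by rewrite ge0_fin_numE ?psum_ge0// ellp_fin.
have [A finA Alt] : exists2 A : set T, finite_set A &
    (psum p x - ((e / 2) `^ p)%:E < \sum_(i \in A) (`|x i| `^ p)%:E)%E.
  by have [_ [A [finA _] <-] Alt] := ub_ereal_sup_adherent ep fin; exists A.
pose s := enum_fset (fset_set A).
have us : uniq s by exact: fset_uniq.
exists (\sum_(t <- s) x t *: ellp_delta t); first by apply: lspan_sum => t; apply: lspan_sub; exists t.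
rewrite -ellp_fsupp_sum//; apply: (@le_lt_trans _ _ (e / 2)); last by lra.
apply: ellp_norm_leP => [|s' us']; first exact: ltW.
move: Alt; rewrite fsbig_finite// sumEFin -/s (psum_fin p1 (ellp_fin x)).
rewrite -EFinB lte_fin ltrBlDr -ltrBlDl => Alt; apply: le_trans (ltW Alt).
pose r := [seq t <- s' | t \notin s].
have usr : uniq (s ++ r).
  rewrite cat_uniq us filter_uniq// andbT /=.
  by apply/hasPn => t; rewrite mem_filter => /andP[].
have := sum_le_ellp_norm x usr; rewrite big_cat -lerBrDl; apply: le_trans.
rewrite /r big_filter [leRHS]big_mkcond; apply: ler_sum => t _.
rewrite ellp_subE ellp_fsuppE; case: ifP => _ /=; last by rewrite subr0.
by rewrite subrr normr0 powR0 ?gt_eqF// .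
Qed.

Lemma ellp_admits_overcomplete : 1 < p -> admits_overcomplete X.
Proof.
move=> lt1p.
have B1 (x : X) : x = 0 \/ range ellp_delta x -> `|x| <= 1.
  by move=> [->|[t _ <-]]; rewrite ?normr0// ellp_delta_norm.
apply: (@small_sums_overcomplete _ _ _ ellp_delta _ (fun a => [set b | (b <= a)%O])
  [set x | `|x| <= 2] 2) => //.
(* A sum of m unit vectors with coefficients at most 1 has norm at most m^(1/p), which is at most e
   m as soon as m >= e^(-p/(p-1)). This is where 1 < p enters. *)
- move=> e e0; pose m := (Num.truncn (e `^ (- (p / (p - 1))))).+1.
  exists m => // s c us ss c1.
  have m0 : 0 < m%:R :> R by rewrite ltr0n.
  have pm1 : 0 < p - 1 by rewrite subr_gt0.
  rewrite -ellp_fsupp_sum//; apply: ellp_fsupp_norm_le => //.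
    by rewrite mulr_ge0// ltW.
  apply: (@le_trans _ _ m%:R).
    rewrite -ss -[leRHS](addr0) -iter_addr -[size s]count_predT -big_const_seq.
    apply: ler_sum => t _; rewrite (_ : 1 = 1 `^ p); last by rewrite powR1.
    by rewrite ge0_ler_powR ?nnegrE// ltW.
  have -> : (e * m%:R) `^ p = m%:R * (e `^ p * m%:R `^ (p - 1)).
    by rewrite powRM ?ltW// -[in LHS](mulr_powRB1 (ltW m0) p0) mulrCA.
  apply: ler_peMr; first exact: ltW.
  have em : e `^ (- (p / (p - 1))) <= m%:R by rewrite ltW// truncnS_gt.
  have : (e `^ (- (p / (p - 1)))) `^ (p - 1) <= m%:R `^ (p - 1).
    by apply: ge0_ler_powR => //; rewrite ?nnegrE ?powR_ge0// ltW.
  rewrite -powRrM mulNr divfK ?gt_eqF// powRN => h.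
  have ep : 0 < e `^ p by rewrite powR_gt0.
  by rewrite -ler_pdivrMl// mulr1.
- exact: omega1_countable_below.
- by move=> a b ab c /= ca; exact: le_trans ab.
- by move=> a; exists a => /=.
- by move=> v vB l l01; exact: (@ellp_geometric_cvg 2).
- move=> x y /B1 x1 /B1 y1.
  by apply: le_trans (ler_normB x y) _; exact: (lerD x1 y1).
- exact: ellp_delta_dense.
- apply: (@separated_nonseparable _ _ ellp_delta 1) => // a b ab.
  rewrite (le_trans _ (ellp_norm_ge _ a))// ellp_subE !ellp_deltaE eqxx (negbTE ab).
  by rewrite subr0 normr1.
Qed.
End Ellp.

(** * L_p of the cube *)

Section LpClasses.
Context d (T : measurableType d) (R : realType).
Variables (mu : probability T R) (p : R) (p1 : 1 <= p).
Local Notation Lf := (LfunType mu (Defs.p1e_subproof p1)).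
Local Notation X := (Lp_space mu p1).
Let p0 : 0 < p. Proof. exact: lt_le_trans p1. Qed.

Lemma measurable_norm_powR (g : T -> R) : measurable_fun setT g ->
  measurable_fun setT (fun x => (`|g x| `^ p)%:E).
Proof.
move=> mg; apply/measurable_EFinP.
apply: (@measurableT_comp _ _ _ _ _ _ (@powR R ^~ p)) => //.
exact: measurableT_comp.
Qed.

Lemma Lnorm_powR (g : T -> R) :
  ('N[mu]_p%:E[EFin \o g] = (\int[mu]_x (`|g x| `^ p)%:E) `^ p^-1)%E.
Proof. by rewrite unlock. Qed.

Lemma Lf_mem (g : T -> R) : measurable_fun setT g ->
  (\int[mu]_x (`|g x| `^ p)%:E < +oo)%E -> g \in Lfun mu p%:E.
Proof.
move=> mg fg; apply/andP; split; rewrite inE //= /finite_norm Lnorm_powR.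
exact: poweR_lty.
Qed.

Definition Lf_of (g : T -> R) (mg : measurable_fun setT g)
    (fg : (\int[mu]_x (`|g x| `^ p)%:E < +oo)%E) : Lf := Lfun_Sub _ (Lf_mem mg fg).

Definition Lp_class (f : Lf) : X := (\pi_X f)%qT.

Lemma Lp_classD f g : Lp_class (f + g) = Lp_class f + Lp_class g.
Proof. exact: raddfD. Qed.

Lemma Lp_classB f g : Lp_class (f - g) = Lp_class f - Lp_class g.
Proof. exact: raddfB. Qed.

Lemma Lp_classZ a f : Lp_class (a *: f) = a *: Lp_class f.
Proof. by rewrite /Lp_class -pi_scale. Qed.

Lemma Lp_class_surj (x : X) : exists f, x = Lp_class f.
Proof. by exists (repr x); rewrite /Lp_class reprK. Qed.

Lemma integral_norm_powR_ge0 (g : T -> R) : (0 <= \int[mu]_x (`|g x| `^ p)%:E)%E.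
Proof. by apply: integral_ge0 => x _; rewrite lee_fin powR_ge0. Qed.

Lemma integral_Lf_fin (f : Lf) : (\int[mu]_x (`|f x| `^ p)%:E < +oo)%E.
Proof.
have := Lfunction_finite _ f; rewrite /finite_norm Lnorm_powR.
rewrite !ltey; apply: contra => /eqP ->; rewrite poweRyr//.
by rewrite gt_eqF// invr_gt0.
Qed.

Lemma Lp_class_norm (f : Lf) : (\int[mu]_x (`|f x| `^ p)%:E)%E = (`|Lp_class f| `^ p)%:E.
Proof.
have -> : `|Lp_class f| = fine ('N[mu]_p%:E[EFin \o f])%E by exact: pi_norm.
rewrite Lnorm_powR -(fineK (x := \int[mu]_x _)%E); last first.
  by rewrite ge0_fin_numE ?integral_norm_powR_ge0// integral_Lf_fin.
rewrite poweR_EFin /= -powRrM mulVf ?gt_eqF// powRr1//.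
exact: fine_ge0 (integral_norm_powR_ge0 _).
Qed.

Lemma Lp_class_norm_le (f : Lf) a : 0 <= a ->
  (\int[mu]_x (`|f x| `^ p)%:E <= (a `^ p)%:E)%E -> `|Lp_class f| <= a.
Proof.
move=> a0; rewrite Lp_class_norm lee_fin => h.
rewrite leNgt; apply/negP => lt; move: h; rewrite leNgt => /negP; apply.
by apply: gt0_ltr_powR => //; rewrite nnegrE.
Qed.

Lemma integral_bounded_le (g : T -> R) (a : R) : measurable_fun setT g ->
  (forall x, `|g x| <= a) -> (\int[mu]_x (`|g x| `^ p)%:E <= (a `^ p)%:E)%E.
Proof.
move=> mg ga.
apply: (@le_trans _ _ (\int[mu]_x (cst (a `^ p)%:E x))%E).
  apply: ge0_le_integral => //.
  - exact: measurable_norm_powR.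
  - move=> x _; rewrite lee_fin; apply: ge0_ler_powR; rewrite ?nnegrE//; first exact: ltW.
    exact: le_trans (ga x).
by rewrite integral_cst//= probability_setT mule1.
Qed.

Lemma integral_bounded_fin (g : T -> R) (a : R) : measurable_fun setT g ->
  (forall x, `|g x| <= a) -> (\int[mu]_x (`|g x| `^ p)%:E < +oo)%E.
Proof. by move=> mg ga; apply: le_lt_trans (integral_bounded_le mg ga) (ltry _). Qed.

Definition Lf_bounded (g : T -> R) (a : R) (mg : measurable_fun setT g)
  (ga : forall x, `|g x| <= a) : Lf := Lf_of mg (integral_bounded_fin mg ga).

Lemma Lf_eq (f g : Lf) : (f : T -> R) =1 g -> f = g.
Proof. by move/LfuneqP. Qed.

End LpClasses.

Import HBSimple HBNNSimple.

(** * Functionals on L_p that vanish on indicators *)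

Section LpFunctional.
Context d (T : measurableType d) (R : realType).
Variables (mu : probability T R) (p : R) (p1 : 1 <= p).
Local Notation Lf := (LfunType mu (Defs.p1e_subproof p1)).
Local Notation X := (Lp_space mu p1).
Let p0 : 0 < p. Proof. exact: lt_le_trans p1. Qed.

Lemma Lf_addE (f g : Lf) x : (f + g) x = f x + g x. Proof. by []. Qed.
Lemma Lf_subE (f g : Lf) x : (f - g) x = f x - g x. Proof. by []. Qed.
Lemma Lf_scaleE a (f : Lf) x : (a *: f) x = a * f x. Proof. by []. Qed.
Lemma Lf_sumE (I : Type) (r : seq I) (P : pred I) (F : I -> Lf) x :
  (\sum_(i <- r | P i) F i) x = \sum_(i <- r | P i) F i x.
Proof. by elim/big_rec2 : _ => [|i u v _ <-]. Qed.

Lemma Lp_class_sumZ (I : Type) (r : seq I) (c : I -> R) (F : I -> Lf) :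
  Lp_class (\sum_(i <- r) c i *: F i) = \sum_(i <- r) c i *: Lp_class (F i).
Proof.
elim: r => [|i r IHr]; first by rewrite !big_nil; exact: raddf0.
by rewrite !big_cons Lp_classD IHr Lp_classZ.
Qed.

Lemma indic_norm_le (A : set T) x : `|\1_A x : R| <= 1.
Proof. by rewrite indicE; case: (_ \in _); rewrite ?normr1 ?normr0. Qed.

Definition Lf_indic (A : set T) (mA : measurable A) : Lf :=
  Lf_bounded mu p1 (measurable_indic mA) (@indic_norm_le A).

Lemma Lf_fin_le (g h : T -> R) : measurable_fun setT g -> measurable_fun setT h ->
  (forall x, `|h x| <= `|g x|) ->
  (\int[mu]_x (`|g x| `^ p)%:E < +oo)%E -> (\int[mu]_x (`|h x| `^ p)%:E < +oo)%E.
Proof.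
move=> mg mh hg; apply: le_lt_trans; apply: ge0_le_integral => //.
- exact: measurable_norm_powR.
- exact: measurable_norm_powR.
- move=> x _; rewrite lee_fin; apply: ge0_ler_powR; rewrite ?nnegrE//.
  exact: ltW.
Qed.

Variable f : {linear X -> R^o}.
Hypothesis cf : continuous f.
Hypothesis f_indic : forall A (mA : measurable A), f (Lp_class (Lf_indic mA)) = 0.

Lemma functional_nnsfun (h : {nnsfun T >-> R}) (g : Lf) : (g : T -> R) =1 h ->
  f (Lp_class g) = 0.
Proof.
move=> gh; have mh y : measurable (h @^-1` [set y]) by exact: measurable_sfunP.
have -> : g = \sum_(y <- fset_set (range h)) y *: Lf_indic (mh y).
  apply: Lf_eq => x; rewrite gh fimfunE fsbig_finite//= Lf_sumE.
  by apply: eq_bigr => y _; rewrite Lf_scaleE.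
rewrite Lp_class_sumZ linear_sum big1// => y _.
by rewrite linearZ /= f_indic scaler0.
Qed.

Lemma functional_approx (g : Lf) : (forall e, 0 < e ->
    exists2 h : Lf, f (Lp_class h) = 0 &
      (\int[mu]_x (`|g x - h x| `^ p)%:E <= (e `^ p)%:E)%E) ->
  f (Lp_class g) = 0.
Proof.
move=> app; have [N N0 fN] := linear_continuous_bound cf.
apply/normr0_eq0/eqP; rewrite eq_le normr_ge0 andbT.
apply/ler_addgt0Pr => e e0; rewrite add0r.
have [h fh gh] := app (e / N) (divr_gt0 e0 N0).
rewrite -[f _]subr0 -fh -linearB -Lp_classB (le_trans (fN _))//.
rewrite mulrC -ler_pdivlMr//; apply: Lp_class_norm_le => //.
by rewrite divr_ge0// ltW.
Qed.

(** Simple functions increase to g, and the p-th powers of the differences are dominated by the p-th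
    power of g. *)
Lemma functional_nonneg (g : Lf) : (forall x, 0 <= g x) -> f (Lp_class g) = 0.
Proof.
move=> g0; have mg : measurable_fun setT (g : T -> R) by [].
have mEg : measurable_fun setT (EFin \o g) by exact/measurable_EFinP.
pose h n : {nnsfun T >-> R} := nnsfun_approx measurableT mEg n.
have h_cvg x : h n x @[n --> \oo] --> g x.
  have := @cvg_nnsfun_approx _ _ _ _ measurableT _ mEg (fun x _ => g0 x) x Logic.I.
  by move=> /fine_cvg.
have h_le n x : h n x <= g x.
  have := @le_approx _ _ _ setT (EFin \o g) n x (fun x _ => g0 x) Logic.I.
  by rewrite /= lee_fin /h nnsfun_approxE.
have h_ge0 n x : 0 <= h n x by [].
have mh n : measurable_fun setT (h n) by [].
have hg n x : `|h n x| <= `|g x| by rewrite !ger0_norm.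
pose H n : Lf := Lf_of p1 (mh n) (Lf_fin_le mg (mh n) (hg n) (integral_Lf_fin g)).
have gh_le n x : `|g x - h n x| <= `|g x|.
  by rewrite !ger0_norm ?subr_ge0// lerBlDr lerDl.
have mgh n : measurable_fun setT (fun x => g x - h n x) by exact: measurable_funB.
pose k n x := (`|g x - h n x| `^ p)%:E.
have kcvg x : k n x @[n --> \oo] --> 0%E.
  apply/fine_cvgP; split; first exact: nearW.
  apply/cvgr0Pnorm_le => e e0.
  (* Below 1 a p-th power is at most its base, so closeness within the minimum of e and 1 is
     enough. *)
  have m0 : 0 < Num.min e 1 by rewrite lt_min e0 ltr01.
  have /cvgrPdist_lt/(_ _ m0) := h_cvg x; apply: filterS => n.
  rewrite lt_min => /andP[ghe gh1] /=.
  rewrite ger0_norm ?powR_ge0//; have [->|gh0] := eqVneq (g x - h n x) 0.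
    by rewrite normr0 powR0 ?gt_eqF// ltW.
  rewrite (le_trans _ (ltW ghe))// ge1r_powR//.
  by rewrite normr_gt0 gh0 ltW.
have [_ _ kint] : [/\ mu.-integrable setT (cst 0%E : T -> \bar R),
    (\int[mu]_x `|k n x - cst 0%E x|)%E @[n --> \oo] --> 0%E &
    (\int[mu]_x k n x)%E @[n --> \oo] --> (\int[mu]_x (cst 0%E x))%E].
  apply: (@dominated_convergence _ _ _ mu setT measurableT k (cst 0%E)
    (fun x => (`|g x| `^ p)%:E)) => //.
  - by move=> n; exact: measurable_norm_powR.
  - by apply: aeW => x _; exact: kcvg.
  - apply/integrableP; split; first exact: measurable_norm_powR.
    under eq_integral do rewrite gee0_abs ?lee_fin ?powR_ge0//.
    exact: integral_Lf_fin.
  - apply: aeW => x n _; rewrite gee0_abs ?lee_fin ?powR_ge0//.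
    by apply: ge0_ler_powR; rewrite ?nnegrE// ltW.
rewrite integral0 in kint.
apply: functional_approx => e e0.
have ep : (0 < (e `^ p)%:E)%E by rewrite lte_fin powR_gt0.
have [n _ /(_ n (leqnn n)) kn] : \forall n \near \oo, (\int[mu]_x k n x < (e `^ p)%:E)%E.
  have /kint := @open_ereal_lt' R 0%E (e `^ p)%:E ep; exact.
exists (H n); last exact: ltW kn.
exact: (@functional_nnsfun (h n)).
Qed.

Lemma functional_eq0 x : f x = 0.
Proof.
have [g ->] := Lp_class_surj x => {x}.
have mg : measurable_fun setT (g : T -> R) by [].
pose gp x := Num.max (g x) 0; pose gn x := Num.max (- g x) 0.
have mgp : measurable_fun setT gp by apply: measurable_maxr.
have mgn : measurable_fun setT gn by apply: measurable_maxr => //; exact: measurable_funN.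
have gpg x : `|gp x| <= `|g x|.
  by rewrite /gp; have [h|h] := leP (g x) 0; rewrite ?normr0.
have gng x : `|gn x| <= `|g x|.
  by rewrite /gn; have [h|h] := leP (- g x) 0; rewrite ?normr0// normrN.
pose Gp : Lf := Lf_of p1 mgp (Lf_fin_le mg mgp gpg (integral_Lf_fin g)).
pose Gn : Lf := Lf_of p1 mgn (Lf_fin_le mg mgn gng (integral_Lf_fin g)).
have -> : g = Gp - Gn.
  apply: Lf_eq => x; rewrite Lf_subE /= /gp /gn.
  have [h|h] := leP (g x) 0; have [h'|h'] := leP (- g x) 0; lra.
rewrite Lp_classB linearB !functional_nonneg ?subr0// => x.
- by rewrite /= /gn le_max lexx orbT.
- by rewrite /= /gp le_max lexx orbT.
Qed.
End LpFunctional.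

Section BoundedMeasurable.
Context d (T : measurableType d) (R : realType) (mu : probability T R).
Local Open Scope ring_scope.

Definition bounded_measurable (g : T -> R) : Prop :=
  measurable_fun setT g /\ exists a, forall x, `|g x| <= a.

Lemma bounded_measurable_integrable g (A : set T) : measurable A ->
  bounded_measurable g -> mu.-integrable A (EFin \o g).
Proof.
move=> mA [mg [a ga]]; apply: measurable_bounded_integrable => //.
- by rewrite (le_lt_trans (probability_le1 _ _))// ltry.
- exact: measurable_funTS.
- exists a; split; first exact: num_real.
  by move=> b ab x _; rewrite /= (le_trans (ga x))// ltW.
Qed.

Lemma bounded_measurable_cst a : bounded_measurable (fun=> a).
Proof. by split; [exact: measurable_cst|exists `|a|]. Qed.

Lemma bounded_measurableD g h : bounded_measurable g -> bounded_measurable h ->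
  bounded_measurable (fun x => g x + h x).
Proof.
move=> [mg [a ga]] [mh [b hb]]; split; first exact: measurable_funD.
by exists (a + b) => x; rewrite (le_trans (ler_normD _ _))// lerD.
Qed.

Lemma bounded_measurableM g h : bounded_measurable g -> bounded_measurable h ->
  bounded_measurable (fun x => g x * h x).
Proof.
move=> [mg [a ga]] [mh [b hb]]; split; first exact: measurable_funM.
by exists (a * b) => x; rewrite normrM ler_pM.
Qed.

Lemma bounded_measurableZ a g : bounded_measurable g ->
  bounded_measurable (fun x => a * g x).
Proof. by move=> bg; apply: bounded_measurableM => //; exact: bounded_measurable_cst. Qed.

Lemma bounded_measurable_sum (I : Type) (s : seq I) (g : I -> T -> R) :
  (forall i, bounded_measurable (g i)) ->
  bounded_measurable (fun x => \sum_(i <- s) g i x).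
Proof.
move=> bg; elim: s => [|i s IHs].
  under eq_fun do rewrite big_nil; exact: bounded_measurable_cst.
under eq_fun do rewrite big_cons; exact: bounded_measurableD.
Qed.

Lemma bounded_measurable_prod (I : Type) (s : seq I) (g : I -> T -> R) :
  (forall i, bounded_measurable (g i)) ->
  bounded_measurable (fun x => \prod_(i <- s) g i x).
Proof.
move=> bg; elim: s => [|i s IHs].
  under eq_fun do rewrite big_nil; exact: bounded_measurable_cst.
under eq_fun do rewrite big_cons; exact: bounded_measurableM.
Qed.

(* Bessel: an orthonormal sum has second moment the sum of the squares. *)
Lemma second_moment_sum (I : eqType) (s : seq I) (c : I -> R) (w : I -> T -> R) :
  (forall i, bounded_measurable (w i)) -> uniq s ->
  (forall i j, \int[mu]_x (w i x * w j x) = (i == j)%:R) ->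
  \int[mu]_x (\sum_(i <- s) c i * w i x) ^+ 2 = \sum_(i <- s) c i ^+ 2.
Proof.
move=> bw us orth.
have bS r : bounded_measurable (fun x => \sum_(i <- r) c i * w i x).
  by apply: bounded_measurable_sum => i; exact: bounded_measurableZ.
have int g : bounded_measurable g -> mu.-integrable setT (EFin \o g).
  exact: bounded_measurable_integrable.
have cross r j : j \notin r -> \int[mu]_x ((\sum_(i <- r) c i * w i x) * w j x) = 0.
  elim: r => [|i r IHr].
    by under eq_Rintegral do rewrite big_nil mul0r; rewrite Rintegral_cst// mul0r.
  rewrite inE negb_or => /andP[ji jr].
  under eq_Rintegral do rewrite big_cons mulrDl -mulrA.
  rewrite RintegralD//; last 2 first.
  - by apply: int; apply: bounded_measurableZ; exact: bounded_measurableM.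
  - by apply: int; exact: bounded_measurableM.
  rewrite RintegralZl//; last by apply: int; exact: bounded_measurableM.
  by rewrite orth eq_sym (negbTE ji) mulr0 add0r IHr.
elim: s us => [_|i s IHs /= /andP[nis us]].
  under eq_Rintegral do rewrite big_nil expr0n.
  by rewrite Rintegral_cst// mul0r big_nil.
have -> : \int[mu]_x (\sum_(j <- i :: s) c j * w j x) ^+ 2 =
    \int[mu]_x ((c i ^+ 2 * (w i x * w i x) +
       (2 * c i) * ((\sum_(j <- s) c j * w j x) * w i x)) +
       (\sum_(j <- s) c j * w j x) ^+ 2).
  by apply: eq_Rintegral => x _; rewrite big_cons; ring.
have b1 : bounded_measurable (fun x => w i x * w i x) by exact: bounded_measurableM.
have b2 : bounded_measurable (fun x => (\sum_(j <- s) c j * w j x) * w i x).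
  exact: bounded_measurableM.
have b3 : bounded_measurable (fun x => (\sum_(j <- s) c j * w j x) ^+ 2).
  by under eq_fun do rewrite expr2; exact: bounded_measurableM.
rewrite RintegralD//; last 2 first.
- by apply: int; apply: bounded_measurableD; exact: bounded_measurableZ.
- exact: int.
rewrite RintegralD//; last 2 first.
- by apply: int; exact: bounded_measurableZ.
- by apply: int; exact: bounded_measurableZ.
rewrite !RintegralZl//; [|exact: int|exact: int].
by rewrite orth eqxx mulr1 cross// mulr0 addr0 IHs// big_cons.
Qed.
End BoundedMeasurable.

(** * Rademacher and Walsh functions on the cube *)

Section Walsh.
Variables (R : realType) (mu : probability (cube omega1) R).
Hypothesis hmu : homogeneous_measure mu.
Local Notation T := (cube omega1).

Definition coord (x : T) (i : omega1) : bool := (x : omega1 -> bool) i.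

Lemma measurable_coord i : measurable [set x : T | coord x i].
Proof. by apply: sub_gen_smallest; exists i. Qed.

Definition rademacher (i : omega1) (x : T) : R := if coord x i then 1 else -1.

Lemma rademacher_norm i x : `|rademacher i x| = 1.
Proof. by rewrite /rademacher; case: ifP; rewrite ?normrN normr1. Qed.

Lemma rademacher_sqr i x : rademacher i x * rademacher i x = 1.
Proof. by rewrite /rademacher; case: ifP; rewrite ?mulrNN mulr1. Qed.

Lemma measurable_rademacher i : measurable_fun setT (rademacher i).
Proof.
rewrite (_ : rademacher i = fun x => 2 * \1_[set x | coord x i] x - 1).
  apply: measurable_funB => //; apply: measurable_funM => //.
  exact: measurable_indic (measurable_coord i).
apply/funext => x; rewrite /rademacher indicE.
have -> : (x \in [set x | coord x i]) = coord x i by apply/idP/idP => [/set_mem|/mem_set].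
by case: (coord x i) => /=; ring.
Qed.

Definition walsh (s : seq omega1) (x : T) : R := \prod_(i <- s) rademacher i x.

Lemma walsh_norm s x : `|walsh s x| = 1.
Proof. by rewrite /walsh normr_prod big1// => i _; rewrite rademacher_norm. Qed.

Lemma bounded_measurable_walsh s : bounded_measurable (walsh s).
Proof.
apply: bounded_measurable_prod => i; split; first exact: measurable_rademacher.
by exists 1 => x; rewrite rademacher_norm.
Qed.

Definition cyl (F : seq omega1) (b : omega1 -> bool) : set T :=
  [set x | forall i, i \in F -> coord x i = b i].

Lemma cyl_cons i F b : i \notin F ->
  cyl F b = cyl (i :: F) (fun j => if j == i then true else b j) `|`
            cyl (i :: F) (fun j => if j == i then false else b j).
Proof.
move=> iF; have ne j : j \in F -> (j == i) = false.
  by move=> jF; apply/eqP => ji; rewrite ji in jF; rewrite jF in iF.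
apply/seteqP; split=> [x Fx|x [] h j jF].
- case xi : (coord x i); [left|right] => j; rewrite inE => /orP[/eqP ->|jF].
  + by rewrite eqxx.
  + by rewrite ne// Fx.
  + by rewrite eqxx.
  + by rewrite ne// Fx.
- by rewrite h ?inE ?jF ?orbT// ne.
- by rewrite h ?inE ?jF ?orbT// ne.
Qed.

Lemma measurable_cyl F b : measurable (cyl F b).
Proof.
elim: F => [|i F IHF].
  by rewrite (_ : cyl _ _ = setT)//; apply/seteqP; split.
rewrite (_ : cyl _ _ = (if b i then [set x | coord x i] else ~` [set x | coord x i]) `&` cyl F b).
  apply: measurableI => //; case: (b i); [|apply: measurableC]; exact: measurable_coord.
apply/seteqP; split=> [x h|x [xi Fx] j].
  split; last by move=> j jF; apply: h; rewrite inE jF orbT.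
  have := h i; rewrite inE eqxx => /(_ isT); case: (b i) => [//|xi].
  by rewrite /= xi.
rewrite inE => /orP[/eqP ->|]; last exact: Fx.
by move: xi; case: (b i) => //= /negP/negbTE.
Qed.

Lemma cyl_measure F b : uniq F -> mu (cyl F b) = ((2^-1) ^+ size F)%:E.
Proof.
move=> uF; have := hmu [fset i | i in F]%fset b.
rewrite card_fseq undup_id// => <-; congr (mu _).
by apply/seteqP; split=> x h i; have := h i; rewrite !inE.
Qed.

(** A cylinder is halved along the next coordinate i of H; the Rademacher function of i is 1 on one
    half and -1 on the other, while the remaining product has the same integral on both. Letting the
    cylinder vary is what carries the induction. *)
Lemma walsh_integral_cyl H F b : uniq (H ++ F) ->
  \int[mu]_(x in cyl F b) walsh H x = if H is [::] then (2^-1) ^+ size F else 0.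
Proof.
elim: H F b => [|i H IHH] F b /=.
  move=> uF; under eq_Rintegral do rewrite /walsh big_nil.
  rewrite Rintegral_cst ?mul1r; last exact: measurable_cyl.
  exact (congr1 fine (cyl_measure b uF)).
rewrite mem_cat negb_or => /andP[/andP[iH iF] uHF].
have uHiF : uniq (H ++ i :: F).
  by rewrite -cat1s uniq_catCA /= mem_cat negb_or iH iF.
have int A s : measurable A -> mu.-integrable A (EFin \o walsh s).
  move=> mA; apply: bounded_measurable_integrable => //; exact: bounded_measurable_walsh.
rewrite (cyl_cons b iF) Rintegral_setU; last 4 first.
- exact: measurable_cyl.
- exact: measurable_cyl.
- by apply: int; apply: measurableU; exact: measurable_cyl.
- apply/disj_setPS => x [h1 h0].
  have := h1 i; rewrite inE eqxx => /(_ isT) e1.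
  by have := h0 i; rewrite inE eqxx => /(_ isT); rewrite e1.
rewrite (@eq_Rintegral _ _ _ _ _ (walsh H)); last first.
  move=> x /set_mem/(_ i); rewrite inE eqxx => /(_ isT) xi.
  by rewrite /walsh big_cons /rademacher xi mul1r.
rewrite [X in _ + X](@eq_Rintegral _ _ _ _ _ (fun x => -1 * walsh H x)); last first.
  move=> x /set_mem/(_ i); rewrite inE eqxx => /(_ isT) xi.
  by rewrite /walsh big_cons /rademacher xi.
rewrite RintegralZl; [|exact: measurable_cyl|by apply: int; exact: measurable_cyl].
by rewrite !IHH// mulN1r subrr.
Qed.

Lemma walsh_integral s : uniq s -> \int[mu]_x walsh s x = (s == [::])%:R.
Proof.
move=> us; have := @walsh_integral_cyl s [::] (fun=> true).
rewrite (_ : cyl [::] _ = setT); last by apply/seteqP; split.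
by rewrite cats0 => ->//; case: s {us}.
Qed.

(** Common coordinates cancel, so only the symmetric difference is left. *)
Lemma walsh_mul F G x : uniq F -> uniq G -> walsh F x * walsh G x =
  walsh ([seq i <- F | i \notin G] ++ [seq i <- G | i \notin F]) x.
Proof.
move=> uF uG; rewrite /walsh big_cat /= !big_filter.
rewrite (bigID (mem G)) /= [X in _ * X](bigID (mem F)) /= mulrACA.
have -> : \prod_(i <- F | i \in G) rademacher i x = \prod_(i <- G | i \in F) rademacher i x.
  rewrite -[LHS]big_filter -[RHS]big_filter; apply: perm_big; apply: uniq_perm; rewrite ?filter_uniq//.
  by move=> i; rewrite !mem_filter andbC.
by rewrite -big_split /= big1 ?mul1r// => i _; rewrite rademacher_sqr.
Qed.

Lemma walsh_orthonormal (F G : {fset omega1}) :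
  \int[mu]_x (walsh (enum_fset F) x * walsh (enum_fset G) x) = (F == G)%:R.
Proof.
under eq_Rintegral do rewrite walsh_mul ?fset_uniq//.
rewrite walsh_integral; last first.
  rewrite cat_uniq !filter_uniq ?fset_uniq//= andbT; apply/hasPn => i.
  by rewrite !mem_filter => /andP[/negbTE -> _]; rewrite andbF.
congr (_ %:R); congr (nat_of_bool _); apply/eqP/eqP => [|->]; last first.
  by rewrite (@eq_in_filter _ _ pred0) ?filter_pred0// => i /= ->.
move=> /(congr1 size); rewrite size_cat => /eqP; rewrite addn_eq0 !size_eq0.
have sub (A B : {fset omega1}) : [seq i <- A | i \notin B] == [::] -> {subset A <= B}.
  move=> /eqP AB i iA; apply: contraT => iB.
  have : i \in [seq i <- A | i \notin B] by rewrite mem_filter iB.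
  by rewrite AB.
by move=> /andP[/sub FG /sub GF]; apply/fsetP => i; apply/idP/idP => [/FG|/GF].
Qed.
End Walsh.

Lemma countable_finite_subsets (A : omega1 -> bool) : countable [set a | A a] ->
  countable [set F : {fset omega1} | forall i, i \in F -> A i].
Proof.
move=> /countable_range_or_empty[A0|[e eA]].
  apply: sub_countable (countable1 (fset0 : {fset omega1})).
  apply: subset_card_le => F FA; apply/fsetP => i; rewrite inE; apply/negP => /FA Ai.
  by have : [set a | A a] i by []; rewrite A0.
pose g (s : seq nat) : {fset omega1} := [fset i | i in map e s]%fset.
apply: sub_countable (sub_countable (card_image_le g setT) (countableP _)).
apply: subset_card_le => F FA.
have ex i : exists n, i \in F -> e n = i.
  have [iF|] := boolP (i \in F); last by exists 0%N.
  have : [set a | A a] i by exact: FA.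
  by rewrite eA => -[n _ en]; exists n.
have [n nP] := choice ex.
exists [seq n i | i <- enum_fset F] => //.
apply/fsetP => i; rewrite /g inE -map_comp.
apply/mapP/idP => [[j jF ->]|iF]; first by rewrite /= nP.
by exists i; rewrite //= nP.
Qed.

Section LpCube.
Variables (R : realType) (mu : probability (cube omega1) R).
Hypothesis hmu : homogeneous_measure mu.
Variables (p : R) (p1 : 1 <= p).
Local Notation T := (cube omega1).
Local Notation Lf := (LfunType mu (Defs.p1e_subproof p1)).
Local Notation X := (Lp_space mu p1).
Let p0 : 0 < p. Proof. exact: lt_le_trans p1. Qed.

Lemma Lf_exists (g : T -> R) : bounded_measurable g -> exists G : Lf, (G : T -> R) =1 g.
Proof. by move=> [mg [a ga]]; exists (Lf_bounded mu p1 mg ga). Qed.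

Definition walsh_Lf (F : {fset omega1}) : Lf :=
  Lf_bounded mu p1 (bounded_measurable_walsh R (enum_fset F)).1
    (fun x => eq_ind_r (fun y => y <= 1) (lexx 1) (walsh_norm R (enum_fset F) x)).

Lemma walsh_LfE F x : walsh_Lf F x = walsh R (enum_fset F) x. Proof. by []. Qed.

Definition walsh_class (F : {fset omega1}) : X := Lp_class (walsh_Lf F).

(** Repeated indices cancel in pairs, since a Rademacher function squares to 1. *)
Lemma walsh_fset (s : seq omega1) : exists F : {fset omega1},
  forall x, walsh R s x = walsh R (enum_fset F) x.
Proof.
elim: s => [|i s [F FE]].
  have e0 : enum_fset (fset0 : {fset omega1}) = [::] by apply/size0nil/cardfs0.
  by exists fset0 => x; rewrite e0.
have [iF|iF] := boolP (i \in F).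
  exists (F `\ i)%fset => x; rewrite {1}/walsh big_cons -/(walsh R s x) FE.
  by rewrite /walsh (big_fsetD1 i)//= mulrA rademacher_sqr mul1r.
exists (i |` F)%fset => x; rewrite {1}/walsh big_cons -/(walsh R s x) FE.
by rewrite /walsh big_fsetU1.
Qed.

Section Vanishing.
Variable f : {linear X -> R^o}.
Hypothesis cf : continuous f.
Hypothesis f_walsh : forall F, f (walsh_class F) = 0.

Let null (g : T -> R) := forall G : Lf, (G : T -> R) =1 g -> f (Lp_class G) = 0.

Lemma null_walsh s : null (walsh R s).
Proof.
move=> G Gs; have [F FE] := walsh_fset s; rewrite -(f_walsh F); congr (f (Lp_class _)).
by apply: Lf_eq => x; rewrite Gs FE.
Qed.

Lemma null_comb a b g h k : bounded_measurable g -> bounded_measurable h ->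
  null g -> null h -> (forall x, k x = a * g x + b * h x) -> null k.
Proof.
move=> /Lf_exists[G Gg] /Lf_exists[H Hh] ng nh kE K Kk.
have -> : K = a *: G + b *: H.
  by apply: Lf_eq => x; rewrite Kk kE Lf_addE !Lf_scaleE Gg Hh.
rewrite Lp_classD !Lp_classZ linearD !linearZ /= (ng _ Gg) (nh _ Hh).
by rewrite !scaler0 addr0.
Qed.

Definition half_sum (F : seq omega1) (x : T) : R :=
  \prod_(i <- F) ((1 + rademacher R i x) / 2).

Lemma bounded_measurable_half_sum F : bounded_measurable (half_sum F).
Proof.
apply: bounded_measurable_prod => i.
apply: bounded_measurableM; last exact: bounded_measurable_cst.
apply: bounded_measurableD; first exact: bounded_measurable_cst.
split; first exact: measurable_rademacher.
by exists 1 => x; rewrite rademacher_norm.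
Qed.

(** Each factor (1 + r_i) / 2 splits the product into two with one factor less, one of them with i
    added to the Walsh part; the free list s absorbs that index. *)
Lemma null_half_sum F s : null (fun x => half_sum F x * walsh R s x).
Proof.
have bm F' s' : bounded_measurable (fun x => half_sum F' x * walsh R s' x).
  apply: bounded_measurableM; first exact: bounded_measurable_half_sum.
  exact: bounded_measurable_walsh.
elim: F s => [|i F IHF] s.
  by move=> G Gs; apply: (null_walsh (s := s)) => x; rewrite Gs /half_sum big_nil mul1r.
apply: (null_comb (a := 2^-1) (b := 2^-1) (bm F s) (bm F (i :: s)) (IHF s) (IHF (i :: s))) => x.
by rewrite /half_sum /walsh !big_cons; field.
Qed.

Lemma half_sumE F x : half_sum F x = (\1_[set y : T | all (coord y) F] x : R).
Proof.
rewrite indicE (_ : (x \in _) = all (coord x) F); last first.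
  by apply/idP/idP => [/set_mem|/mem_set].
elim: F => [|i F IHF]; first by rewrite /half_sum big_nil.
rewrite /half_sum big_cons -/(half_sum F x) IHF /= /rademacher.
by case: (coord x i) => /=; field.
Qed.

(** Dynkin's theorem for the sets on which finitely many given coordinates are true: their
    indicators are half sums, hence combinations of Walsh functions, and the property passes to
    complements and to countable disjoint unions. *)
Lemma null_indic A : measurable A -> null (\1_A : T -> R).
Proof.
pose G : set (set T) := [set [set y : T | all (coord y) F] | F in [set: seq omega1]].
have mT : @measurable _ T = <<s G >>.
  apply/seteqP; split; apply: smallest_sub.
  - exact: smallest_sigma_algebra.
  - move=> _ [i _ <-]; apply: sub_gen_smallest; exists [:: i] => //.
    by apply/seteqP; split=> x /=; rewrite andbT.
  - exact: sigma_algebra_measurable.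
  - move=> _ [F _ <-]; rewrite (_ : [set y | _] = cyl F (fun=> true)).
      exact: measurable_cyl.
    by apply/seteqP; split=> x /=; [move=> /allP|move=> h; apply/allP].
rewrite mT; move: A; apply: (dynkin_induction mT).
- move=> _ _ [F _ <-] [F' _ <-]; exists (F ++ F') => //.
  by apply/seteqP; split=> x /=; rewrite all_cat => /andP.
- move=> g gT; apply: (null_walsh (s := [::])) => x.
  by rewrite gT /walsh big_nil indicT.
- move=> _ [F _ <-] g gF; apply: (null_half_sum (F := F) (s := [::])) => x.
  by rewrite gF half_sumE /walsh big_nil mulr1.
- move=> A mA nA; apply: (null_comb (a := 1) (b := -1) (g := walsh R [::]) (h := \1_A)).
  + exact: bounded_measurable_walsh.
  + split; first exact: measurable_indic.
    by exists 1; exact: indic_norm_le.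
  + exact: null_walsh.
  + exact: nA.
  + move=> x; rewrite /walsh big_nil !indicE in_setC.
    by case: (_ \in _); rewrite /=; ring.
move=> F mF tF nF g gF.
pose U n := \big[setU/set0]_(k < n) F k.
have mU n : measurable (U n) by apply: bigsetU_measurable => k _; exact: mF.
have nU n : null (\1_(U n) : T -> R).
  elim: n => [|n IHn].
    apply: (null_comb (a := 0) (b := 0) (g := walsh R [::]) (h := walsh R [::])).
    + exact: bounded_measurable_walsh.
    + exact: bounded_measurable_walsh.
    + exact: null_walsh.
    + exact: null_walsh.
    + by move=> x; rewrite /U big_ord0 indic0 !mul0r addr0.
  apply: (null_comb (a := 1) (b := 1) (g := \1_(U n)) (h := \1_(F n))) => //.
  + split; first exact: measurable_indic.
    by exists 1; exact: indic_norm_le.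
  + split; first exact: measurable_indic.
    by exists 1; exact: indic_norm_le.
  + move=> x; rewrite !mul1r /U big_ord_recr /= -/(U n) !indicE in_setU.
    have [xF|xF] := boolP (x \in F n); last by rewrite orbF addr0.
    suff -> : (x \in U n) = false by rewrite add0r.
    apply/negP => /set_mem; rewrite /U -bigcup_mkord => -[k /= kn Fk].
    have := tF k n Logic.I Logic.I (ex_intro _ x (conj Fk (set_mem xF))).
    by move=> kE; rewrite kE ltnn in kn.
(* The indicators of the partial unions converge in L_p because the remainders have measure tending
   to 0. *)
pose D n := (\bigcup_k F k) `\` U n.
have mbig : measurable (\bigcup_k F k) by apply: bigcup_measurable => k _; exact: mF.
have mD n : measurable (D n) by exact: measurableD.
have Dcvg : mu (D n) @[n --> \oo] --> 0%E.
  rewrite -(measure0 mu) (_ : set0 = \bigcap_n D n).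
    apply: nonincreasing_cvg_mu => //.
    - by rewrite (le_lt_trans (probability_le1 _ _))// ltry.
    - exact: bigcapT_measurable.
    - move=> m n mn; apply/subsetPset => x [xF nx]; split=> //; apply: contra_not nx.
      rewrite /U -!bigcup_mkord => -[k /= km Fk]; exists k => //=.
      exact: leq_trans mn.
  apply/seteqP; split=> // x Dx; have [[k _ Fk] _] := Dx 0%N Logic.I.
  have [_ ] := Dx k.+1 Logic.I; apply; rewrite /U -bigcup_mkord; exists k => //=.
apply: (functional_approx cf) => e e0.
have ep : (0 < (e `^ p)%:E)%E by rewrite lte_fin powR_gt0.
have [n _ /(_ n (leqnn n)) Dn] : \forall n \near \oo, (mu (D n) < (e `^ p)%:E)%E.
  by have /Dcvg := @open_ereal_lt' R 0%E (e `^ p)%:E ep; exact.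
exists (Lf_indic mu p1 (mU n)); first exact: nU.
have UF x : x \in U n -> x \in \bigcup_k F k.
  by move=> /set_mem; rewrite /U -bigcup_mkord => -[k _ Fk]; apply/mem_set; exists k.
rewrite (@eq_integral _ _ _ mu setT (fun x => (\1_(D n) x)%:E)); last first.
  move=> x _; rewrite gF /= !indicE in_setD; congr (_%:E).
  have [xU|xU] := boolP (x \in U n).
    by rewrite UF// subrr normr0 powR0// gt_eqF.
  rewrite subr0 andbT; case: (_ \in _); rewrite ?normr1 ?normr0 ?powR1//.
  by rewrite powR0// gt_eqF.
by rewrite integral_indic// setIT; exact: ltW Dn.
Qed.

Lemma functional_walsh_eq0 x : f x = 0.
Proof.
apply: functional_eq0 => // A mA; exact: (null_indic mA).
Qed.
End Vanishing.

Lemma walsh_dense : linearly_dense (range walsh_class).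
Proof.
apply: hahn_banach_dense => f cf f_walsh; apply: functional_walsh_eq0 => // F.
by apply: f_walsh; exists F.
Qed.

Lemma integral_bounded_measurable (g : T -> R) : bounded_measurable g ->
  (\int[mu]_x (g x)%:E)%E = (\int[mu]_x g x)%:E.
Proof.
move=> bg; rewrite /Rintegral fineK//.
exact: integrable_fin_num (bounded_measurable_integrable mu measurableT bg).
Qed.

(** One estimate serves all p >= 1. The sum u satisfies |u| <= m and, by orthonormality, has second
    moment at most m. With t = |u| / m in [0, 1] and q = e^p, one has t^p <= t <= (q + t^2 / q) / 2;
    the integral of |u|^p is thus at most m^p (q / 2 + 1 / (2 m q)), which is at most (e m)^p once m
    q^2 >= 1. *)
Lemma walsh_small_sums (e : R) : 0 < e -> exists2 m, (0 < m)%N &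
  forall (s : seq {fset omega1}) (c : {fset omega1} -> R),
    uniq s -> size s = m -> (forall F, `|c F| <= 1) ->
    `|\sum_(F <- s) c F *: walsh_class F| <= e * m%:R.
Proof.
move=> e0; pose q := e `^ p; have q0 : 0 < q by rewrite powR_gt0.
pose m := (Num.truncn (q ^- 2)).+1; exists m => // s c us ss c1.
have m0 : 0 < m%:R :> R by rewrite ltr0n.
have mq : 1 <= m%:R * q ^+ 2.
  by rewrite -ler_pdivrMr ?exprn_gt0// div1r ltW// truncnS_gt.
pose u x := \sum_(F <- s) c F * walsh R (enum_fset F) x.
have bw F : bounded_measurable (walsh R (enum_fset F)) by exact: bounded_measurable_walsh.
have bu : bounded_measurable u.
  by apply: bounded_measurable_sum => F; exact: bounded_measurableZ.
have um x : `|u x| <= m%:R.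
  rewrite (le_trans (ler_norm_sum _ _ _))// -ss -[leRHS]addr0 -iter_addr.
  rewrite -[size s]count_predT -big_const_seq; apply: ler_sum => F _.
  by rewrite normrM walsh_norm mulr1.
have u2 : \int[mu]_x (u x) ^+ 2 <= m%:R.
  rewrite (second_moment_sum c bw us); last by move=> F G; exact: walsh_orthonormal.
  rewrite -ss -[leRHS]addr0 -iter_addr -[size s]count_predT -big_const_seq.
  by apply: ler_sum => F _; rewrite -real_normK ?num_real// exprn_ile1.
rewrite -Lp_class_sumZ; apply: Lp_class_norm_le; first by rewrite mulr_ge0// ltW.
pose M := m%:R `^ p; have M0 : 0 < M by rewrite powR_gt0.
pose b x := M * (q / 2) + M / (2 * m%:R ^+ 2 * q) * u x ^+ 2.
have bb2 : bounded_measurable (fun x => u x ^+ 2).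
  rewrite (_ : (fun x => u x ^+ 2) = fun x => u x * u x); first exact: bounded_measurableM.
  by apply/funext => x; rewrite expr2.
have bbZ : bounded_measurable (fun x => M / (2 * m%:R ^+ 2 * q) * u x ^+ 2).
  exact: bounded_measurableZ.
have bb : bounded_measurable b.
  by apply: bounded_measurableD => //; exact: bounded_measurable_cst.
apply: (@le_trans _ _ (\int[mu]_x (b x)%:E)%E).
  apply: ge0_le_integral => //.
  - apply: measurable_norm_powR => //.
  - by apply/measurable_EFinP; exact: bb.1.
  - move=> x _; rewrite lee_fin Lf_sumE.
    have -> : \sum_(F <- s) (c F *: walsh_Lf F) x = u x.
      by apply: eq_bigr => F _; rewrite Lf_scaleE.
    have -> : `|u x| = m%:R * (`|u x| / m%:R) by rewrite mulrC divfK ?gt_eqF.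
    set t := `|u x| / m%:R.
    have t0 : 0 <= t by rewrite divr_ge0// ltW.
    have t1 : t <= 1 by rewrite ler_pdivrMr// mul1r.
    have tp : t `^ p <= t.
      have [->|tn0] := eqVneq t 0; first by rewrite powR0// gt_eqF.
      by rewrite ge1r_powR// lt_neqAle eq_sym tn0 t0.
    have -> : b x = M * ((q + t ^+ 2 / q) / 2).
      by rewrite /b /t exprMn exprVn real_normK ?num_real//; field; rewrite !gt_eqF.
    rewrite (powRM _ (ltW m0) t0) -/M ler_pM2l// (le_trans tp)//.
    rewrite ler_pdivlMr// -subr_ge0.
    have -> : q + t ^+ 2 / q - t * 2 = (q - t) ^+ 2 / q by field; rewrite gt_eqF.
    by rewrite divr_ge0 ?sqr_ge0// ltW.
rewrite integral_bounded_measurable// lee_fin /b RintegralD//; last 2 first.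
- exact: bounded_measurable_integrable measurableT (bounded_measurable_cst T (M * (q / 2))).
- exact: bounded_measurable_integrable.
rewrite Rintegral_cst// [X in _ * X + _ <= _](_ : _ = 1) ?mulr1; last first.
  exact (congr1 fine (probability_setT mu)).
rewrite RintegralZl//; last exact: bounded_measurable_integrable.
rewrite (powRM _ (ltW e0) (ltW m0)) -/M -/q.
apply: (@le_trans _ _ (M * (q / 2) + M / (2 * m%:R ^+ 2 * q) * m%:R)).
  by rewrite lerD2l ler_pM2l// divr_gt0// !mulr_gt0// exprn_gt0.
rewrite [leRHS]mulrC -subr_ge0.
have -> : M * q - (M * (q / 2) + M / (2 * m%:R ^+ 2 * q) * m%:R) =
    M * (m%:R * q ^+ 2 - 1) / (2 * m%:R * q) by field; rewrite !gt_eqF.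
by rewrite divr_ge0 ?mulr_ge0 ?subr_ge0// ltW.
Qed.
End LpCube.

Section LpFinal.
Variables (R : realType) (mu : probability (cube omega1) R).
Hypothesis hmu : homogeneous_measure mu.
Variables (p : R) (p1 : 1 <= p).
Local Notation T := (cube omega1).
Local Notation Lf := (LfunType mu (Defs.p1e_subproof p1)).
Local Notation X := (Lp_space mu p1).
Let p0 : 0 < p. Proof. exact: lt_le_trans p1. Qed.

Definition Lp_bounded_by (a : R) : set X :=
  [set x | exists G : Lf, x = Lp_class G /\ forall t, `|G t| <= a].

Lemma Lp_bounded_by_norm a x : 0 <= a -> Lp_bounded_by a x -> `|x| <= a.
Proof.
move=> a0 [G [-> Ga]]; apply: Lp_class_norm_le => //.
exact: integral_bounded_le.
Qed.

(** Representatives bounded at every point allow the sum to be taken pointwise; the result is a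
    bounded measurable function, and the uniform tail estimate bounds the L_p norm for a probability
    measure. *)
Lemma Lp_geometric_cvg a (v : nat -> X) (l : R) : (forall n, Lp_bounded_by a (v n)) ->
  0 <= l <= 4^-1 -> cvgn (series (fun n => l ^+ n *: v n)).
Proof.
move=> va l01; have [G GP] := choice va.
have Ga t n : `|G n t| <= a by have [_] := GP n; exact.
pose h t := power_sum (fun n => G n t) l.
pose S N : Lf := \sum_(0 <= n < N) l ^+ n *: G n.
have SE N t : S N t = series (fun n => G n t * l ^+ n) N.
  by rewrite /S /series /= Lf_sumE; apply: eq_bigr => i _; rewrite Lf_scaleE mulrC.
have mh : measurable_fun setT h.
  apply: (@measurable_fun_cvg _ _ _ _ (fun N t => S N t)) => // t _.
  under eq_fun do rewrite SE.
  exact: power_sum_cvg l01 (Ga t).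
have ha t : `|h t| <= 4 / 3 * a by apply: power_sum_le.
pose H : Lf := Lf_bounded mu p1 mh ha.
pose q N : R := geometric (4 / 3 * a) 4^-1 N.
have HS N t : `|(H - S N) t| <= q N.
  by rewrite Lf_subE SE; exact: power_sum_tail.
have [t0] : inhabited T by constructor; exact: (fun=> true).
have q0 N : 0 <= q N by exact: le_trans (normr_ge0 _) (HS N t0).
apply/cvg_ex; exists (Lp_class H); apply/cvgrPdist_lt => e e0.
near=> N; apply: (@le_lt_trans _ _ (q N)).
  have -> : series (fun n => l ^+ n *: v n) N = Lp_class (S N).
    rewrite /S Lp_class_sumZ /series /=; apply: eq_bigr => n _.
    by have [->] := GP n.
  rewrite -Lp_classB; apply: Lp_bounded_by_norm => //.
  by exists (H - S N).
by near: N; exact: geometric_lt.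
Unshelve. all: by end_near. Qed.

(** The difference D of two Walsh functions takes its values in {-2, 0, 2}, so |D|^p >= D^2 / 2
    because 2^p >= 2, and orthonormality makes the integral of D^2 equal to 2. *)
Lemma walsh_class_separated (F G : {fset omega1}) : F != G ->
  1 <= `|walsh_class mu p1 F - walsh_class mu p1 G|.
Proof.
move=> FG; rewrite -Lp_classB; set D := walsh_Lf _ _ _ - _.
pose c H : R := if H == F then 1 else -1.
pose u x := \sum_(H <- [:: F; G]) c H * walsh R (enum_fset H) x.
have uE x : D x = u x.
  rewrite /u !big_cons big_nil /c eqxx eq_sym (negbTE FG) addr0 mul1r mulN1r.
  by rewrite Lf_subE.
have bw H : bounded_measurable (walsh R (enum_fset H)) by exact: bounded_measurable_walsh.
have bu : bounded_measurable u.
  by apply: bounded_measurable_sum => H; exact: bounded_measurableZ.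
have bu2 : bounded_measurable (fun x => 2^-1 * u x ^+ 2).
  apply: bounded_measurableZ.
  rewrite (_ : (fun x => u x ^+ 2) = fun x => u x * u x); first exact: bounded_measurableM.
  by apply/funext => x; rewrite expr2.
have u2 : \int[mu]_x (u x) ^+ 2 = 2.
  rewrite (second_moment_sum c bw); last first.
  - by move=> H K; exact: walsh_orthonormal.
  - by rewrite /= inE FG.
  by rewrite !big_cons big_nil /c eqxx eq_sym (negbTE FG); ring.
have ge1 : (1 <= \int[mu]_x (`|D x| `^ p)%:E)%E.
  apply: (@le_trans _ _ (\int[mu]_x (2^-1 * u x ^+ 2)%:E)%E).
    rewrite integral_bounded_measurable// RintegralZl//; last first.
      apply: bounded_measurable_integrable => //.
      rewrite (_ : (fun x => u x ^+ 2) = fun x => u x * u x); first exact: bounded_measurableM.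
      by apply/funext => x; rewrite expr2.
    by rewrite u2 mulVf.
  apply: ge0_le_integral => //.
  - by move=> x _; rewrite lee_fin mulr_ge0 ?sqr_ge0// invr_ge0.
  - by apply/measurable_EFinP; exact: bu2.1.
  - exact: measurable_norm_powR.
  - move=> x _; rewrite lee_fin uE.
    rewrite /u !big_cons big_nil /c eqxx eq_sym (negbTE FG) addr0 mul1r mulN1r.
    have := walsh_norm R (enum_fset F) x; have := walsh_norm R (enum_fset G) x.
    move: (walsh R _ x) (walsh R _ x) => g f g1 f1.
    have pm y : `|y| = 1 :> R -> y = 1 \/ y = -1.
      move/eqP; rewrite eqr_norml ler01 andbT => /orP[/eqP ->|/eqP ->]; by [left|right].
    have h2 : 2 <= 2 `^ p :> R by rewrite -{1}[2]powRr1// ler_powR// ler1n.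
    have [->|->] := pm _ f1; have [->|->] := pm _ g1.
    + by rewrite subrr expr0n mulr0 powR_ge0.
    + rewrite opprK (_ : 1 + 1 = 2)// ger0_norm// (le_trans _ h2)//; lra.
    + rewrite -opprD normrN (_ : 1 + 1 = 2)// ger0_norm// (le_trans _ h2)//; lra.
    + by rewrite subrr expr0n mulr0 powR_ge0.
move: ge1; rewrite Lp_class_norm lee_fin => ge1.
rewrite leNgt; apply/negP => lt1; move: ge1; rewrite leNgt => /negP; apply.
have -> : 1 = 1 `^ p :> R by rewrite powR1.
by apply: gt0_ltr_powR => //; rewrite nnegrE.
Qed.

Lemma Lp_admits_overcomplete : admits_overcomplete X.
Proof.
pose B := Lp_bounded_by 2.
have B1 (x : X) : x = 0 \/ range (walsh_class mu p1) x -> Lp_bounded_by 1 x.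
  move=> [->|[F _ <-]].
    by exists 0; split=> [|t]; [rewrite /Lp_class raddf0|rewrite normr0].
  by exists (walsh_Lf mu p1 F); split=> // t; rewrite walsh_LfE walsh_norm.
apply: (@small_sums_overcomplete _ _ _ (walsh_class mu p1) _
  (fun a => [set F : {fset omega1} | forall i, i \in F -> (i <= a)%O]) B 2).
- exact: walsh_small_sums.
- by move=> a; apply: countable_finite_subsets; exact: omega1_countable_below.
- by move=> a b ab F Fa i /Fa ia; exact: le_trans ab.
- move=> F; have [|g gP] := @countable_omega1_bounded [set` F].
    exact: countable_fset.
  by exists g.
- by move=> x; exact: Lp_bounded_by_norm.
- by move=> v vB l l01; exact: Lp_geometric_cvg vB l01.
- move=> x y /B1[G [-> G1]] /B1[H [-> H1]]; exists (G - H); split.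
    by rewrite Lp_classB.
  by move=> t; rewrite Lf_subE (le_trans (ler_normB _ _))// (lerD (G1 t) (H1 t)).
- exact: walsh_dense.
- apply: (@separated_nonseparable _ _ (fun a => walsh_class mu p1 [fset a]%fset) 1) => //.
  move=> a b ab; apply: walsh_class_separated; apply: contra ab => /eqP ab.
  by have := fset11 a; rewrite ab inE.
Qed.
End LpFinal.

(** * Functionals on C(K) and Radon measures *)

Section Riesz.
Variables (R : realType) (K : ptopologicalType) (cK : compact [set: K]).
Hypothesis hK : hausdorff_space K.
Variable f : {linear C_space R cK -> R^o}.
Hypothesis cf : continuous f.
Implicit Types (U V : set K) (g : C_space R cK).

Definition unit_supported U : set (C_space R cK) :=
  [set g | (forall x, `|g x| <= 1) /\ forall x, ~ U x -> g x = 0].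

(** On open sets this is the total variation of the signed measure that represents f. Its outer
    extension gives one positive measure controlling f, without a splitting of f into positive and
    negative parts. *)
Definition variation U : R := sup [set f g | g in unit_supported U].

Definition fnorm : R := sval (cid2 (linear_continuous_bound cf)).

Lemma fnorm_gt0 : 0 < fnorm. Proof. by rewrite /fnorm; case: cid2. Qed.

Lemma fnorm_le g : `|f g| <= fnorm * `|g|. Proof. by rewrite /fnorm; case: cid2. Qed.

Lemma unit_ball_le g : (forall x, `|g x| <= 1) -> f g <= fnorm.
Proof.
move=> g1; apply: le_trans (ler_norm _) _; apply: le_trans (fnorm_le g) _.
apply: ler_piMr; first exact: ltW fnorm_gt0.
by apply: C_norm_le.
Qed.

Lemma unit_supported_has_sup U : has_sup [set f g | g in unit_supported U].
Proof.
split; first by exists (f 0), 0 => //; split=> x; rewrite ?C_zeroE ?normr0.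
exists fnorm => _ [g [g1 _] <-].
exact: unit_ball_le.
Qed.

Lemma variation_ge U g : unit_supported U g -> f g <= variation U.
Proof.
by move=> Ug; apply: ub_le_sup; [have [] := unit_supported_has_sup U|exists g].
Qed.

Lemma variation_le U a : (forall g, unit_supported U g -> f g <= a) -> variation U <= a.
Proof.
move=> h; apply: ge_sup; first by have [] := unit_supported_has_sup U.
by move=> _ [g Ug <-]; exact: h.
Qed.

Lemma variation_ge0 U : 0 <= variation U.
Proof.
rewrite -(linear0 f); apply: variation_ge.
by split=> x; rewrite ?C_zeroE ?normr0.
Qed.

Lemma variation_mono U V : U `<=` V -> variation U <= variation V.
Proof.
move=> UV; apply: variation_le => g [g1 g0]; apply: variation_ge; split=> // x nVx.
by apply: g0; apply: contra_not nVx; exact: UV.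
Qed.

Lemma variation_adherent U e : 0 < e ->
  exists2 g, unit_supported U g & variation U - e < f g.
Proof.
move=> e0; have [_ [g Ug <-] h] := sup_adherent e0 (unit_supported_has_sup U).
by exists g.
Qed.

Lemma closed_level g e : closed [set x | e <= `|g x|].
Proof.
have cg : continuous (fun x => `|g x|) by move=> x; apply: cvg_norm; exact: C_continuous.
rewrite (_ : [set x | _] = (fun x => `|g x|) @^-1` [set r | e <= r])//.
by apply: closed_comp; [move=> x _; exact: cg|exact: closed_ge].
Qed.

(** Vanishing off U does not put the support inside U. A soft threshold at e / [fnorm] changes f by
    at most e and leaves a function carried by a closed, hence compact, subset of U. *)
Lemma supported_shrink U g e : 0 < e -> (forall x, ~ U x -> g x = 0) ->
  exists g' C, [/\ closed C, C `<=` U, forall x, ~ C x -> g' x = 0,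
    forall x, `|g' x| <= `|g x| & `|f g - f g'| <= e].
Proof.
move=> e0 gU; pose q := e / fnorm; have q0 : 0 < q by rewrite divr_gt0// fnorm_gt0.
pose g' : C_space R cK :=
  mkC cK (continuous_soft_threshold (e := q) (@C_continuous _ _ _ g)).
exists g', [set x | q <= `|g x|]; split.
- exact: closed_level.
- by move=> x /= qg; apply: contrapT => /gU gx; move: qg; rewrite gx normr0 leNgt q0.
- by move=> x /negP; rewrite -ltNge => /ltW; exact: soft_threshold_eq0.
- by move=> x; apply: soft_threshold_norm; exact: ltW.
- rewrite -linearB (le_trans (fnorm_le _))// mulrC -ler_pdivlMr ?fnorm_gt0//.
  by apply: C_norm_le => [|x]; [exact: ltW|apply: soft_threshold_dist; exact: ltW].
Qed.

(** An Urysohn function that is 0 on the part of C outside U and 1 on the part outside V cuts a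
    function carried by C into a piece supported in U and a piece supported in V. *)
Lemma variationU_le U V : open U -> open V ->
  variation (U `|` V) <= variation U + variation V.
Proof.
move=> oU oV; apply: variation_le => g [g1 gUV]; apply/ler_addgt0Pr => e e0.
have [g' [C [clC CUV g'C g'g]]] := supported_shrink e0 gUV.
rewrite ler_distl => /andP[_ gg'].
have [phi [cphi phi01 phi0 phi1]] :
    exists phi : K -> R, [/\ continuous phi, range phi `<=` `[0, 1]%classic,
      phi @` (C `&` ~` U) `<=` [set 0] & phi @` (C `&` ~` V) `<=` [set 1]].
  have /(@normal_separatorP R) sep := compact_normal hK cK.
  apply/uniform_separatorP; apply: sep.
  - by apply: closedI => //; exact: open_closedC.
  - by apply: closedI => //; exact: open_closedC.
  - apply/seteqP; split=> // x [[Cx nU] [_ nV]].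
    by have [] := CUV x Cx.
have p01 x : 0 <= phi x <= 1.
  by have /= := phi01 (phi x) (ex_intro2 _ _ x Logic.I erefl); rewrite in_itv.
have c1 : continuous (fun x => g' x * phi x).
  by move=> x; apply: cvgM; [exact: C_continuous|exact: cphi].
have c2 : continuous (fun x => g' x * (1 - phi x)).
  move=> x; apply: cvgM; first exact: C_continuous.
  by apply: cvgB; [exact: cvg_cst|exact: cphi].
pose g1' := mkC cK c1; pose g2' := mkC cK c2.
have g'E : g' = g1' + g2'.
  apply: val_inj; apply/funext => x.
  by transitivity (g' x * phi x + g' x * (1 - phi x)); [by rewrite -mulrDr addrCA subrr addr0 mulr1|].
have le1 a x : 0 <= a <= 1 -> `|g' x * a| <= 1.
  move=> /andP[a0 a1]; rewrite normrM (ger0_norm a0).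
  by rewrite (le_trans _ (g1 x))// (le_trans _ (g'g x))// ler_piMr.
rewrite (le_trans gg')// lerD2r g'E linearD lerD//; apply: variation_ge.
- split=> x; first exact: le1.
  move=> nU; rewrite mkCE; have [Cx|nC] := pselect (C x); last by rewrite g'C// mul0r.
  by have -> : phi x = 0; [apply: phi0; exists x|rewrite mulr0].
- split=> x; first by apply: le1; have /andP[? ?] := p01 x; apply/andP; split; lra.
  move=> nV; rewrite mkCE; have [Cx|nC] := pselect (C x); last by rewrite g'C// mul0r.
  by have -> : phi x = 1; [apply: phi1; exists x|rewrite subrr mulr0].
Qed.

(** A nearly optimal function is carried by a compact set, which finitely many of the [U n] cover,
    so finite subadditivity is enough. *)
Lemma variation_bigcup_le (U : nat -> set K) : (forall n, open (U n)) ->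
  ((variation (\bigcup_n U n))%:E <= \sum_(n <oo) (variation (U n))%:E)%E.
Proof.
move=> oU; set S := (\sum_(n <oo) _)%E.
have fin N : variation (\big[setU/set0]_(n < N) U n) <= \sum_(n < N) variation (U n).
  elim: N => [|N IHN].
    rewrite !big_ord0; apply: variation_le => g [_ g0].
    rewrite (_ : g = 0) ?linear0//; apply: val_inj; apply/funext => x.
    by rewrite /= g0.
  rewrite !big_ord_recr /= (le_trans (variationU_le _ _))// ?lerD2r//.
  by rewrite -bigcup_mkord; apply: bigcup_open => i _; exact: oU.
have finS N : ((variation (\big[setU/set0]_(n < N) U n))%:E <= S)%E.
  apply: (@le_trans _ _ (\sum_(n < N) (variation (U n))%:E)%E).
    by rewrite sumEFin lee_fin.
  rewrite -(big_mkord xpredT (fun n => (variation (U n))%:E)).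
  by apply: nneseries_lim_ge => n _ _; rewrite lee_fin variation_ge0.
case: S finS => [s|_|/(_ 0%N)]; last 2 first.
- exact: leey.
- by rewrite leeNy_eq.
move=> finS; rewrite lee_fin; apply: variation_le => g [g1 gU].
apply/ler_addgt0Pr => e e0.
have [g' [C [clC CU g'C g'g]]] := supported_shrink e0 gU.
rewrite ler_distl => /andP[_ gg']; rewrite (le_trans gg')// lerD2r.
have /compact_near_coveringP cC := subclosed_compact clC cK (@subsetT _ C).
have [x Cx|N _ /(_ N (leqnn N)) CN] := cC nat \oo (fun n x => (\big[setU/set0]_(k < n) U k) x) _.
  have [n _ Unx] := CU x Cx.
  exists (U n, [set m | (n < m)%N]).
    by split; [apply: open_nbhs_nbhs; split=> //; exact: oU|exists n.+1].
  move=> [y m] [/= Uny nm]; rewrite -bigcup_mkord; by exists n.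
rewrite -lee_fin; apply: le_trans (finS N); rewrite lee_fin; apply: variation_ge; split.
  by move=> x; exact: le_trans (g'g x) (g1 x).
by move=> x nx; apply: g'C => /CN.
Qed.
End Riesz.

Section RieszMeasure.
Local Open Scope ereal_scope.
Variables (R : realType) (K : ptopologicalType) (cK : compact [set: K]).
Hypothesis hK : hausdorff_space K.
Variable f : {linear C_space R cK -> R^o}.
Hypothesis cf : continuous f.

Definition variation_outer (A : set K) : \bar R :=
  ereal_inf [set (variation f U)%:E | U in [set U | open U /\ A `<=` U]].

Lemma variation_outer_le A U : open U -> A `<=` U ->
  variation_outer A <= (variation f U)%:E.
Proof. by move=> oU AU; apply: ereal_inf_lbound; exists U. Qed.

Lemma le_variation_outer A (a : \bar R) :
  (forall U, open U -> A `<=` U -> a <= (variation f U)%:E) -> a <= variation_outer A.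
Proof. by move=> h; apply: le_ereal_inf_tmp => _ [U [oU AU] <-]; exact: h. Qed.

Lemma variation_outer_ge0 A : 0 <= variation_outer A.
Proof. by apply: le_variation_outer => U _ _; rewrite lee_fin variation_ge0. Qed.

Lemma variation_outer_open U : open U -> variation_outer U = (variation f U)%:E.
Proof.
move=> oU; apply/eqP; rewrite eq_le variation_outer_le//=.
by apply: le_variation_outer => V oV UV; rewrite lee_fin variation_mono.
Qed.

Lemma variation_outer_mono : {homo variation_outer : A B / A `<=` B >-> A <= B}.
Proof.
move=> A B AB; apply: le_variation_outer => U oU BU.
by apply: variation_outer_le => //; exact: subset_trans BU.
Qed.

Lemma variation_outer_lty A : variation_outer A < +oo.
Proof.
by apply: le_lt_trans (variation_outer_le openT (@subsetT _ A)) _; exact: ltry.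
Qed.

Lemma variation_outer_fin A : variation_outer A \is a fin_num.
Proof. by rewrite ge0_fin_numE ?variation_outer_ge0 ?variation_outer_lty. Qed.

Lemma variation_outer_adherent A (e : R) : (0 < e)%R ->
  exists U, [/\ open U, A `<=` U & (variation f U)%:E <= variation_outer A + e%:E].
Proof.
move=> e0; have [_ [U [oU AU] <-] /ltW h] := lb_ereal_inf_adherent e0 (variation_outer_fin A).
by exists U.
Qed.

Lemma variation_outer0 : variation_outer set0 = 0.
Proof.
rewrite variation_outer_open//; last exact: open0.
congr (_%:E); apply/eqP; rewrite eq_le (variation_ge0 cf) andbT.
apply: (variation_le cf) => g [_ g0].
rewrite (_ : g = 0%R) ?linear0//; apply: val_inj; apply/funext => x.
by rewrite /= g0.
Qed.

Lemma variation_outer_sigma_subadditive : sigma_subadditive variation_outer.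
Proof.
move=> A; apply/lee_addgt0Pr => e e0.
have ex n : exists U, [/\ open U, A n `<=` U &
    (variation f U)%:E <= variation_outer (A n) + (e / (2 ^ n.+1)%:R)%:E].
  by apply: variation_outer_adherent; rewrite divr_gt0// ltr0n expn_gt0.
have [U UP] := choice ex.
have oU n : open (U n) by have [] := UP n.
apply: (@le_trans _ _ (variation f (\bigcup_n U n))%:E).
  apply: variation_outer_le; first exact: bigcup_open.
  by apply: subset_bigcup => n _; have [] := UP n.
apply: (le_trans (variation_bigcup_le hK cf oU)).
apply: le_trans (epsilon_trick xpredT _ (ltW e0)); last first.
  by move=> n; exact: variation_outer_ge0.
apply: lee_nneseries => [n _ _|n _].
  by rewrite lee_fin (variation_ge0 cf).
by have [_ _ h] := UP n; exact: h.
Qed.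

HB.instance Definition _ := isOuterMeasure.Build R K variation_outer
  variation_outer0 variation_outer_ge0 variation_outer_mono
  variation_outer_sigma_subadditive.

(** A nearly optimal function for the intersection of U and V, shrunk to a closed carrier C, and a
    nearly optimal one for U minus C have disjoint carriers, so their sum is still admissible for U.
    The shrinking and the two choices cost e / 3 each. *)
Lemma open_caratheodory V : open V -> variation_outer.-caratheodory V.
Proof.
move=> oV; apply: le_caratheodory_measurable => A.
apply: le_variation_outer => U oU AU.
apply/lee_addgt0Pr => e e0; have e3 : (0 < e / 3)%R by rewrite divr_gt0.
have oUV : open (U `&` V) by exact: openI.
have [g [g1 gUV] fg] := variation_adherent cf (U `&` V) e3.
have [g' [C [clC CUV g'C g'g fgg']]] := supported_shrink cf e3 gUV.
have oUC : open (U `\` C) by apply: openI => //; exact: closed_openC.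
have [h [h1 hUC] fh] := variation_adherent cf (U `\` C) e3.
have le1 : variation_outer (A `&` V) <= (variation f (U `&` V))%:E.
  by apply: variation_outer_le => //; exact: setSI.
have le2 : variation_outer (A `&` ~` V) <= (variation f (U `\` C))%:E.
  apply: variation_outer_le => // x [Ax nVx]; split; first exact: AU.
  by move=> /CUV[].
apply: (le_trans (leeD le1 le2)); rewrite -!EFinD lee_fin.
have : (f (g' + h) <= variation f U)%R.
  apply: (variation_ge cf); split=> x; rewrite C_addE.
    have [Cx|nC] := pselect (C x).
      by rewrite (hUC x) ?addr0 ?(le_trans (g'g x))// => -[_].
    by rewrite g'C// add0r.
  move=> nU; rewrite (hUC x) ?addr0; last by case.
  by apply: g'C => /CUV[].
rewrite linearD /=; move: fgg'; rewrite ler_distl => /andP[_ fgg'].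
have h3 : (3 * (e / 3) = e)%R by field.
lra.
Qed.

Definition riesz_measure : set (borel K) -> \bar R := variation_outer.

Lemma borel_caratheodory (A : set (borel K)) : measurable A ->
  variation_outer.-caratheodory A.
Proof.
apply: smallest_sub; last by move=> V oV; exact: open_caratheodory.
split.
- exact: caratheodory_measurable_set0.
- by move=> B mB; rewrite setTD; exact: caratheodory_measurable_setC.
- by move=> F mF; exact: caratheodory_measurable_bigcup.
Qed.

Let riesz_measure0 : riesz_measure set0 = 0.
Proof. exact: variation_outer0. Qed.

Let riesz_measure_ge0 A : 0 <= riesz_measure A.
Proof. exact: variation_outer_ge0. Qed.

Let riesz_measure_sigma_additive : semi_sigma_additive riesz_measure.
Proof.
move=> F mF tF mbF.
apply: (@caratheodory_measure_sigma_additive _ _ variation_outer) => //.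
- by move=> n; exact: borel_caratheodory.
- exact: borel_caratheodory.
Qed.

HB.instance Definition _ := isMeasure.Build _ (borel K) R riesz_measure
  riesz_measure0 riesz_measure_ge0 riesz_measure_sigma_additive.

Let riesz_measure_fin : fin_num_fun riesz_measure.
Proof. by move=> A _; exact: variation_outer_fin. Qed.

HB.instance Definition _ := Measure_isFinite.Build _ (borel K) R riesz_measure
  riesz_measure_fin.

Let m : {finite_measure set (borel K) -> \bar R} := riesz_measure.

(** Inner regularity is outer regularity of the complement: the complement of an open set is
    compact, and the measure is finite. *)
Lemma riesz_measure_radon : radon m.
Proof.
move=> A mA; apply/eqP; rewrite eq_le; apply/andP; split; last first.
  apply: ge_ereal_sup => _ [C [_ CA] <-].
  exact: variation_outer_mono.
have fin (B : set (borel K)) : m B \is a fin_num by exact: variation_outer_fin.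
apply/lee_addgt0Pr => e e0.
have [U [oU AU Ue]] := variation_outer_adherent (~` A) e0.
have mU : measurable (U : set (borel K)) by exact: sub_gen_smallest.
have cU : compact (~` U).
  by apply: subclosed_compact (open_closedC oU) cK _.
apply: (@le_trans _ _ (m (~` U) + e%:E)); last first.
  rewrite leeD2r//; apply: ereal_sup_ubound; exists (~` U) => //.
  by split=> // x nUx; apply: contrapT => nAx; apply: nUx; exact: AU.
have mT (B : set (borel K)) : measurable B -> m setT = m B + m (~` B).
  by move=> mB; rewrite -measureU ?setUv ?setICr//; exact: measurableC.
have := mT A mA; rewrite (mT _ mU).
have : m U <= m (~` A) + e%:E by rewrite /m /= /riesz_measure variation_outer_open.
rewrite -(fineK (fin A)) -(fineK (fin U)) -(fineK (fin (~` A))) -(fineK (fin (~` U))).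
rewrite -!EFinD !lee_fin => h1 [h2]; lra.
Qed.

(** Each point off the support has an open neighbourhood of measure 0, and open null sets are closed
    under finite unions, so a compact carrier of [g'] lies in one of them. The variation is 0 there,
    and it bounds f on small multiples of [g'] of both signs. *)
Lemma riesz_measure_support (g : C_space R cK) :
  (forall x, measure_support m x -> g x = 0%R) -> f g = 0%R.
Proof.
move=> g0; apply/normr0_eq0/eqP; rewrite eq_le normr_ge0 andbT.
apply/ler_addgt0Pr => e e0; rewrite add0r.
have gW x : ~ (~` measure_support m) x -> g x = 0%R by move=> /contrapT; exact: g0.
have [g' [C [clC CW g'C g'g fgg']]] := supported_shrink cf e0 gW.
suff fg'0 : f g' = 0%R by move: fgg'; rewrite fg'0 subr0.
pose N : set (set K) := [set U | open U /\ m U = 0].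
have N0 : N set0 by split; [exact: open0|exact: measure0].
have NU U V : N U -> N V -> N (U `|` V).
  move=> [oU U0] [oV V0]; split; first exact: openU.
  have mo W : open W -> measurable (W : set (borel K)) by move=> oW; exact: sub_gen_smallest.
  apply/eqP; rewrite eq_le measure_ge0 andbT.
  apply: le_trans (measureU2 _ (mo _ oU) (mo _ oV)) _.
  by rewrite [X in X + _ <= _]U0 [X in _ + X <= _]V0 adde0.
have [V [oV V0] CV] : exists2 V, N V & C `<=` V.
  have /compact_near_coveringP cC := subclosed_compact clC cK (@subsetT _ C).
  pose F := filter_from N (fun U => [set V | U `<=` V]).
  have FF : Filter F.
    apply: filter_from_filter; first by exists set0.
    move=> U V NUU NV; exists (U `|` V); first exact: NU.
    by move=> W /=; rewrite subUset => -[].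
  have [x Cx|V NV h] := cC _ F (fun U x => U x) FF; last by exists V => //; exact: h.
  have /existsNP[U /not_implyP[oU /not_implyP[Ux /negP]]] := CW x Cx.
  rewrite -leNgt => U0.
  exists (U, [set V | U `<=` V]).
    split; first by apply: open_nbhs_nbhs.
    by exists U => //; split=> //; apply/eqP; rewrite eq_le U0 measure_ge0.
  by move=> [y W] [/= Uy UW]; exact: UW.
have V0' : variation f V = 0%R.
  by apply: EFin_inj; rewrite -variation_outer_open//; exact: V0.
pose M := (1 + `|g'|)%R; have M0 : (0 < M)%R by rewrite ltr_pwDl.
have unit_V (c : R) : (`|c| <= M^-1)%R -> (f (c *: g') <= 0)%R.
  move=> cM; rewrite -V0'; apply: (variation_ge cf); split=> x; rewrite C_scaleE.
    rewrite normrM (le_trans (ler_pM _ _ cM (C_norm_ge g' x)))//.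
    by rewrite mulrC ler_pdivrMr// mul1r /M lerDr.
  by move=> nV; rewrite g'C ?mulr0// => /CV.
have := unit_V M^-1%R; rewrite gtr0_norm ?invr_gt0// => /(_ (lexx _)).
have := unit_V (- M^-1)%R; rewrite normrN gtr0_norm ?invr_gt0// => /(_ (lexx _)).
rewrite scaleNr linearN linearZ /= oppr_le0 => h1 h2.
have : (M^-1 *: f g' : R^o)%R = 0%R by apply/eqP; rewrite eq_le h1 h2.
by move/eqP; rewrite scaler_eq0 invr_eq0 gt_eqF//= => /eqP.
Qed.

Lemma functional_support : exists m : {finite_measure set (borel K) -> \bar R},
  radon m /\ forall g : C_space R cK, (forall x, measure_support m x -> g x = 0%R) -> f g = 0%R.
Proof. by exists m; split; [exact: riesz_measure_radon|exact: riesz_measure_support]. Qed.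
End RieszMeasure.

(** * Corson compact spaces *)

Lemma ptws_cvgP (R : realType) (G : Type) (F : set_system (G -> R)) (z : G -> R) : Filter F ->
  {ptws, F --> z} <-> forall g, f g @[f --> F] --> z g.
Proof. exact: (@pointwise_cvgP (discrete_topology {classic G}) R F z). Qed.

Definition clamp (R : realType) (t : R) : R := Num.max 0 (Num.min 1 t).

Lemma clamp_ge1 (R : realType) (t : R) : 1 <= t -> clamp t = 1.
Proof. by move=> t1; rewrite /clamp (min_idPl t1) (max_idPr ler01). Qed.

Lemma clamp_le0 (R : realType) (t : R) : t <= 0 -> clamp t = 0.
Proof. by move=> t0; rewrite /clamp (min_idPr (le_trans t0 ler01)) (max_idPl t0). Qed.

Lemma le_clamp (R : realType) (s t : R) : s <= t -> clamp s <= clamp t.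
Proof.
by move=> st; rewrite /clamp ge_max !le_max lexx /= le_min !ge_min lexx /= st !orbT.
Qed.

Lemma continuous_clamp (R : realType) (T : topologicalType) (f : T -> R) :
  continuous f -> continuous (fun t => clamp (f t)).
Proof.
move=> cf t; apply: (@continuous_max R T (cst 0) (fun t => Num.min 1 (f t))); first exact: cvg_cst.
by apply: (@continuous_min R T (cst 1) f); [exact: cvg_cst|exact: cf].
Qed.

Section Coordinates.
Variables (R : realType) (K : topologicalType) (cK : compact [set: K]).
Variables (G : Type) (h : K -> {ptws G -> R}).
Hypothesis hopen : forall U : set K, open U <->
  exists2 V : set {ptws G -> R}, open V & U = h @^-1` V.

Lemma coordinate_continuous g : continuous (fun x => h x g : R).
Proof.
have ch : continuous h.
  by apply/continuousP => V oV; apply/hopen; exists V.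
move=> x; have /ptws_cvgP/(_ g) : {ptws, h @ nbhs x --> h x} by exact: ch.
exact.
Qed.

(** These are the basic entourages of the uniformity that the coordinates induce on K. *)
Definition close (F : seq G) (d : R) (x y : K) : bool := all (fun g => `|h x g - h y g| < d) F.

Lemma close_catP F F' d d' x y : 
  close (F ++ F') (Num.min d d') x y -> close F d x y /\ close F' d' x y.
Proof.
rewrite /close all_cat => /andP[c c']; split; [apply: sub_all c|apply: sub_all c'] => g /=;
  by rewrite lt_min => /andP[].
Qed.

Lemma close_trans F d x y z : close F (d / 2) x y -> close F (d / 2) y z -> close F d x z.
Proof.
elim: F => //= g F IHF /andP[xy /IHF{}IHF] /andP[yz /IHF ->].
rewrite andbT [d]splitr (le_lt_trans _ (ltrD xy yz))//.
by rewrite (le_trans _ (ler_normD _ _))// addrA subrK.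
Qed.

Lemma near_close F d x : 0 < d -> \forall y \near x, close F d x y.
Proof.
move=> d0; elim: F => [|g F IHF]; first by apply: nearW => y.
have := @coordinate_continuous g x; move=> /cvgrPdist_lt/(_ _ d0).
by apply: filterS2 IHF => y /= cF ->.
Qed.

Lemma nbhs_close x (U : set K) : nbhs x U ->
  exists F d, 0 < d /\ forall y, close F d x y -> U y.
Proof.
rewrite nbhsE => -[U' [/hopen[V oV U'V] U'x] U'U].
(* The filter generated by the coordinate neighbourhoods of x converges under h to h x, so every set
   open for the topology induced by h that contains x contains one of them. *)
pose B : set_system K := filter_from [set Fd : seq G * R | 0 < Fd.2]
  (fun Fd => [set y | close Fd.1 Fd.2 x y]).
have FB : Filter B.
  apply: filter_from_filter; first by exists ([::], 1) => /=.
  move=> [F d] [F' d'] /= d0 d'0; exists (F ++ F', Num.min d d').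
    by rewrite /= lt_min d0.
  by move=> y /= /close_catP.
have /(_ V) [] : {ptws, h @ B --> h x}.
- apply/ptws_cvgP => g; apply/cvgrPdist_lt => e e0.
  by exists ([:: g], e) => //= y; rewrite /= andbT.
- by apply: open_nbhs_nbhs; split=> //; move: U'x; rewrite U'V.
- move=> [F d] /= d0 FV; exists F, d; split=> // y /FV Vy.
  by apply: U'U; rewrite U'V.
Qed.

(** The Heine-Cantor theorem for the uniformity of the coordinates: compactness is applied along the
    filter of ever finer pairs (F, d), and d is halved for the triangle inequality. *)
Lemma uniform_close (u : K -> R) (e : R) : continuous u -> 0 < e ->
  exists F d, 0 < d /\ forall x y, close F d x y -> `|u x - u y| < e.
Proof.
move=> cu e0; have e2 : 0 < e / 2 by rewrite divr_gt0.
pose B : set_system (seq G * R) := filter_from [set Fd : seq G * R | 0 < Fd.2]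
  (fun Fd => [set Fd' | forall x y, close Fd'.1 Fd'.2 x y -> close Fd.1 Fd.2 x y]).
have FB : Filter B.
  apply: filter_from_filter; first by exists ([::], 1) => /=.
  move=> [F d] [F' d'] /= d0 d'0; exists (F ++ F', Num.min d d').
    by rewrite /= lt_min d0.
  by move=> [F'' d''] /= c; split=> x y /c /close_catP[].
have /compact_near_coveringP cov := cK.
have [x _|[F d] /= d0 FdP] := cov _ B
  (fun Fd x => forall y, close Fd.1 Fd.2 x y -> `|u x - u y| < e) FB; last first.
  by exists F, d; split=> // x y xy; apply: (FdP (F, d)).
have /nbhs_close[F [d [d0 Fdx]]] : nbhs x [set y | `|u x - u y| < e / 2].
  by have := cu x; move=> /cvgrPdist_lt; exact.
exists ([set x' | close F (d / 2) x x'],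
        [set Fd' | forall x y, close Fd'.1 Fd'.2 x y -> close F (d / 2) x y]) => /=.
  split; first by apply: near_close; rewrite divr_gt0.
  by exists (F, d / 2) => //=; rewrite divr_gt0.
move=> [x' Fd] /= [xx' FdP] y /FdP x'y.
have h1 : `|u x - u y| < e / 2 by apply: Fdx; exact: close_trans x'y.
have h2 : `|u x - u x'| < e / 2.
  apply: Fdx; apply: sub_all xx' => g /lt_trans; apply; lra.
have -> : u x' - u y = (u x - u y) - (u x - u x') by ring.
by rewrite (le_lt_trans (ler_normB _ _))// [e]splitr ltrD.
Qed.

Definition C_mul (u v : C_space R cK) : C_space R cK :=
  mkC cK (fun x => cvgM (@C_continuous R K cK u x) (@C_continuous R K cK v x)).

Lemma C_mulE u v x : C_mul u v x = u x * v x. Proof. by []. Qed.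

Fact ramp_continuous (p : G * (nat * int)) :
  continuous (fun x => clamp (p.2.1%:R * h x p.1 - p.2.2%:~R) - clamp (- p.2.2%:~R : R)).
Proof.
move=> x; apply: cvgB; last exact: cvg_cst.
apply: (@continuous_clamp R K (fun x => p.2.1%:R * h x p.1 - p.2.2%:~R)) => {}x.
by apply: cvgB; [apply: cvgMr; exact: coordinate_continuous|exact: cvg_cst].
Qed.

(* The constant is subtracted so that a ramp vanishes where its coordinate does:
   otherwise the products of ramps would not be weakly countably supported. *)
Definition ramp p : C_space R cK := mkC cK (@ramp_continuous p).

Lemma ramp0 p x : h x p.1 = 0 -> ramp p x = 0.
Proof. by move=> h0; rewrite mkCE h0 mulr0 sub0r subrr. Qed.

Definition ramp_product (s : seq (G * (nat * int))) : C_space R cK :=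
  foldr C_mul (C_cst cK 1) (map ramp s).

Lemma ramp_product_cons p s x : ramp_product (p :: s) x = ramp p x * ramp_product s x.
Proof. by []. Qed.

Lemma ramp_product_cat s s' x :
  ramp_product (s ++ s') x = ramp_product s x * ramp_product s' x.
Proof.
elim: s => [|p s IHs]; first by rewrite mkCE mul1r.
by rewrite cat_cons !ramp_product_cons IHs mulrA.
Qed.

Lemma ramp_product0 s x : has (fun p => h x p.1 == 0) s -> ramp_product s x = 0.
Proof.
elim: s => // p s IHs /orP[/eqP/ramp0 p0|/IHs s0]; rewrite ramp_product_cons.
  by rewrite p0 mul0r.
by rewrite s0 mulr0.
Qed.

Definition ramp_span := lspan (range ramp_product).

Lemma C_eq (u v : C_space R cK) : (forall x, u x = v x) -> u = v.
Proof. by move=> uv; apply: val_inj; apply/funext. Qed.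

Lemma ramp_span_mul u v : ramp_span u -> ramp_span v -> ramp_span (C_mul u v).
Proof.
move=> [m [c [z [zs ->]]]] [n [c' [z' [zs' ->]]]].
have -> : C_mul (\sum_i c i *: z i) (\sum_j c' j *: z' j) =
    \sum_i c i *: (\sum_j c' j *: C_mul (z i) (z' j)).
  apply: C_eq => x; rewrite C_mulE !C_sumE big_distrl; apply: eq_bigr => i _.
  rewrite !C_scaleE C_sumE !big_distrr; apply: eq_bigr => j _.
  by rewrite !C_scaleE C_mulE /=; ring.
apply: lspan_sum => i; apply: lspan_sum => j; apply: lspan_sub.
have [s _ <-] := zs i; have [s' _ <-] := zs' j.
by exists (s ++ s') => //; apply: C_eq => x; rewrite ramp_product_cat.
Qed.

Definition partition_of_unity (P : K -> K -> bool) (I : Type) (r : seq I) (q : I -> C_space R cK) :=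
  [/\ forall i, ramp_span (q i), forall i x, 0 <= q i x, 
      forall x, \sum_(i <- r) q i x = 1 &
      forall i x y, q i x != 0 -> q i y != 0 -> P x y].

(** Differences of unit ramps in n h(x, g), shifted by consecutive integers, telescope to 1. Each
    lives where h(x, g) stays in an interval of length 2/n, so n > 2/d makes it fine enough; N
    exceeds |n h(x, g)| by more than 1, so that the ends of the telescope are exactly 1 and 0. *)
Lemma partition_of_unity_coordinate g (d : R) : 0 < d ->
  exists (r : seq nat) q, partition_of_unity (close [:: g] d) r q.
Proof.
move=> d0.
have ch : continuous (fun x => h x g : R) by exact: coordinate_continuous.
pose n := (Num.truncn (2 / d)).+1.
have n0 : 0 < n%:R :> R by rewrite ltr0n.
have nd : 2 < n%:R * d.
  by rewrite -ltr_pdivrMr// truncnS_gt.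
pose N := (Num.truncn (n%:R * `|mkC cK ch|)).+2.
have hN x : `|n%:R * h x g| < N%:R - 1.
  rewrite /N -[in X in _ < X]natr1 addrK normrM (ger0_norm (ltW n0)) (le_lt_trans _ (truncnS_gt _))//.
  by rewrite ler_pM2l//; exact: (C_norm_ge (mkC cK ch)).
pose a i x : R := n%:R * h x g - i%:R + N%:R.
pose b i : int := i%:Z - N%:Z.
(* The multiple of the constant function restores what the two ramps subtract. *)
pose q i : C_space R cK := ramp (g, (n, b i)) - ramp (g, (n, b i.+1)) +
  (clamp (- (b i)%:~R : R) - clamp (- (b i.+1)%:~R)) *: C_cst cK 1.
have qE i x : q i x = clamp (a i x) - clamp (a i.+1 x).
  rewrite /q C_addE C_subE C_scaleE !mkCE mulr1 /=.
  have aE j : n%:R * h x g - (b j)%:~R = a j x by rewrite /b /a intrD intrN; ring.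
  rewrite !aE; ring.
exists (index_iota 0 (N + N)), q; split.
- move=> i; rewrite /q; have sp s : ramp_span (ramp_product s).
    by apply: lspan_sub; exists s.
  have r1 p : ramp p = ramp_product [:: p].
    by apply: C_eq => x; rewrite [RHS]C_mulE mkCE [C_cst _ _ x]mkCE mulr1.
  rewrite addrC; apply: lspan_addZ; first exact: (sp [::]).
  rewrite addrC -scaleN1r; apply: lspan_addZ; rewrite r1; exact: sp.
- move=> i x; rewrite qE subr_ge0; apply: le_clamp.
  by rewrite /a -natr1; lra.
- move=> x; under eq_bigr do rewrite qE.
  rewrite (telescope_sumr_eq (fun i => - clamp (a i x)))//; last first.
    by move=> i _; rewrite opprK addrC.
  have := hN x; rewrite ltr_norml => /andP[h1 h2].
  by rewrite opprK clamp_le0 ?clamp_ge1 ?oppr0 ?add0r// /a ?natrD; lra.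
- have supp i x : q i x != 0 -> -1 < a i.+1 x < 1.
    rewrite qE => nz; rewrite !ltNge; apply/andP; split; apply: contraNN nz => ax.
    + by rewrite !clamp_le0 ?subrr// /a; move: ax; rewrite /a -natr1; lra.
    + by rewrite !clamp_ge1 ?subrr// /a; move: ax; rewrite /a -natr1; lra.
  move=> i x y /supp /andP[x1 x2] /supp /andP[y1 y2]; rewrite /= andbT.
  rewrite -(ltr_pM2l n0) (le_lt_trans _ nd)// -[X in X * `|_|](ger0_norm (ltW n0)) -normrM.
  rewrite mulrBr ler_norml; move: x1 x2 y1 y2; rewrite /a => *; apply/andP; split; lra.
Qed.

Lemma partition_of_unity_close F (d : R) : 0 < d ->
  exists (I : Type) (r : seq I) q, partition_of_unity (close F d) r q.
Proof.
move=> d0; elim: F => [|g F [I [r [q [qs q0 q1 qP]]]]].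
  exists unit, [:: tt], (fun=> C_cst cK 1); split=> //.
  - by move=> _; apply: lspan_sub; exists [::].
  - by move=> x; rewrite big_cons big_nil addr0.
have [r' [q' [qs' q0' q1' qP']]] := partition_of_unity_coordinate g d0.
exists (nat * I)%type, [seq (i, j) | i <- r', j <- r], (fun ij => C_mul (q' ij.1) (q ij.2)).
split.
- by move=> ij; exact: ramp_span_mul.
- by move=> ij x; rewrite C_mulE mulr_ge0.
- move=> x; rewrite big_allpairs /= -[RHS]mulr1 -{1}(q1' x) -(q1 x) big_distrlr /=.
  by apply: eq_bigr => i _; apply: eq_bigr.
- move=> [i j] x y; rewrite !C_mulE !mulf_eq0 !negb_or => /andP[/= x1 x2] /andP[y1 y2].
  by have := qP' i x y x1 y1; rewrite /= andbT => ->; exact: qP x2 y2.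
Qed.

(** Approximation of Stone-Weierstrass type: on a partition of unity fine enough for u, one value of
    u for each member gives the coefficients, and every member is itself in the span of the
    products. *)
Lemma ramp_products_linearly_dense : linearly_dense (range ramp_product).
Proof.
apply: C_linearly_denseP => u e e0.
have [F [d [d0 ud]]] := uniform_close (@C_continuous R K cK u) e0.
have [I [r [q [qs q0 q1 qP]]]] := partition_of_unity_close F d0.
have /choice[x xP] : forall i, exists x : R, forall y, q i y != 0 -> `|u y - x| <= e.
  move=> i; have [[z qz]|no] := pselect (exists z, q i z != 0).
    by exists (u z) => y qy; apply/ltW/ud; exact: qP qz.
  by exists 0 => y qy; case: no; exists y.
exists (\sum_(i <- r) x i *: q i) => [|t].
  exact: lspan_sum.
have -> : u t - (\sum_(i <- r) x i *: q i) t = \sum_(i <- r) (u t - x i) * q i t.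
  under [RHS]eq_bigr do rewrite mulrBl.
  by rewrite sumrB -mulr_sumr q1 mulr1 C_sumE.
rewrite (le_trans (ler_norm_sum _ _ _))// -[leRHS]mulr1 -(q1 t) big_distrr /=.
apply: ler_sum => i _; rewrite normrM (ger0_norm (q0 i t)).
have [->|qt] := eqVneq (q i t) 0; first by rewrite !mulr0.
by rewrite ler_wpM2r//; exact: xP.
Qed.

End Coordinates.

Lemma countable_all (T : Type) (U : countType) (A : set T) : countable A ->
  countable [set s : seq (T * U) | forall p, List.In p s -> A p.1].
Proof.
move=> /countable_injP[f finj]; apply/countable_injP.
exists (fun s => choice.pickle [seq (f p.1, p.2) | p <- s]) => s s'.
move=> + + /(pcan_inj choice.pickleK).
elim: s s' => [|[t u] s IHs] [|[t' u'] s'] //; rewrite !inE => sA s'A [] ft -> /IHs ->.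
- congr ((_, _) :: _); apply: finj ft; rewrite inE.
    by apply: (sA (t, u)); left.
  by apply: (s'A (t', u')); left.
- by rewrite inE => q qs; apply: sA; right.
- by rewrite inE => q qs; apply: s'A; right.
Qed.

Lemma corson_WLD (R : realType) (K : ptopologicalType) (cK : compact [set: K]) :
  hausdorff_space K -> corson R K -> radon_separable_supports R K -> WLD (C_space R cK).
Proof.
move=> hK [G [h [hc _ hopen]]] sepK.
exists (range (ramp_product cK hopen)); first exact: ramp_products_linearly_dense.
move=> f cf; have [m [mR fm]] := functional_support hK cf.
have [D cD [_ mD]] := sepK m mR.
(* A coordinate outside A vanishes on D, hence by continuity on its closure, which contains the
   support. *)
pose A := \bigcup_(x in D) [set g | h x g != 0].
have cA : countable A by apply: bigcup_countable.
have hA g x : ~ A g -> measure_support m x -> h x g = 0.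
  move=> nA /mD; have clg : closed [set x | h x g = 0].
    apply: (@preimage_closed _ _ (fun x => h x g : R) [set t | t = 0]); last exact: (@closed_eq R).
    by move=> y _; apply: coordinate_continuous.
  rewrite closureE => /(_ [set x | h x g = 0]); apply; split=> // y Dy.
  by apply: contrapT => /eqP hyg; apply: nA; exists y.
have := countable_all (nat * int)%type cA.
apply: sub_countable.
apply: (@card_le_trans _ _ _ (ramp_product cK hopen @` [set s | forall p, List.In p s -> A p.1])); last exact: card_image_le.
apply: subset_card_le => _ [[s _ <-] fs]; exists s => // p ps.
(* One factor with a coordinate outside A makes the whole product vanish on the support, so f kills
   it; the products that remain are indexed by finite lists over a countable set. *)
apply: contrapT => nA; move/eqP: fs; apply; apply: fm => x mx.
apply: ramp_product0; elim: s ps => //= q s IHs [->|/IHs ->]; last by rewrite orbT.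
by rewrite hA ?eqxx.
Qed.

Theorem theorem11 (R : realType) :
  (* (1) *)
  (forall X : completeNormedModType R,
     WLD X -> has_dens X [set: omega1] -> admits_overcomplete X) /\
  (* (1a) *)
  (forall (p : R) (p1 : 1 < p),
     admits_overcomplete (ellp_space omega1 (ltW p1))) /\
  (forall mu : probability (cube omega1) R, homogeneous_measure mu ->
     forall (p : R) (p1 : 1 < p),
       admits_overcomplete (Lp_space mu (ltW p1))) /\
  (* (1b) *)
  (forall mu : probability (cube omega1) R, homogeneous_measure mu ->
     admits_overcomplete (Lp_space mu (lexx (1 : R)))) /\
  (* (1c) *)
  admits_overcomplete (c0_space omega1 R) /\
  (* (1d) *)
  (forall (K : ptopologicalType) (cK : compact [set: K]),
     hausdorff_space K -> corson R K -> radon_separable_supports R K ->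
     has_dens (C_space R cK) [set: omega1] ->
     admits_overcomplete (C_space R cK)) /\
  (* (2) *)
  admits_overcomplete (C_space R omega1_succ_compact) /\
  (* (3) *)
  (forall S : set omega1, locally_compact [set: omega1_isolating S] ->
     admits_overcomplete
       (C_space R (@one_point_compactification_compact (omega1_isolating S)))).
Proof.
split=> [X|].
  apply: WLD_admits_overcomplete => M v l vM l01.
  exact: complete_geometric_cvg vM l01.
split=> [p p1|]; first exact: ellp_admits_overcomplete.
split=> [mu hmu p p1|]; first exact: Lp_admits_overcomplete.
split=> [mu hmu|]; first exact: Lp_admits_overcomplete.
split; first exact: c0_admits_overcomplete.
split=> [K cK hK corK sepK|].
  apply: WLD_admits_overcomplete; first exact: C_geometric_cvg.
  exact: corson_WLD.
split; first exact: omega1_succ_admits_overcomplete.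
by move=> S lcS; exact: isolating_admits_overcomplete.
Qed.
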